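(* Let $n\ge2$ and let $x:M^n\to\mathbb R^{n+1}$ be an embedding of a connected, oriented manifold such that $x(M)$ is a complete radial graph over the standard $n$-sphere $\mathbb S^n$ minus $k\geq0$ points. Let $A$ and $H$ be the second fundamental form and mean curvature of $M$ with respect to a unit normal field. If $|A|$ is bounded, $H$ is constant and $p\mapsto|x(p)^\top|$ is integrable on $M$, then $k=0$ and $x(M)$ is a sphere.
   Context: A radial graph over an open set $\Omega\subset\mathbb S^n$ (here $\Omega$ is $\mathbb S^n$ minus $k$ points, $k$ finite) is a hypersurface of the form $\{u(q)q:\ q\in\Omega\}$ with $u:\Omega\to(0,+\infty)$ smooth; in particular it is transversal at every point to the position vector field $\xi(x)=x$. Complete refers to the induced metric. $x(p)^\top$ denotes the orthogonal projection of the position vector $x(p)$ onto the tangent space of $M$ at $p$; integrable means in $\mathcal L^1(M)$ for the induced Riemannian volume measure. $nH$ is the trace of $A$. *)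

(* Defs.v *)
From HB Require Import structures.
From mathcomp Require Import all_boot all_order all_algebra.
From mathcomp Require Import all_classical all_reals all_analysis.

Set Implicit Arguments.
Unset Strict Implicit.
Unset Printing Implicit Defensive.

Import Order.TTheory GRing.Theory Num.Theory.
Import numFieldNormedType.Exports.

Local Open Scope classical_set_scope.
Local Open Scope ring_scope.

(* Vectors are row vectors.  The library norm on ['rV[R]_m] is the sup norm: it
   is only used for its topology and for differentiability; all the metric
   notions below use the Euclidean inner product. *)
Definition dotv (R : realType) (m : nat) (v w : 'rV[R]_m) : R :=
  (v *m w^T) ord0 ord0.

Definition enorm (R : realType) (m : nat) (v : 'rV[R]_m) : R :=
  Num.sqrt (dotv v v).

Definition esphere (R : realType) (m : nat) (c : 'rV[R]_m) (r : R) :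
    set 'rV[R]_m :=
  [set z | enorm (z - c) = r].

Definition unit_sphere (R : realType) (m : nat) : set 'rV[R]_m := esphere 0 1.
Arguments unit_sphere : clear implicits.

(* Only meant for [U] open and [V], [W] of finite dimension. *)
Fixpoint Ck_on (R : realType) (V W : normedModType R) (k : nat)
    (U : set V) (f : V -> W) : Prop :=
  match k with
  | 0 => forall y, U y -> {for y, continuous f}
  | k'.+1 => (forall y, U y -> differentiable f y) /\
             (forall v, Ck_on k' U ('D_v f))
  end.

Definition smooth_on (R : realType) (V W : normedModType R)
    (U : set V) (f : V -> W) : Prop :=
  forall k, Ck_on k U f.

(* Smoothness on a subset which need not be open, such as an open subset of the
   unit sphere: local existence of smooth extensions to the ambient space. *)
Definition smooth_on_subset (R : realType) (V W : normedModType R)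
    (A : set V) (f : V -> W) : Prop :=
  forall a, A a -> exists (U : set V) (F : V -> W),
    [/\ open U, U a, smooth_on U F & forall z, A z -> U z -> F z = f z].

Record chart (R : realType) (n : nat) (T : topologicalType) := Chart {
  cdom : set T ;
  cmap : T -> 'rV[R]_n ;
  cinv : 'rV[R]_n -> T ;
  cdom_open : open cdom ;
  ccod_open : open (cmap @` cdom) ;
  cmap_continuous : forall p, cdom p -> {for p, continuous cmap} ;
  cinv_continuous : forall y, (cmap @` cdom) y -> {for y, continuous cinv} ;
  cmapK : forall p, cdom p -> cinv (cmap p) = p
}.

Definition ccod (R : realType) (n : nat) (T : topologicalType)
  (c : chart R n T) : set 'rV[R]_n := cmap c @` cdom c.

(* [chart_at] is an arbitrary selection of charts of the atlas.  It serves to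
   evaluate, as functions on the manifold, quantities which are given by a
   coordinate formula and do not depend on the chart.  Manifolds are nonempty
   (pointed), as the library requires of measurable spaces. *)
Record oriented_manifold (R : realType) (n : nat) := OrientedManifold {
  carrier :> ptopologicalType ;
  carrier_hausdorff : hausdorff_space carrier ;
  carrier_second_countable : @second_countable carrier ;
  atlas : set (chart R n carrier) ;
  chart_at : carrier -> chart R n carrier ;
  atlas_chart_at : forall p, atlas (chart_at p) ;
  cdom_chart_at : forall p, cdom (chart_at p) p ;
  atlas_smooth : forall c d, atlas c -> atlas d ->
    smooth_on (cmap c @` (cdom c `&` cdom d)) (cmap d \o cinv c) ;
  atlas_oriented : forall c d, atlas c -> atlas d ->
    forall y, (cmap c @` (cdom c `&` cdom d)) y ->
    0 < \det ('J (cmap d \o cinv c) y)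
}.

Definition smooth_map (R : realType) (n : nat) (M : oriented_manifold R n)
    (W : normedModType R) (f : M -> W) : Prop :=
  forall c, atlas c -> smooth_on (ccod c) (f \o cinv c).

(* The rows of this matrix are the coordinate vector fields
   [d(x)/dy_1, ..., d(x)/dy_n] of the chart [c], at the point [p]. *)
Definition cjacobian (R : realType) (n m : nat) (M : oriented_manifold R n)
    (f : M -> 'rV[R]_m) (c : chart R n M) (p : M) : 'M[R]_(n, m) :=
  'J (f \o cinv c) (cmap c p).

Definition embedding (R : realType) (n m : nat) (M : oriented_manifold R n)
    (x : M -> 'rV[R]_m) : Prop :=
  [/\ smooth_map x,
      (forall c p, atlas c -> cdom c p -> row_free (cjacobian x c p)),
      injective x &
      forall A : set M, open A <-> exists2 B, open B & A = x @^-1` B].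

(* g_ij = <d_i x, d_j x> *)
Definition induced_metric (R : realType) (n m : nat) (M : oriented_manifold R n)
    (x : M -> 'rV[R]_m) (c : chart R n M) (p : M) : 'M[R]_n :=
  cjacobian x c p *m (cjacobian x c p)^T.

Definition unit_normal (R : realType) (n : nat) (M : oriented_manifold R n)
    (x N : M -> 'rV[R]_n.+1) : Prop :=
  [/\ smooth_map N,
      (forall p, enorm (N p) = 1) &
      forall c p, atlas c -> cdom c p ->
        forall i, dotv (row i (cjacobian x c p)) (N p) = 0].

(* Matrix, in the coordinate basis at [p] and acting on row vectors, of the
   shape operator [A = - dN] (the second fundamental form seen as a self-adjoint
   endomorphism of the tangent space): it is the solution [S] of the Weingarten
   equations [d_i N = - \sum_j S_ij d_j x]. *)
Definition shape_operator (R : realType) (n : nat) (M : oriented_manifold R n)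
    (x N : M -> 'rV[R]_n.+1) (p : M) : 'M[R]_n :=
  let c := chart_at p in
  - (cjacobian N c p *m (cjacobian x c p)^T) *m invmx (induced_metric x c p).

(* |A|^2 = tr (A^2), as [A] is self-adjoint. *)
Definition norm_sff (R : realType) (n : nat) (M : oriented_manifold R n)
    (x N : M -> 'rV[R]_n.+1) (p : M) : R :=
  Num.sqrt (\tr (shape_operator x N p *m shape_operator x N p)).

Definition mean_curvature (R : realType) (n : nat) (M : oriented_manifold R n)
    (x N : M -> 'rV[R]_n.+1) (p : M) : R :=
  \tr (shape_operator x N p) / n%:R.

(* Orthogonal projection onto the row space of [cjacobian x c p], which is the
   tangent space of [x(M)] at [x p]. *)
Definition tangent_proj (R : realType) (n m : nat) (M : oriented_manifold R n)
    (x : M -> 'rV[R]_m) (p : M) (v : 'rV[R]_m) : 'rV[R]_m :=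
  let c := chart_at p in
  v *m (cjacobian x c p)^T *m invmx (induced_metric x c p) *m cjacobian x c p.

(* Curves are parametrized by the whole line, but only their restrictions to
   [0, 1] matter. *)
Definition C1_curve (R : realType) (n : nat) (M : oriented_manifold R n)
    (g : R -> M) : Prop :=
  continuous g /\
  forall c, atlas c -> Ck_on 1 (g @^-1` cdom c) (cmap c \o g : R -> 'rV[R]_n).

Definition curve_length (R : realType) (n m : nat) (M : oriented_manifold R n)
    (x : M -> 'rV[R]_m) (g : R -> M) : \bar R :=
  (\int[lebesgue_measure]_(t in `[0%R, 1%R]) (enorm (derive1 (x \o g) t))%:E)%E.

Definition riemannian_dist (R : realType) (n m : nat)
    (M : oriented_manifold R n) (x : M -> 'rV[R]_m) (p q : M) : \bar R :=
  ereal_inf [set curve_length x g | g in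
    [set g : R -> M | [/\ C1_curve g, g 0 = p & g 1 = q]]].

Definition complete_induced_metric (R : realType) (n m : nat)
    (M : oriented_manifold R n) (x : M -> 'rV[R]_m) : Prop :=
  forall s : nat -> M,
    (forall e : R, 0 < e -> exists K : nat, forall i j : nat,
       (K <= i)%N -> (K <= j)%N -> (riemannian_dist x (s i) (s j) < e%:E)%E) ->
    exists p : M, forall e : R, 0 < e -> exists K : nat, forall i : nat,
      (K <= i)%N -> (riemannian_dist x (s i) p < e%:E)%E.

(* Lebesgue integral over R^n, as an iterated integral; it is only used for
   nonnegative Borel functions, where Tonelli's theorem applies. *)
Fixpoint lebesgue_integral_rV (R : realType) (n : nat) :
    ('rV[R]_n -> \bar R) -> \bar R :=
  match n return ('rV[R]_n -> \bar R) -> \bar R with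
  | 0 => fun f => f 0
  | n'.+1 => fun f =>
      (\int[lebesgue_measure]_(t in [set: R])
        lebesgue_integral_rV
          (fun v : 'rV[R]_n' => f (row_mx (const_mx t : 'rV[R]_1) v)))%E
  end.

(* dvol = sqrt (det g) dy in every chart. As the manifold is covered by
   countably many charts, this determines [mu]. *)
Definition riemannian_volume (R : realType) (n m : nat)
    (M : oriented_manifold R n) (x : M -> 'rV[R]_m)
    (mu : {measure set (g_sigma_algebraType (@open M)) -> \bar R}) : Prop :=
  forall c, atlas c ->
  forall E : set (g_sigma_algebraType (@open M)),
    measurable E -> E `<=` cdom c ->
    mu E = lebesgue_integral_rV
      ((fun y => (Num.sqrt (\det (induced_metric x c (cinv c y))))%:E)
        \_ (cmap c @` E)).

Definition radial_graph (R : realType) (n k : nat) (S : set 'rV[R]_n.+1) :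
    Prop :=
  exists (a : k.-tuple 'rV[R]_n.+1) (u : 'rV[R]_n.+1 -> R),
    let Omega := unit_sphere R n.+1 `\` [set` a] in
    [/\ uniq a,
        [set` a] `<=` unit_sphere R n.+1,
        smooth_on_subset Omega (u : 'rV[R]_n.+1 -> R^o),
        forall q, Omega q -> 0 < u q &
        S = [set u q *: q | q in Omega]].

(* Main.v *)
(* The tangential field [V = A x^T - H x^T] has divergence
   [<x, N> (|A|^2 - n H^2)] because [H] is constant.  A radial graph is
   transversal to the position vector, so the support function [<x, N>] does not
   vanish, and the divergence has a constant sign.  Since [|A|] is bounded and
   [|x^T|] is integrable, so is [|V|]; by completeness (Hopf-Rinow) there are
   compactly supported cut-offs of slope [eps], and integrating [div V] against
   them gives [O(eps)].  Hence [|A|^2 = n H^2], that is, [M] is umbilic, and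
   [N + H x] is constant.  If [H = 0] the graph lies in an open half-space, which
   is impossible because the sphere minus finitely many points contains antipodal
   points; otherwise [x(M)] lies in a sphere around [c].  On the ray spanned by
   [q] and its opposite, the distances to [0] of the points of the graph have
   product [r^2 - |c|^2 > 0], so the origin is inside the sphere and [x(M)] is
   the sphere minus the points in the missing directions.  A circular arc
   running into such a point would contradict completeness.

   Integrals are computed in charts, where the induced volume has a density with
   respect to a measure [lam] computing iterated Lebesgue integrals.  Cut-offs are
   only Lipschitz, so the integration by parts is done by difference quotients
   and translation invariance, along frames with constant coefficients. *)

Require Import Defs.
From HB Require Import structures.
From mathcomp Require Import all_boot all_order all_algebra perm.
From mathcomp Require Import all_classical all_reals all_analysis.
From mathcomp Require Import ring lra measurable_realfun.

Import Order.TTheory GRing.Theory Num.Theory.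
Import numFieldNormedType.Exports.

Local Open Scope classical_set_scope.
Local Open Scope ring_scope.

Set Implicit Arguments.
Unset Strict Implicit.
Unset Printing Implicit Defensive.

(** * Continuously differentiable functions *)

(** The cut-offs are truncated distance functions and are never smoothed: every derivative is put on
    the smooth factor and a translation is moved onto the cut-off, so that only its variation along
    a fixed direction is measured. The constant in the resulting inequality must not depend on the
    chart, because the number of charts meeting the support is not controlled as the slope tends to
    0. This dictates the frame: in the chart around [p0] the translations follow the rows of
    [pinv J0], the tangential parts of the ambient basis vectors, whose length near [p0] is bounded
    in terms of [n] only. The inequality is proved with a nonnegative weight [Theta] so that it can
    be summed over a partition of unity; the derivatives of the partition need no bound, since they
    belong to the integrand [stokes_term]. Distances are handled through the strict relation that
    some path is shorter than [a]; this replaces infima and leads to Hopf-Rinow without geodesics.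
    The shape operator is turned into an ambient matrix, which does not depend on the chart and is
    therefore globally continuous. *)

Section near_eq.
Variables (R : realType) (V W : normedModType R).
Implicit Types (U : set V) (f g : V -> W).

Lemma near_eq_continuous f g y :
  (\forall z \near y, f z = g z) -> {for y, continuous g} -> {for y, continuous f}.
Proof.
move=> fg; rewrite /prop_for /continuous_at (nbhs_singleton fg) => cg.
apply: cvg_trans cg; apply: near_eq_cvg.
by near=> z; apply/esym; near: z.
Unshelve. all: by end_near. Qed.

Lemma open_near U y : open U -> U y -> \forall z \near y, U z.
Proof. by move=> oU Uy; apply: open_nbhs_nbhs; split. Qed.

Lemma differentiable_eps f y (df : {linear V -> W}) : continuous df ->
  (forall e, 0 < e -> \forall h \near (0:V), `|f (h + y) - f y - df h| <= e * `|h|) ->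
  differentiable f y.
Proof.
move=> cdf H.
have E : f \o shift y = cst (f y) + df +o_ (0 : V) id.
  apply/eqaddoP => e e0; near=> h.
  rewrite /= !fctE /= opprD addrA; near: h; exact: H.
apply/diff_locallyP; rewrite (diff_unique cdf E); split => //.
Unshelve. all: by end_near. Qed.

Lemma diff_eps f y : differentiable f y ->
  forall e, 0 < e -> \forall h \near (0:V), `|f (h + y) - f y - 'd f y h| <= e * `|h|.
Proof.
move=> /diff_locallyP[_ /eqaddoP H] e e0.
by have := H _ e0; apply: filterS => h /=; rewrite !fctE /= opprD addrA.
Qed.

Lemma near_eq_differentiable f g y :
  (\forall z \near y, f z = g z) -> differentiable g y -> differentiable f y.
Proof.
move=> fg dg.
apply: (@differentiable_eps _ _ ('d g y)); first exact: diff_continuous.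
move=> e e0; near=> h.
have -> : f (h + y) = g (h + y).
  near: h; move: fg; rewrite [X in X -> _](near_shift 0) subr0.
  by apply: filterS => z /=.
rewrite (nbhs_singleton fg); near: h; exact: diff_eps.
Unshelve. all: by end_near. Qed.

End near_eq.

Section C1on.
Variables (R : realType) (V : normedModType R).
Implicit Types (U : set V) (f g : V -> R).

(** This is [Ck_on 1] for scalar functions. Continuity is asked of each derivative in a fixed
    direction, so that the algebraic rules below need no operator norm. *)
Definition C1on U f : Prop :=
  (forall y, U y -> differentiable f y) /\
  (forall v y, U y -> {for y, continuous ('D_v f)}).

Lemma C1on_derivable U f v y : C1on U f -> U y -> derivable f y v.
Proof. by move=> [d _] /d; exact: diff_derivable. Qed.

Lemma C1on_continuous U f y : C1on U f -> U y -> {for y, continuous f}.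
Proof. by move=> [d _] /d; exact: differentiable_continuous. Qed.

Lemma C1on_intro U f (df : V -> V -> R) : open U ->
  (forall y, U y -> differentiable f y) ->
  (forall v y, U y -> 'D_v f y = df v y) ->
  (forall v y, U y -> {for y, continuous (df v)}) -> C1on U f.
Proof.
move=> oU d e c; split => // v y Uy.
apply: (@near_eq_continuous _ _ _ _ (df v)); last exact: c.
by apply: filterS (open_near oU Uy) => z; exact: e.
Qed.

Lemma C1on_eq U f g : open U -> (forall y, U y -> f y = g y) -> C1on U g -> C1on U f.
Proof.
move=> oU fg Cg.
have n y : U y -> \forall z \near y, f z = g z.
  by move=> Uy; apply: filterS (open_near oU Uy) => z; exact: fg.
apply: (@C1on_intro _ _ (fun v => 'D_v g)) => //.
- by move=> y Uy; apply: near_eq_differentiable (n y Uy) _; case: Cg => + _; apply.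
- by move=> v y Uy; apply: near_eq_derive; exact: n.
- by case: Cg.
Qed.

Lemma C1on_cst U c : open U -> C1on U (fun=> c).
Proof.
move=> oU; apply: (@C1on_intro _ _ (fun _ _ => 0)) => //.
- by move=> v y Uy; exact: derive_cst.
- by move=> v y Uy; exact: cst_continuous.
Qed.

Lemma C1onD U f g : open U -> C1on U f -> C1on U g -> C1on U (fun y => f y + g y).
Proof.
move=> oU Cf Cg; apply: (@C1on_intro _ _ (fun v y => 'D_v f y + 'D_v g y)) => //.
- by move=> y Uy; apply: differentiableD; [case: Cf|case: Cg] => + _; apply.
- move=> v y Uy; apply: deriveD; exact: C1on_derivable Uy.
- move=> v y Uy; apply: (@continuousD _ _ _ ('D_v f) ('D_v g)).
    by case: Cf => _; exact.
  by case: Cg => _; exact.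
Qed.

Lemma C1onM U f g : open U -> C1on U f -> C1on U g -> C1on U (fun y => f y * g y).
Proof.
move=> oU Cf Cg.
apply: (@C1on_intro _ _ (fun v y => f y * 'D_v g y + g y * 'D_v f y)) => //.
- by move=> y Uy; apply: differentiableM; [case: Cf|case: Cg] => + _; apply.
- move=> v y Uy; apply: deriveM; exact: C1on_derivable Uy.
- move=> v y Uy.
  apply: (@continuousD _ _ _ (fun y => f y * 'D_v g y) (fun y => g y * 'D_v f y)).
    apply: (@continuousM _ _ f ('D_v g)); first exact: C1on_continuous Uy.
    by case: Cg => _; exact.
  apply: (@continuousM _ _ g ('D_v f)); first exact: C1on_continuous Uy.
  by case: Cf => _; exact.
Qed.

Lemma C1onN U f : open U -> C1on U f -> C1on U (fun y => - f y).
Proof.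
move=> oU Cf; apply: (C1on_eq oU _ (C1onM oU (C1on_cst (-1) oU) Cf)) => y _.
by rewrite mulN1r.
Qed.

Lemma C1onB U f g : open U -> C1on U f -> C1on U g -> C1on U (fun y => f y - g y).
Proof. by move=> oU Cf Cg; exact: (C1onD oU Cf (C1onN oU Cg)). Qed.

Lemma C1on_sum U (I : Type) (s : seq I) (P : pred I) (F : I -> V -> R) : open U ->
  (forall i, P i -> C1on U (F i)) -> C1on U (fun y => \sum_(i <- s | P i) F i y).
Proof.
move=> oU CF; elim: s => [|i s IH].
  by apply: (C1on_eq oU _ (C1on_cst 0 oU)) => y _; rewrite big_nil.
have [Pi|Pi] := boolP (P i).
  apply: (C1on_eq oU _ (C1onD oU (CF i Pi) IH)) => y _.
  by rewrite big_cons Pi.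
by apply: (C1on_eq oU _ IH) => y _; rewrite big_cons (negbTE Pi).
Qed.

Lemma C1on_prod U (I : Type) (s : seq I) (P : pred I) (F : I -> V -> R) : open U ->
  (forall i, P i -> C1on U (F i)) -> C1on U (fun y => \prod_(i <- s | P i) F i y).
Proof.
move=> oU CF; elim: s => [|i s IH].
  by apply: (C1on_eq oU _ (C1on_cst 1 oU)) => y _; rewrite big_nil.
have [Pi|Pi] := boolP (P i).
  apply: (C1on_eq oU _ (C1onM oU (CF i Pi) IH)) => y _.
  by rewrite big_cons Pi.
by apply: (C1on_eq oU _ IH) => y _; rewrite big_cons (negbTE Pi).
Qed.

Lemma derive_compR (f : V -> R) (s : R -> R) (y v : V) :
  differentiable f y -> derivable s (f y) 1 ->
  differentiable (fun y => s (f y)) y /\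
  'D_v (fun y => s (f y)) y = derive1 s (f y) * 'D_v f y.
Proof.
move=> df /derivable1_diffP ds.
have dc : differentiable (s \o f) y by exact: differentiable_comp.
split => //.
rewrite (_ : (fun y => s (f y)) = s \o f)// deriveE// diff_comp//= deriv1E; last first.
  exact/derivable1_diffP.
by rewrite [LHS]mulrC -deriveE.
Qed.

Lemma C1on_comp U f (s : R -> R) : open U -> C1on U f ->
  (forall y, U y -> derivable s (f y) 1) ->
  (forall y, U y -> {for f y, continuous (derive1 s)}) -> C1on U (fun y => s (f y)).
Proof.
move=> oU Cf ds cs.
have df y : U y -> differentiable f y by case: Cf => + _; apply.
apply: (@C1on_intro _ _ (fun v y => derive1 s (f y) * 'D_v f y)) => //.
- by move=> y Uy; have [] := derive_compR 0 (df _ Uy) (ds _ Uy).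
- by move=> v y Uy; have [] := derive_compR v (df _ Uy) (ds _ Uy).
- move=> v y Uy; apply: (@continuousM _ _ (fun y => derive1 s (f y)) ('D_v f)).
    apply: (@continuous_comp _ _ _ f (derive1 s)); last exact: cs.
    exact: C1on_continuous Uy.
  by case: Cf => _; exact.
Qed.

Lemma C1onV U f : open U -> C1on U f -> (forall y, U y -> f y != 0) ->
  C1on U (fun y => (f y)^-1).
Proof.
move=> oU Cf f0.
apply: (@C1on_intro _ _ (fun v y => - (f y) ^- 2 * 'D_v f y)) => //.
- by move=> y Uy; apply: differentiableV (f0 _ Uy); case: Cf => + _; apply.
- by move=> v y Uy; apply: deriveV (f0 _ Uy) _; exact: C1on_derivable Uy.
- move=> v y Uy.
  apply: (@continuousM _ _ (fun y => - (f y) ^- 2) ('D_v f)); last first.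
    by case: Cf => _; exact.
  apply: (@continuousN _ _ _ (fun y => (f y) ^- 2)).
  apply: (@continuousV _ _ (fun y => f y ^+ 2)); first by rewrite expf_neq0// f0.
  apply: (@continuousM _ _ f f); exact: C1on_continuous Uy.
Qed.

Lemma C1on_sqrt U f : open U -> C1on U f -> (forall y, U y -> 0 < f y) ->
  C1on U (fun y => Num.sqrt (f y)).
Proof.
move=> oU Cf f0.
have ds y : U y -> is_derive (f y) 1 Num.sqrt (2 * Num.sqrt (f y))^-1.
  by move=> Uy; exact: is_derive1_sqrt (f0 _ Uy).
apply: C1on_comp => //.
  by move=> y /ds[].
move=> y Uy.
apply: (@near_eq_continuous _ _ _ _ (fun t => (2 * Num.sqrt t)^-1)).
  have : \forall z \near f y, 0 < z by apply: lt_nbhsr; exact: f0.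
  apply: filterS => z z0; rewrite derive1E.
  by have [_ ->] := is_derive1_sqrt z0.
apply: (@continuousV _ _ (fun t => 2 * Num.sqrt t)).
  by rewrite mulf_neq0// ?pnatr_eq0// gt_eqF// sqrtr_gt0 f0.
apply: (@continuousM _ _ (fun=> 2) Num.sqrt); first exact: cst_continuous.
exact: sqrt_continuous.
Qed.

End C1on.

(** * Matrix-valued functions: products, inverses and Jacobi's formula *)

Section C1mx.
Variables (R : realType) (V : normedModType R).
Implicit Types (U : set V).

Definition C1mx U p q (A : V -> 'M[R]_(p, q)) :=
  forall i j, C1on U (fun y => A y i j).

Lemma C1mx_mul U p q r (A : V -> 'M[R]_(p, q)) (B : V -> 'M[R]_(q, r)) :
  open U -> C1mx U A -> C1mx U B -> C1mx U (fun y => A y *m B y).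
Proof.
move=> oU CA CB i j.
apply: (C1on_eq oU _ (C1on_sum (index_enum _) (P := predT)
  (F := fun k y => A y i k * B y k j) oU (fun k _ => C1onM oU (CA i k) (CB k j)))).
by move=> y _; rewrite mxE.
Qed.

Lemma C1mx_tr U p q (A : V -> 'M[R]_(p, q)) : open U -> C1mx U A ->
  C1mx U (fun y => (A y)^T).
Proof. by move=> oU CA i j; apply: (C1on_eq oU _ (CA j i)) => y _; rewrite mxE. Qed.

Lemma C1mx_add U p q (A B : V -> 'M[R]_(p, q)) : open U ->
  C1mx U A -> C1mx U B -> C1mx U (fun y => A y + B y).
Proof.
move=> oU CA CB i j.
by apply: (C1on_eq oU _ (C1onD oU (CA i j) (CB i j))) => y _; rewrite mxE.
Qed.

Lemma C1mx_cst U p q (A : 'M[R]_(p, q)) : open U -> C1mx U (fun=> A).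
Proof. by move=> oU i j; exact: C1on_cst. Qed.

Lemma C1on_det U n (A : V -> 'M[R]_n) : open U -> C1mx U A ->
  C1on U (fun y => \det (A y)).
Proof.
move=> oU CA; rewrite /determinant.
apply: C1on_sum => // s _; apply: C1onM => //; first exact: C1on_cst.
by apply: C1on_prod => // i _; exact: CA.
Qed.

(** Cramer's rule: the entries of the inverse are cofactors divided by the determinant. *)
Lemma C1mx_inv U n (A : V -> 'M[R]_n) : open U -> C1mx U A ->
  (forall y, U y -> A y \in unitmx) -> C1mx U (fun y => invmx (A y)).
Proof.
move=> oU CA uA i j.
have CD := C1on_det oU CA.
have Cadj : C1on U (fun y => cofactor (A y) j i).
  rewrite /cofactor; apply: (C1onM oU (C1on_cst _ oU)).
  apply: C1on_det => // a b.
  by apply: (C1on_eq oU _ (CA (lift j a) (lift i b))) => y _; rewrite !mxE.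
have CV : C1on U (fun y => (\det (A y))^-1).
  by apply: C1onV => // y Uy; rewrite -unitfE -unitmxE uA.
apply: (C1on_eq oU _ (C1onM oU CV Cadj)) => y Uy.
by rewrite /invmx uA// !mxE.
Qed.

Lemma derivable_mulmx p q r (A : V -> 'M[R]_(p, q)) (B : V -> 'M[R]_(q, r)) y v :
  derivable A y v -> derivable B y v ->
  derivable (fun y => A y *m B y) y v /\
  'D_v (fun y => A y *m B y) y = 'D_v A y *m B y + A y *m 'D_v B y.
Proof.
move=> dA dB.
have dAe := (derivable_mxP _ _ _).1 dA; have dBe := (derivable_mxP _ _ _).1 dB.
have E i j : (fun x => (A x *m B x) i j) =
    \sum_(k < q) ((fun x => A x i k) * (fun x => B x k j)).
  by apply/funext => x; rewrite mxE fct_sumE.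
have dAB : derivable (fun y => A y *m B y) y v.
  apply/derivable_mxP => i j; rewrite E; apply: derivable_sum => k.
  exact: derivableM.
split => //; rewrite derive_mx//; apply/matrixP => i j; rewrite mxE E.
rewrite derive_sum; last by move=> k; exact: derivableM.
rewrite derive_mx// derive_mx// !mxE -big_split; apply: eq_bigr => k _ /=.
by rewrite deriveM// !mxE addrC; congr (_ + _); rewrite [LHS]mulrC.
Qed.

Lemma C1mx_derivable U p q (A : V -> 'M[R]_(p, q)) y v : C1mx U A -> U y ->
  derivable A y v.
Proof. by move=> CA Uy; apply/derivable_mxP => i j; exact: C1on_derivable (CA i j) Uy. Qed.

Lemma derivable_trmx p q (A : V -> 'M[R]_(p, q)) y v : derivable A y v ->
  derivable (fun y => (A y)^T) y v /\ 'D_v (fun y => (A y)^T) y = ('D_v A y)^T.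
Proof.
move=> dA; have dAe := (derivable_mxP _ _ _).1 dA.
have dT : derivable (fun y => (A y)^T) y v.
  apply/derivable_mxP => i j; rewrite (_ : (fun _ => _) = fun x => A x j i)//.
  by apply/funext => x; rewrite mxE.
split => //; rewrite !derive_mx//; apply/matrixP => i j; rewrite !mxE.
by congr ('D_v _ y); apply/funext => x; rewrite mxE.
Qed.

Lemma is_derive_prod (I : eqType) (s : seq I) (F : I -> V -> R) (D : I -> R) y v :
  uniq s -> (forall i, is_derive y v (F i) (D i)) ->
  is_derive y v (fun z => \prod_(i <- s) F i z)
    (\sum_(i <- s) D i * \prod_(j <- s | j != i) F j y).
Proof.
move=> + dF; elim: s => [_|a s IH /= /andP[aNs us]].
  rewrite big_nil; rewrite (_ : (fun _ => _) = cst 1); first exact: is_derive_cst.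
  by apply/funext => z; rewrite big_nil.
rewrite (_ : (fun _ => _) = F a * (fun z => \prod_(i <- s) F i z)); last first.
  by apply/funext => z; rewrite big_cons.
have {}IH := IH us.
apply: is_derive_eq.
rewrite big_cons /= addrC; congr (_ + _).
  rewrite big_cons eqxx /= [LHS]mulrC; congr (_ * _).
  rewrite big_seq [RHS]big_seq_cond; apply: eq_bigl => i.
  by case: (boolP (i \in s)) => //= si; apply/esym; apply: contraNneq aNs => <-.
rewrite /GRing.scale /= mulr_sumr; apply: eq_big_seq => i si; rewrite big_cons.
have -> : a != i by apply: contraNneq aNs => ->.
by rewrite mulrCA.
Qed.

(** Jacobi's formula, from the Leibniz expansion of the determinant. *)
Lemma derive_det n (A : V -> 'M[R]_n) y v : derivable A y v ->
  derivable (fun y => \det (A y)) y v /\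
  'D_v (fun y => \det (A y)) y = \tr ('D_v A y *m \adj (A y)).
Proof.
move=> dA; have dAe := (derivable_mxP _ _ _).1 dA.
have dAi i j : is_derive y v (fun z => A z i j) ('D_v A y i j).
  by rewrite derive_mx// mxE; exact: derivableP.
have dP (s : 'S_n) : is_derive y v (fun z => \prod_i A z i (s i))
    (\sum_i 'D_v A y i (s i) * \prod_(j | j != i) A y j (s j)).
  apply: (@is_derive_prod _ (index_enum _) (fun i z => A z i (s i))) => //.
  exact: index_enum_uniq.
have dS : is_derive y v (fun z => \det (A z)) (\sum_(s : 'S_n) (-1) ^+ s *
    \sum_i 'D_v A y i (s i) * \prod_(j | j != i) A y j (s j)).
  have {}dP (s : 'S_n) : is_derive y v (fun z => (-1) ^+ s * \prod_i A z i (s i))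
    ((-1) ^+ s * \sum_i 'D_v A y i (s i) * \prod_(j | j != i) A y j (s j)).
    have := dP s => {}dP.
    exact: (@is_deriveZ _ _ _ (fun z => \prod_i A z i (s i)) ((-1) ^+ s)).
  rewrite /determinant.
  elim: (index_enum _) => [|s r IH].
    rewrite big_nil (_ : (fun _ => _) = cst 0); first exact: is_derive_cst.
    by apply/funext => z; rewrite big_nil.
  rewrite big_cons (_ : (fun _ => _) = (fun z => (-1) ^+ s * \prod_i A z i (s i)) +
     (fun z => \sum_(i <- r) (-1) ^+ i * \prod_i0 A z i0 (i i0))).
    exact: is_deriveD.
  by apply/funext => z; rewrite big_cons.
split; first exact: ex_derive.
rewrite derive_val.
(* The [i]-th term is the determinant whose row [i] has been differentiated; expanding it along that
   row produces the adjugate. *)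
transitivity (\sum_i \det (\matrix_(k, l) (if k == i then 'D_v A y k l else A y k l))).
  under eq_bigr do rewrite mulr_sumr.
  rewrite exchange_big /=; apply: eq_bigr => i _; apply: eq_bigr => s _.
  congr (_ * _); rewrite [RHS](bigD1 i)//= mxE eqxx; congr (_ * _).
  by apply: eq_bigr => j ji; rewrite mxE (negbTE ji).
rewrite /mxtrace; apply: eq_bigr => i _.
rewrite (expand_det_row _ i) mxE; apply: eq_bigr => j _.
rewrite !mxE eqxx; congr (_ * _).
rewrite /cofactor; congr (_ * \det _); apply/matrixP => a b; rewrite !mxE.
by rewrite eq_sym (negbTE (neq_lift _ _)).
Qed.

End C1mx.

(** * Symmetry of mixed derivatives *)

Section Schwarz.
Variables (R : realType) (V : normedModType R).
Implicit Types (U : set V) (f : V -> R).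

Lemma is_derive_line (W : normedModType R) (f : V -> W) p v (s : R) : derivable f (s *: v + p) v ->
  is_derive s (1 : R) (fun s : R => f (s *: v + p)) ('D_v f (s *: v + p)).
Proof.
move=> df.
have E : (fun h : R => h^-1 *: ((fun s : R => f (s *: v + p)) \o shift s) (h *: 1)
   - h^-1 *: f (s *: v + p)) = (fun h : R => h^-1 *: (f \o shift (s *: v + p)) (h *: v)
   - h^-1 *: f (s *: v + p)).
  by apply/funext => h /=; rewrite scaler1 scalerDl addrA.
have E' : (fun h : R => h^-1 *: (((fun s : R => f (s *: v + p)) \o shift s) (h *: 1)
   - f (s *: v + p))) = (fun h : R => h^-1 *: ((f \o shift (s *: v + p)) (h *: v)
   - f (s *: v + p))).
  by apply/funext => h /=; rewrite scaler1 scalerDl addrA.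
split; first by rewrite /derivable E'.
by rewrite /derive E'.
Qed.

Lemma MVT_line f p v (t : R) : 0 < t ->
  (forall s : R, 0 <= s <= t -> derivable f (s *: v + p) v) ->
  exists2 c : R, 0 <= c <= t & f (t *: v + p) - f p = t * 'D_v f (c *: v + p).
Proof.
move=> t0 df.
have dg (s : R) : 0 <= s <= t -> is_derive s (1 : R) (fun s : R => f (s *: v + p)) ('D_v f (s *: v + p)).
  by move=> st; apply: is_derive_line; exact: df.
have [] := @MVT_segment R (fun s => f (s *: v + p)) (fun s => 'D_v f (s *: v + p)) 0 t (ltW t0).
- move=> s; rewrite in_itv /= => /andP[s0 st]; apply: dg.
  by rewrite !ltW.
- apply: derivable_within_continuous => s; rewrite in_itv /= => st.
  by have [] := dg s st.
move=> c; rewrite in_itv /= => ct E; exists c => //.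
by move: E; rewrite scale0r add0r subr0 mulrC.
Qed.

(** The mean value theorem is applied twice: along [v] to the difference [phi] of [f] in the
    direction [w], then along [w] to ['D_v f]. *)
Lemma double_difference U f y v w (t : R) : open U -> C1on U f -> C1on U ('D_v f) ->
  0 < t -> (forall a b : R, 0 <= a <= t -> 0 <= b <= t -> U (a *: v + (b *: w + y))) ->
  exists a b : R, [/\ 0 <= a <= t, 0 <= b <= t &
   f (t *: v + (t *: w + y)) - f (t *: v + y) - (f (t *: w + y) - f y) =
   t * t * 'D_w ('D_v f) (a *: v + (b *: w + y))].
Proof.
move=> oU Cf Cvf t0 HU.
pose phi z := f (t *: w + z) - f z.
have tt : 0 <= t <= t by rewrite (ltW t0) lexx.
have zt : 0 <= (0 : R) <= t by rewrite lexx ltW.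
have dphi (s : R) : 0 <= s <= t -> is_derive (s *: v + y) v phi
   ('D_v f (t *: w + (s *: v + y)) - 'D_v f (s *: v + y)).
  move=> st; rewrite /phi.
  have sh (q : V) : U (t *: w + q) -> is_derive q v (fun z => f (t *: w + z)) ('D_v f (t *: w + q)).
    move=> Uq; have df : derivable f (t *: w + q) v by exact: C1on_derivable Cf Uq.
    have E' : (fun h : R => h^-1 *: (((fun z => f (t *: w + z)) \o shift q) (h *: v)
       - f (t *: w + q))) = (fun h : R => h^-1 *: ((f \o shift (t *: w + q)) (h *: v)
       - f (t *: w + q))).
      by apply/funext => h /=; rewrite addrCA.
    by split; [rewrite /derivable E'|rewrite /derive E'].
  apply: (@is_deriveB _ _ _ (fun z => f (t *: w + z)) f).
    by apply: sh; rewrite addrCA; exact: HU.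
  apply: derivableP; apply: (C1on_derivable Cf).
  have := HU s 0 st zt; rewrite scale0r add0r. exact.
have [a at_ Ea] := @MVT_line phi y v t t0 (fun s st => @ex_derive _ _ _ _ _ _ _ (dphi s st)).
have Da : 'D_v phi (a *: v + y) = 'D_v f (t *: w + (a *: v + y)) - 'D_v f (a *: v + y).
  by have [] := dphi a at_.
have [|b bt Eb] := @MVT_line ('D_v f) (a *: v + y) w t t0.
  move=> s st; apply: (C1on_derivable Cvf).
  by rewrite addrCA; exact: HU.
exists a, b; split; [exact: at_|exact: bt|].
rewrite -mulrA [a *: v + _]addrCA -Eb -Da -Ea /phi.
rewrite (addrCA (t *: w) (t *: v)).
move: (f _) (f _) (f _) (f _) => p1 p2 p3 p4; ring.
Qed.

(** The second difference of [f] on a small parallelogram is symmetric in [v] and [w], and equals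
    [t * t] times either mixed derivative at some point of it; continuity of both at [y]
    concludes. *)
Lemma Schwarz U f y v w : open U -> U y -> C1on U f ->
  C1on U ('D_v f) -> C1on U ('D_w f) ->
  'D_w ('D_v f) y = 'D_v ('D_w f) y.
Proof.
move=> oU Uy Cf Cv Cw.
apply/eqP; rewrite -subr_eq0 -normr_le0; apply/ler_addgt0Pr => e e0; rewrite add0r.
have e2 : 0 < e / 2 by rewrite divr_gt0.
have N1 : \forall z \near y, `|'D_w ('D_v f) y - 'D_w ('D_v f) z| < e / 2.
  by have /cvgrPdist_lt/(_ _ e2) := Cv.2 w y Uy.
have N2 : \forall z \near y, `|'D_v ('D_w f) y - 'D_v ('D_w f) z| < e / 2.
  by have /cvgrPdist_lt/(_ _ e2) := Cw.2 v y Uy.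
have N := filterI (filterI N1 N2) (open_near oU Uy).
have [d /= d0 dN] := (nbhs_ballP _ _).1 (N _ _).
pose m := `|v| + `|w| + 1.
have m0 : 0 < m by rewrite ltr_wpDl// addr_ge0.
(* With this side length the parallelogram at [y] spanned by [t *: v] and [t *: w] stays in the ball
   of radius [d]. *)
pose t := d / (2 * m).
have t0 : 0 < t by rewrite divr_gt0// mulr_gt0.
have B (a b : R) : 0 <= a <= t -> 0 <= b <= t -> ball y d (a *: v + (b *: w + y)).
  move=> /andP[a0 at_] /andP[b0 bt]; rewrite -ball_normE /ball_ /=.
  rewrite addrA opprD addrCA subrr addr0 normrN.
  apply: (le_lt_trans (ler_normD _ _)); rewrite !normrZ !ger0_norm//.
  apply: (@le_lt_trans _ _ (t * m)).
    rewrite /m mulrDr mulr1 mulrDr -[leLHS]addr0; apply: lerD; last exact: ltW.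
    by apply: lerD; apply: ler_wpM2r.
  have -> : t * m = d / 2 by rewrite /t; field; rewrite gt_eqF.
  by rewrite ltr_pdivrMr//; lra.
have HU (a b : R) : 0 <= a <= t -> 0 <= b <= t -> U (a *: v + (b *: w + y)).
  by move=> ? ?; apply: (dN _ (B a b _ _)).2.
have HU' (a b : R) : 0 <= a <= t -> 0 <= b <= t -> U (a *: w + (b *: v + y)).
  by move=> ? ?; rewrite addrCA; exact: HU.
have [a [b [ha hb E1]]] := double_difference oU Cf Cv t0 HU.
have [a' [b' [ha' hb' E2]]] := double_difference oU Cf Cw t0 HU'.
have E : 'D_w ('D_v f) (a *: v + (b *: w + y)) = 'D_v ('D_w f) (b' *: v + (a' *: w + y)).
  have tt : t * t != 0 by rewrite mulf_neq0// gt_eqF.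
  rewrite [b' *: v + _]addrCA; apply: (mulfI tt).
  apply: (etrans (esym E1)); apply: (etrans _ E2); rewrite (addrCA (t *: v)).
  move: (f _) (f _) (f _) (f _) => p1 p2 p3 p4; ring.
have [[M1 _] _] := dN _ (B _ _ ha hb).
have [[_ M2] _] := dN _ (B _ _ hb' ha').
rewrite /= in M1 M2.
rewrite E in M1.
rewrite -(subrKA ('D_v ('D_w f) (b' *: v + (a' *: w + y)))).
apply: (le_trans (ler_normD _ _)); rewrite (splitr e); apply: lerD; first exact: ltW.
rewrite distrC; exact: (ltW M2).
Qed.

End Schwarz.

(** * The divergence formula in a chart *)

Section pseudo_inverse.
Variables (R : realType) (n : nat).
Implicit Types (J : 'M[R]_(n, n.+1)) (N : 'rV[R]_n.+1).

Lemma dotv_ge0 m (v : 'rV[R]_m) : 0 <= dotv v v.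
Proof. by rewrite /dotv mxE sumr_ge0// => i _; rewrite mxE -expr2 sqr_ge0. Qed.

Lemma dotv_eq0 m (v : 'rV[R]_m) : dotv v v = 0 -> v = 0.
Proof.
rewrite /dotv mxE => /eqP; rewrite psumr_eq0; last first.
  by move=> i _; rewrite mxE -expr2 sqr_ge0.
move=> /allP H; apply/rowP => i; rewrite mxE.
have := H i (mem_index_enum i).
by rewrite mxE -expr2 sqrf_eq0 => /eqP; rewrite (ord1 ord0).
Qed.

(** The Moore-Penrose inverse of a matrix of full row rank. When the rows of [J] are the coordinate
    fields, [v *m pinv J] is the row of coordinates of the tangential part of [v]. *)
Definition pinv J : 'M[R]_(n.+1, n) := J^T *m invmx (J *m J^T).

(** If [v] is in the kernel of the Gram matrix, then the squared length of [v *m J] is 0. *)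
Lemma gram_unit p (J : 'M[R]_(n, p)) : row_free J -> J *m J^T \in unitmx.
Proof.
move=> Jf; rewrite -row_free_unit -kermx_eq0; apply/eqP/row_matrixP => i.
rewrite row0; set v := row i _.
have vG : v *m (J *m J^T) = 0.
  by apply/sub_kermxP; rewrite /v row_sub.
have : v *m J = 0.
  by apply: dotv_eq0; rewrite /dotv trmx_mul mulmxA -(mulmxA v) vG mul0mx mxE.
by move=> vJ; apply: (row_free_inj Jf); rewrite vJ mul0mx.
Qed.

Variables (J : 'M[R]_(n, n.+1)) (N : 'rV[R]_n.+1).
Hypotheses (Jf : row_free J) (NN : N *m N^T = 1%:M) (JN : J *m N^T = 0).

Lemma mul_pinv : J *m pinv J = 1%:M.
Proof. by rewrite /pinv mulmxA mulmxV// gram_unit. Qed.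

Lemma normal_pinv : N *m pinv J = 0.
Proof. by rewrite /pinv mulmxA -(trmxK (N *m J^T)) trmx_mul trmxK JN trmx0 mul0mx. Qed.

(** [N] stacked on [J] is a square matrix, so its right inverse [(N^T, pinv J)] is also a left
    inverse. This splits the identity into normal and tangential projections. *)
Lemma pinv_mul : N^T *m N + pinv J *m J = 1%:M.
Proof.
pose F : 'M[R]_(1 + n) := col_mx N J.
pose E : 'M[R]_(1 + n) := row_mx N^T (pinv J).
have FE : F *m E = 1%:M.
  by rewrite mul_col_row NN normal_pinv JN mul_pinv -scalar_mx_block.
by have := mulmx1C FE; rewrite mul_row_col.
Qed.

Lemma pinv_mulE : pinv J *m J = 1%:M - N^T *m N.
Proof. by rewrite -pinv_mul addrAC subrr add0r. Qed.

End pseudo_inverse.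

(** * The pointwise computation of the divergence *)

Section divergence_algebra.
Variables (R : realType) (n : nat).
Variables (K E : 'I_n -> 'M[R]_n) (B : 'M[R]_n) (xi : 'rV[R]_n) (f H : R).
Hypothesis Ksym : forall i k l, K i k l = K k i l.
Hypothesis Esym : forall i k l, E i k l = E k i l.
Hypothesis trB : \tr B = - (n%:R * H).
Hypothesis trE : forall k, \tr (E k) = \tr (B *m K k).

(** The symmetry of [K'] exchanges the differentiation index with the contracted one. *)
Lemma sum_sym_trace (K' : 'I_n -> 'M[R]_n) (eta : 'rV[R]_n) (C : 'M[R]_n) :
  (forall i k l, K' i k l = K' k i l) ->
  \sum_i (eta *m K' i *m C) 0 i = \sum_k eta 0 k * \tr (C *m K' k).
Proof.
move=> S.
under [RHS]eq_bigr => k _ do rewrite mxtrace_mulC /mxtrace mulr_sumr.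
rewrite exchange_big /=; apply: eq_bigr => i _.
rewrite -mulmxA mxE; apply: eq_bigr => k _; congr (_ * _).
by rewrite !mxE; apply: eq_bigr => l _; rewrite S.
Qed.

(** Here [K i] holds the Christoffel symbols, [E i] the tangential coordinates of the second
    derivatives of the normal, [B] is minus the shape operator, [xi] the coordinates of the
    tangential part of the position, and [f] the support function. The hypothesis [trE] is the
    contracted Codazzi equation for a constant mean curvature. All Christoffel terms cancel, and so
    do the terms in [xi]. *)
Lemma divergence_algebra :
  \sum_i ((- (delta_mx 0 i *m (B + H%:M)) + xi *m K i *m (B + H%:M)
    + f *: (delta_mx 0 i *m B *m (B + H%:M)) - xi *m E i + xi *m B *m K i : 'rV[R]_n) 0 i
    + (- (xi *m (B + H%:M))) 0 i * \tr (K i))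
  = f * (\tr (B *m B) - n%:R * H ^+ 2).
Proof.
have T1 (C : 'M[R]_n) : \sum_i (delta_mx 0 i *m C : 'rV[R]_n) 0 i = \tr C.
  by apply: eq_bigr => i _; rewrite -rowE mxE.
have T2 (eta : 'rV[R]_n) : \sum_i (eta *m K i) 0 i = \sum_k eta 0 k * \tr (K k).
  have := sum_sym_trace eta 1%:M Ksym.
  under eq_bigr do rewrite mulmx1.
  by under [in RHS]eq_bigr do rewrite mul1mx.
have T3 (eta : 'rV[R]_n) : \sum_i (eta *m E i) 0 i = \sum_k eta 0 k * \tr (E k).
  have := sum_sym_trace eta 1%:M Esym.
  under eq_bigr do rewrite mulmx1.
  by under [in RHS]eq_bigr do rewrite mul1mx.
transitivity (- \tr (B + H%:M) + \sum_k xi 0 k * \tr ((B + H%:M) *m K k)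
  + f * \tr (B *m (B + H%:M)) - \sum_k xi 0 k * \tr (E k)
  + \sum_k (xi *m B) 0 k * \tr (K k)
  - \sum_k (xi *m (B + H%:M)) 0 k * \tr (K k)).
  rewrite -T1 -sum_sym_trace// -T1 -T3 -T2 mulr_sumr -!sumrN -!big_split /=.
  apply: eq_bigr => i _.
  rewrite -(mulmxA _ B (B + H%:M)).
  move: (_ *m (B *m _)) (_ *m K i *m (B + _)) (_ *m B *m K i) (_ *m E i).
  move: (delta_mx 0 i *m _) (xi *m _) => a b c d e g.
  by rewrite !mxE; ring.
have -> : \sum_k (xi *m (B + H%:M)) 0 k * \tr (K k) =
    \sum_k (xi *m B) 0 k * \tr (K k) + \sum_k xi 0 k * (H * \tr (K k)).
  rewrite -big_split /=; apply: eq_bigr => k _.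
  by rewrite mulmxDr mul_mx_scalar mxE [(H *: xi) 0 k]mxE; ring.
have -> : \sum_k xi 0 k * \tr ((B + H%:M) *m K k) =
    \sum_k xi 0 k * \tr (E k) + \sum_k xi 0 k * (H * \tr (K k)).
  rewrite -big_split /=; apply: eq_bigr => k _.
  by rewrite mulmxDl mul_scalar_mx mxtraceD mxtraceZ -trE mulrDr.
rewrite mulmxDr !mxtraceD mul_mx_scalar mxtraceZ mxtrace_scalar trB.
move: (\sum_k _) (\sum_k _) (\sum_k _) (\tr _) => a b c d.
by rewrite -mulr_natl; ring.
Qed.

End divergence_algebra.

Section jacobian_C1.
Variables (R : realType) (n m : nat) (U : set 'rV[R]_n) (X : 'rV[R]_n -> 'rV[R]_m).
Hypotheses (oU : open U) (dX : forall y, U y -> differentiable X y).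
Hypotheses (CX : C1mx U X) (CX2 : forall v, C1mx U ('D_v X)).

Lemma row_jacobian i y : U y -> row i ('J X y) = 'D_(delta_mx 0 i) X y.
Proof. by move=> Uy; rewrite rowE (deriveEjacobian _ (dX Uy)). Qed.

Lemma jacobianE i j y : U y -> 'J X y i j = 'D_(delta_mx 0 i) (fun z => X z 0 j) y.
Proof.
move=> Uy.
have -> : 'J X y i j = row i ('J X y) 0 j by rewrite [RHS]mxE.
rewrite row_jacobian// derive_mx; first by rewrite mxE.
exact: C1mx_derivable CX Uy.
Qed.

Lemma C1mx_jacobian : C1mx U (jacobian X).
Proof.
move=> i j; apply: (C1on_eq oU _ (CX2 (delta_mx 0 i) 0 j)) => y Uy.
by rewrite -row_jacobian// [RHS]mxE.
Qed.

(** Schwarz's theorem for each component of [X]; it is used both for the position and for the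
    normal. *)
Lemma jacobian_sym i k l y : U y ->
  'D_(delta_mx 0 i) (jacobian X) y k l = 'D_(delta_mx 0 k) (jacobian X) y i l.
Proof.
move=> Uy.
have D (a b : 'I_n) : 'D_(delta_mx 0 a) (jacobian X) y b l =
    'D_(delta_mx 0 a) ('D_(delta_mx 0 b) (fun z => X z 0 l)) y.
  rewrite derive_mx; last exact: C1mx_derivable C1mx_jacobian Uy.
  rewrite mxE.
  apply: near_eq_derive.
  by apply: filterS (open_near oU Uy) => z; exact: jacobianE.
have C (b : 'I_n) : C1on U ('D_(delta_mx 0 b) (fun z => X z 0 l)).
  by apply: (C1on_eq oU _ (C1mx_jacobian b l)) => z Uz; rewrite jacobianE.
exact: (etrans (D i k) (etrans (Schwarz oU Uy (CX 0 l) (C k) (C i)) (esym (D k i)))).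
Qed.

End jacobian_C1.

(** The Gram determinant is the square of the determinant of the square matrix with rows [N] and
    [J]. *)
Lemma det_gram_gt0 (R : realType) n (J : 'M[R]_(n, n.+1)) (N : 'rV[R]_n.+1) :
  row_free J -> N *m N^T = 1%:M -> J *m N^T = 0 -> 0 < \det (J *m J^T).
Proof.
move=> Jf NN JN.
pose F : 'M[R]_(1 + n) := col_mx N J.
have FF : F *m F^T = block_mx 1%:M 0 0 (J *m J^T).
  rewrite tr_col_mx mul_col_row NN JN.
  by rewrite -(trmxK (N *m J^T)) trmx_mul trmxK JN trmx0.
have E : \det (J *m J^T) = (\det F) ^+ 2.
  by rewrite expr2 -[X in _ * X]det_tr -det_mulmx FF det_ublock det1 mul1r.
rewrite E lt0r sqr_ge0 andbT -E -unitfE -unitmxE; exact: gram_unit.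
Qed.

(** The product rule for [JN *m pinv J]: the normal part of the derivative of [pinv J] is killed
    because the derivatives of [N] are tangential. *)
Lemma derive_shape_algebra (R : realType) n p (d c a : 'M[R]_(n, p)) (q : 'M[R]_(p, n))
    (nt : 'M[R]_(p, 1)) (b : 'M[R]_(1, p)) :
  d *m nt = 0 ->
  c *m q + d *m (- (q *m a *m q) - nt *m b *m q) = c *m q - d *m q *m (a *m q).
Proof. by move=> dn; rewrite mulmxBr mulmxN !mulmxA dn !mul0mx subr0. Qed.

(** The product rule for [chart_field] in the direction [e], rewritten with the symbols of
    [divergence_algebra]: [j] and [jn] are the Jacobians of position and normal, [a] and [c] their
    derivatives, [q] is the pseudo-inverse of [j], and [f] is the support function. *)
Lemma derive_field_algebra (R : realType) n p (e : 'rV[R]_n) (j jn a c : 'M[R]_(n, p))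
    (q : 'M[R]_(p, n)) (nt : 'M[R]_(p, 1)) (x : 'rV[R]_p) (f h : R) :
  j *m q = 1%:M -> x *m nt = f%:M ->
  - ((e *m j *m q + x *m (- (q *m a *m q) - nt *m (e *m jn) *m q)) *m (jn *m q + h%:M)
      + x *m q *m (c *m q - jn *m q *m (a *m q))) =
  - (e *m (jn *m q + h%:M)) + x *m q *m (a *m q) *m (jn *m q + h%:M)
  + f *: (e *m (jn *m q) *m (jn *m q + h%:M)) - x *m q *m (c *m q)
  + x *m q *m (jn *m q) *m (a *m q).
Proof.
move=> jq xn.
have -> : e *m j *m q = e by rewrite -mulmxA jq mulmx1.
have -> : x *m (- (q *m a *m q) - nt *m (e *m jn) *m q) =
    - (x *m q *m (a *m q)) - f *: (e *m (jn *m q)).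
  by rewrite mulmxBr mulmxN !mulmxA xn mul_scalar_mx !scalemxAl.
move: (jn *m q) (a *m q) (c *m q) (x *m q) => b a' c' y.
rewrite mulmxBr !mulmxA !mulmxDl !mulNmx -scalemxAl.
move: (e *m _) (y *m a' *m _) (f *: _) (y *m c') (y *m b *m _) => p1 p2 p3 p4 p5.
by rewrite !opprD !opprK !addrA.
Qed.

(** * The divergence of the field in a chart *)

Section chart_divergence.
Variables (R : realType) (n : nat) (U : set 'rV[R]_n).
Variables (X N : 'rV[R]_n -> 'rV[R]_n.+1) (H : R).
Hypothesis oU : open U.
Hypotheses (dX : forall y, U y -> differentiable X y) (CX : C1mx U X)
  (CX2 : forall v, C1mx U ('D_v X)).
Hypotheses (dN : forall y, U y -> differentiable N y) (CN : C1mx U N)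
  (CN2 : forall v, C1mx U ('D_v N)).
Hypotheses (NN : forall y, U y -> N y *m (N y)^T = 1%:M)
  (XN : forall y, U y -> 'J X y *m (N y)^T = 0)
  (Jf : forall y, U y -> row_free ('J X y)).

Let J := jacobian X.
Let JN := jacobian N.
Let Jp y := pinv (J y).
Let B y := JN y *m Jp y.
Hypothesis trB : forall y, U y -> \tr (B y) = - (n%:R * H).

Let G y := J y *m (J y)^T.
Definition vol_density y := Num.sqrt (\det (G y)).
Let w := vol_density.
(** [B] is minus the shape operator, so these are the chart coordinates of [A x^T - H x^T]. *)
Definition chart_field y := - (X y *m Jp y *m (B y + H%:M)).
Let V := chart_field.

Let CJ : C1mx U J. Proof. exact: C1mx_jacobian. Qed.
Let CJN : C1mx U JN. Proof. exact: C1mx_jacobian. Qed.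
Let CG : C1mx U G. Proof. exact: (C1mx_mul oU CJ (C1mx_tr oU CJ)). Qed.
Let Gu y : U y -> G y \in unitmx. Proof. by move=> Uy; apply: gram_unit; exact: Jf. Qed.
Lemma C1mx_pinv : C1mx U (fun y => pinv ('J X y)).
Proof. exact: (C1mx_mul oU (C1mx_tr oU CJ) (C1mx_inv oU CG Gu)). Qed.
Let CJp : C1mx U Jp := C1mx_pinv.
Let CB : C1mx U B. Proof. exact: (C1mx_mul oU CJN CJp). Qed.
Lemma C1mx_chart_field : C1mx U V.
Proof.
have C1 : C1mx U (fun y => X y *m Jp y *m (B y + H%:M)).
  apply: (C1mx_mul oU (C1mx_mul oU CX CJp)).
  exact: (C1mx_add oU CB (C1mx_cst _ oU)).
move=> i j; apply: (C1on_eq oU _ (C1onN oU (C1 i j))) => y _.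
by rewrite /V /chart_field mxE.
Qed.

Let detG y : U y -> 0 < \det (G y).
Proof. by move=> Uy; apply: det_gram_gt0 (NN Uy) (XN Uy); exact: Jf. Qed.

Lemma C1on_vol_density : C1on U w.
Proof. exact: (C1on_sqrt oU (C1on_det oU CG) detG). Qed.

Lemma vol_density_gt0 y : U y -> 0 < w y.
Proof. by move=> Uy; rewrite sqrtr_gt0 detG. Qed.

(** Jacobi's formula for [\det (J *m J^T)]; the two terms of the product rule have the same trace by
    transposition, which cancels the factor 2 of the square root. *)
Lemma derive_vol_density v y : U y -> 'D_v w y = w y * \tr ('D_v J y *m Jp y).
Proof.
move=> Uy.
have dJ : derivable J y v by exact: C1mx_derivable CJ Uy.
have [dJT DJT] := derivable_trmx dJ.
have [dG DG] := derivable_mulmx dJ dJT.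
have [ddet Ddet] := derive_det dG.
have d0 := detG Uy.
have dd : differentiable (fun y => \det (G y)) y.
  by have [+ _] := C1on_det oU CG; apply.
have ds := is_derive1_sqrt d0.
have [_ ->] := derive_compR v dd (@ex_derive _ _ _ _ _ _ _ ds).
rewrite derive1E (@derive_val _ _ _ _ _ _ _ ds) Ddet DG DJT.
have adjE : \adj (G y) = \det (G y) *: invmx (G y).
  by rewrite /invmx Gu// scalerA divff ?gt_eqF// scale1r.
rewrite adjE -scalemxAr mxtraceZ mulmxDl mxtraceD.
have E : \tr (J y *m ('D_v J y)^T *m invmx (G y)) = \tr ('D_v J y *m (J y)^T *m invmx (G y)).
  rewrite -mxtrace_tr !trmx_mul trmxK trmx_inv.
  by rewrite /G trmx_mul trmxK mxtrace_mulC.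
have EJ : 'D_v J y *m (J y)^T *m invmx (G y) = 'D_v J y *m Jp y by rewrite /Jp /pinv mulmxA.
rewrite E EJ.
have wE : Num.sqrt (\det (G y)) = w y by [].
have dE : \det (G y) = w y ^+ 2 by rewrite -wE sqr_sqrtr// ltW.
rewrite wE dE.
have := vol_density_gt0 Uy.
move: (w y) (\tr _) => a b a0. field; exact: lt0r_neq0.
Qed.

Let JJp y : U y -> J y *m Jp y = 1%:M. Proof. by move=> Uy; exact: mul_pinv (Jf Uy). Qed.
Let NJp y : U y -> N y *m Jp y = 0. Proof. by move=> Uy; exact: normal_pinv (XN Uy). Qed.

(** Differentiate [N *m N^T = 1]. *)
Lemma derive_normal_orth v y : U y -> 'D_v N y *m (N y)^T = 0.
Proof.
move=> Uy.
have dNy : derivable N y v by exact: C1mx_derivable CN Uy.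
have [dNT DNT] := derivable_trmx dNy.
have [dNN DNN] := derivable_mulmx dNy dNT.
have Z : 'D_v (fun y => N y *m (N y)^T) y = 0.
  rewrite derive_mx//; apply/matrixP => i j; rewrite !mxE.
  apply: (@etrans _ _ ('D_v (fun=> (1%:M : 'M[R]_1) i j) y)); last exact: derive_cst.
  apply: near_eq_derive.
  by apply: filterS (open_near oU Uy) => z Uz; rewrite NN.
move: DNN; rewrite Z DNT => E.
have S : ('D_v N y *m (N y)^T)^T = 'D_v N y *m (N y)^T.
  by apply/matrixP => i j; rewrite mxE !ord1.
have E2 : 'D_v N y *m (N y)^T + 'D_v N y *m (N y)^T = 0.
  by rewrite -[X in _ + X]S trmx_mul trmxK -E.
apply/matrixP => i j; have := congr1 (fun M : 'M[R]_1 => M i j) E2.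
by rewrite !mxE => /eqP; rewrite -mulr2n mulrn_eq0 /= => /eqP.
Qed.

Lemma jacobian_normal_orth y : U y -> JN y *m (N y)^T = 0.
Proof.
move=> Uy; apply/row_matrixP => i; rewrite row_mul row0 (row_jacobian dN i Uy).
exact: derive_normal_orth.
Qed.

(** Differentiate the decomposition [N^T *m N + pinv J *m J = 1] and multiply on the right by
    [pinv J], which is annihilated by [N] and inverted by [J]. *)
Lemma derive_pinv v y : U y ->
  'D_v Jp y = - (Jp y *m 'D_v J y *m Jp y) - (N y)^T *m 'D_v N y *m Jp y.
Proof.
move=> Uy.
have dNy : derivable N y v by exact: C1mx_derivable CN Uy.
have dJy : derivable J y v by exact: C1mx_derivable CJ Uy.
have dJpy : derivable Jp y v by exact: C1mx_derivable CJp Uy.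
have [dNT DNT] := derivable_trmx dNy.
have [dNN DNN] := derivable_mulmx dNT dNy.
have [dJJ DJJ] := derivable_mulmx dJpy dJy.
have Z : 'D_v (fun y => (N y)^T *m N y) y + 'D_v (fun y => Jp y *m J y) y = 0.
  rewrite -(deriveD dNN dJJ) (derive_mx (derivableD dNN dJJ)).
  apply/matrixP => i j; rewrite !mxE.
  apply: (@etrans _ _ ('D_v (fun=> (1%:M : 'M[R]_n.+1) i j) y)); last exact: derive_cst.
  apply: near_eq_derive.
  apply: filterS (open_near oU Uy) => z Uz.
  by rewrite -(pinv_mul (Jf Uz) (NN Uz) (XN Uz)).
move: Z; rewrite DNN DJJ DNT => /(congr1 (mulmx^~ (Jp y))).
rewrite mul0mx !mulmxDl -!mulmxA (NJp Uy) (JJp Uy) mulmx1 mulmx0 add0r.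
move=> /eqP; rewrite addrC -addrA addr_eq0 => /eqP ->; rewrite opprD.
by rewrite !mulmxA.
Qed.

Lemma divergence_chart_field y : U y ->
  \sum_i 'D_(delta_mx 0 i) (fun z => w z * V z 0 i) y =
  w y * (dotv (X y) (N y) * (\tr (B y *m B y) - n%:R * H ^+ 2)).
Proof.
move=> Uy.
pose K i := 'D_(delta_mx 0 i) J y *m Jp y.
pose E i := 'D_(delta_mx 0 i) JN y *m Jp y.
pose xi := X y *m Jp y.
have dJpy v : derivable Jp y v by exact: C1mx_derivable CJp Uy.
have dJNy v : derivable JN y v by exact: C1mx_derivable CJN Uy.
have dXy v : derivable X y v by exact: C1mx_derivable CX Uy.
have JNN := jacobian_normal_orth Uy.
have DB i : 'D_(delta_mx 0 i) B y = E i - B y *m K i.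
  have [_ ->] := derivable_mulmx (dJNy (delta_mx 0 i)) (dJpy (delta_mx 0 i)).
  by rewrite (derive_pinv _ Uy); exact: derive_shape_algebra.
have dBy v : derivable B y v by exact: C1mx_derivable CB Uy.
(* The trace of [B] is constant, so the trace of its derivative [E k - B *m K k] vanishes. *)
have trE k : \tr (E k) = \tr (B y *m K k).
  apply/eqP; rewrite -subr_eq0 -linearB /= -DB (derive_mx (dBy _)).
  have -> : \tr (\matrix_(i, j) 'D_(delta_mx 0 k) (fun t => B t i j) y) =
     'D_(delta_mx 0 k) (fun t => \tr (B t)) y.
    rewrite /mxtrace -[RHS](_ : 'D_(delta_mx 0 k) (\sum_i (fun t => B t i i)) y = _).
      rewrite derive_sum; last by move=> i; exact: (C1on_derivable (CB i i) Uy).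
      by apply: eq_bigr => i _; rewrite mxE.
    by congr ('D_ _ _ y); apply/funext => t; rewrite fct_sumE.
  apply/eqP; apply: (@etrans _ _ ('D_(delta_mx 0 k) (fun=> - (n%:R * H)) y)); last exact: derive_cst.
  apply: near_eq_derive.
  by apply: filterS (open_near oU Uy) => z Uz; exact: trB.
have DV i : 'D_(delta_mx 0 i) V y =
  - (delta_mx 0 i *m (B y + H%:M)) + xi *m K i *m (B y + H%:M)
    + dotv (X y) (N y) *: (delta_mx 0 i *m B y *m (B y + H%:M)) - xi *m E i + xi *m B y *m K i.
  have [dXJ DXJ] := derivable_mulmx (dXy (delta_mx 0 i)) (dJpy (delta_mx 0 i)).
  have dBH : derivable (fun y => B y + H%:M) y (delta_mx 0 i).
    exact: (@derivableD _ _ _ B (cst H%:M) _ _ (dBy _) (derivable_cst _ _ _)).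
  have DBH : 'D_(delta_mx 0 i) (fun y => B y + H%:M) y = E i - B y *m K i.
    rewrite (@deriveD _ _ _ B (cst H%:M) _ _ (dBy _) (derivable_cst _ _ _)).
    by rewrite derive_cst addr0 DB.
  have [dP DP] := derivable_mulmx dXJ dBH.
  have RX : 'D_'e_i X y = 'e_i *m J y := deriveEjacobian _ (dX Uy).
  have RN : 'D_'e_i N y = 'e_i *m JN y := deriveEjacobian _ (dN Uy).
  have DQ := etrans (derive_pinv 'e_i Uy) (congr1 (fun b => - (Jp y *m 'D_'e_i J y *m Jp y)
    - (N y)^T *m b *m Jp y) RN).
  have DXQ := etrans DXJ (congr2 (fun a b => a *m Jp y + X y *m b) RX DQ).
  have DF := etrans DP (congr2 (fun a b => a *m (B y + H%:M) + (X y *m Jp y) *m b) DXQ DBH).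
  have DFN := etrans (@deriveN _ _ _ (fun y => X y *m Jp y *m (B y + H%:M)) _ _ dP) (congr1 -%R DF).
  apply: (etrans DFN); apply: derive_field_algebra; first exact: JJp.
  by rewrite /dotv -mx11_scalar.
have dwy v : derivable w y v by exact: (C1on_derivable C1on_vol_density Uy).
have Ksym i k l : K i k l = K k i l.
  rewrite /K [LHS]mxE [RHS]mxE; apply: eq_bigr => j _; congr (_ * _).
  exact: (jacobian_sym oU dX CX CX2 i k j Uy).
have Esym i k l : E i k l = E k i l.
  rewrite /E [LHS]mxE [RHS]mxE; apply: eq_bigr => j _; congr (_ * _).
  exact: (jacobian_sym oU dN CN CN2 i k j Uy).
apply: (etrans _ (congr1 ( *%R (w y))
  (divergence_algebra xi (dotv (X y) (N y)) Ksym Esym (trB Uy) trE))).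
apply: (etrans _ (esym (mulr_sumr _ _ _ _))).
apply: eq_bigr => i _.
have dVy : derivable V y (delta_mx 0 i) by exact: C1mx_derivable C1mx_chart_field Uy.
have dVi : derivable (fun z => V z 0 i) y (delta_mx 0 i).
  exact: ((derivable_mxP _ _ _).1 dVy 0 i).
have DVi : 'D_'e_i (fun z => V z 0 i) y = ('D_'e_i V y) 0 i.
  by rewrite (derive_mx dVy) [RHS]mxE.
apply: (etrans (deriveM (dwy (delta_mx 0 i)) dVi)).
apply: (etrans (congr2 (fun a b => w y *: a + V y 0 i *: b)
  (etrans DVi (congr1 (fun M : 'rV[R]_n => M 0 i) (DV i))) (derive_vol_density _ Uy))).
cbv beta; rewrite -/(K i) /V /chart_field -/xi.
move: ((_ + xi *m B y *m K i) 0 i) => p.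
move: ((- (xi *m (B y + H%:M))) 0 i) (\tr (K i)) (w y) => q r t.
by rewrite /GRing.scale /=; ring.
Qed.

End chart_divergence.

(** * Lebesgue measure on row vectors *)

Notation Borel T := (g_sigma_algebraType (@open T)) (only parsing).

Section borel_rV.
Variable R : realType.

Lemma open_borel (T : ptopologicalType) (A : set T) : open A ->
  measurable (A : set (Borel T)).
Proof. by move=> oA; apply: sub_sigma_algebra. Qed.

Lemma open_continuous_measurable_borel (T : ptopologicalType) (D : set T) (f : T -> R) :
  open D -> (forall p, D p -> {for p, continuous f}) ->
  measurable_fun (D : set (Borel T)) (f : Borel T -> R).
Proof.
move=> oD cf; apply: (measurability _ (measurable_realfun.RGenOpens.measurableE R)).
move=> _ [_ [a [b ->] <-]]; apply: open_borel.
rewrite openE => p [Dp /= fp]; apply: filterI; first exact: open_nbhs_nbhs.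
by apply: (cf _ Dp); apply: open_nbhs_nbhs; split => //; exact: interval_open.
Qed.

Lemma continuous_measurable_borel (T : ptopologicalType) (f : T -> R) :
  continuous f -> measurable_fun setT (f : Borel T -> R).
Proof. by move=> cf; apply: (open_continuous_measurable_borel openT) => p _; exact: cf. Qed.

Lemma rV_ball n (r : 'rV[R]_n) (e : R) : 0 < e ->
  ball r e = [set v | forall j, `|r 0 j - v 0 j| < e].
Proof.
move=> e0; apply/seteqP; split=> v /=.
  by move=> [_ H] j; have := H 0 j; rewrite -ball_normE.
by move=> H; split => // i j; rewrite (ord1 i) -ball_normE; exact: H.
Qed.

(** An open set is the union of the balls it contains that have a rational centre and a radius
    [1 / (k + 1)]. There are countably many of them, and the preimage of a sup-norm ball is a finite
    intersection of conditions on the coordinates. *)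
Lemma measurable_rV n d (T : measurableType d) (f : T -> 'rV[R]_n) :
  (forall j, measurable_fun setT (fun t => f t 0 j)) ->
  measurable_fun setT (f : T -> Borel 'rV[R]_n).
Proof.
move=> mf.
apply: (@measurability _ _ _ (Borel 'rV[R]_n) _ _ (@open 'rV[R]_n)) => //.
move=> _ [A oA <-]; rewrite setTI.
pose c (p : 'rV[rat]_n * nat) : 'rV[R]_n := map_mx ratr p.1.
pose e (p : 'rV[rat]_n * nat) : R := p.2.+1%:R^-1.
have e0 p : 0 < e p by rewrite invr_gt0.
pose P := [set p | ball (c p) (e p) `<=` A].
have -> : f @^-1` A = \bigcup_(p in P) f @^-1` (ball (c p) (e p)).
  apply/seteqP; split => [t /= Aft|t [p Pp /= B]]; last exact: Pp.
  have /nbhs_ballP[d' /= d0 dA] := open_nbhs_nbhs (conj oA Aft).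
  have [k kd] : exists k : nat, k.+1%:R^-1 < d' / 2.
    exists (Num.trunc ((d' / 2)^-1)); rewrite invf_plt ?posrE ?divr_gt0//.
    exact: truncnS_gt.
  have k0 : (0:R) < k.+1%:R^-1 by rewrite invr_gt0.
  have : forall j : 'I_n, exists q : rat, `|ratr q - f t 0 j| < k.+1%:R^-1.
    move=> j.
    have lt : f t 0 j - k.+1%:R^-1 < f t 0 j + k.+1%:R^-1.
      by rewrite ltrBlDr -addrA ltrDl addr_gt0.
    have [q] := rat_in_itvoo lt.
    by rewrite in_itv /= => h; exists q; rewrite ltr_distl.
  move=> /choice[q Hq]; exists (\row_j q j, k).
    move=> v; rewrite rV_ball//= => Hv; apply: dA; rewrite rV_ball//= => j.
    have := Hv j; have := Hq j; rewrite /c /e /= !mxE => h1 h2.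
    rewrite -(subrKA (ratr (q j))); apply: (le_lt_trans (ler_normD _ _)).
    rewrite distrC (splitr d'); apply: ltrD; exact: lt_trans kd.
  rewrite /= rV_ball//= => j; have := Hq j; by rewrite /c /e !mxE.
have -> : \bigcup_(p in P) f @^-1` (ball (c p) (e p)) =
    \bigcup_p (if `[< P p >] then f @^-1` (ball (c p) (e p)) else set0).
  apply/seteqP; split => [t [p Pp B]|t [p _]].
    by exists p => //; rewrite asboolT.
  by case: asboolP => // Pp B; exists p.
apply: countable_bigcupT_measurable => [|p]; first exact: countableP.
case: asboolP => // _.
have -> : f @^-1` (ball (c p) (e p)) =
    \bigcap_(j in [set: 'I_n]) ((fun t => f t 0 j) @^-1` [set x | `|c p 0 j - x| < e p]).
  apply/seteqP; split=> [t|t Ht] /=; rewrite rV_ball//=.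
    by move=> Ht j _; exact: Ht.
  by move=> j; exact: Ht.
apply: fin_bigcap_measurable => [|j _]; first exact: finite_finset.
rewrite -[X in measurable X]setTI; apply: (mf j) => //.
apply: open_measurable; rewrite (_ : [set x | _] = ball (c p 0 j) (e p)).
  exact: ball_open.
by rewrite -ball_normE.
Qed.

(** Links the product sigma-algebra, where Tonelli's theorem lives, with the Borel sets of row
    vectors. *)
Lemma measurable_row_mx n :
  measurable_fun setT ((fun p : R * 'rV[R]_n => row_mx (const_mx p.1 : 'rV[R]_1) p.2)
     : measurableTypeR R * Borel 'rV[R]_n -> Borel 'rV[R]_(1 + n)).
Proof.
apply: measurable_rV => j.
have [k ->|k ->] := split_ordP j.
  rewrite (_ : (fun _ => _) = fst).
    exact: measurable_fst.
  by apply/funext => p /=; rewrite row_mxEl mxE.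
rewrite (_ : (fun _ => _) = (fun v : Borel 'rV[R]_n => v 0 k) \o snd); last first.
  by apply/funext => p /=; rewrite row_mxEr.
apply: measurableT_comp => //.
apply: continuous_measurable_borel => v; exact: coord_continuous.
Qed.

End borel_rV.

(** An alias of [mu] that carries the proof of sigma-finiteness, so that a hypothesis can be turned
    into an inferred structure. *)
Definition sigma_finite_pack d (T : measurableType d) (R : realType)
  (mu : {measure set T -> \bar R}) of sigma_finite setT mu : set T -> \bar R := mu.

Section sigma_finite_pack.
Context d (T : measurableType d) (R : realType) (mu : {measure set T -> \bar R}).
Variable smu : sigma_finite setT mu.
HB.instance Definition _ := Measure.on (sigma_finite_pack smu).
HB.instance Definition _ :=
  Measure_isSigmaFinite.Build _ _ _ (sigma_finite_pack smu) smu.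
End sigma_finite_pack.

Section lebesgue_rV.
Variable R : realType.
Local Open Scope ereal_scope.

(** Iterated integrals have no convergence theorems of their own; through this relation they inherit
    those of a genuine measure. *)
Definition integrates_rV n (mu : {measure set (Borel 'rV[R]_n) -> \bar R}) :=
  forall f : 'rV[R]_n -> \bar R, measurable_fun setT (f : Borel 'rV[R]_n -> \bar R) ->
    (forall y, 0 <= f y) -> lebesgue_integral_rV f = \int[mu]_y f y.

Definition cube n (k : R) : set 'rV[R]_n := [set v | forall j, (`|v 0%R j| <= k)%R].

Arguments cube n k : clear implicits.

Lemma measurable_cube n k : measurable (cube n k : set (Borel 'rV[R]_n)).
Proof.
have -> : cube n k = \bigcap_(j in [set: 'I_n]) ((fun v : Borel 'rV[R]_n => v 0%R j) @^-1` [set x | (`|x| <= k)%R]).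
  by apply/seteqP; split=> [v H j _|v H j]; exact: H.
apply: fin_bigcap_measurable => [|j _]; first exact: finite_finset.
have mj : measurable_fun setT (fun v : Borel 'rV[R]_n => v 0%R j).
  apply: continuous_measurable_borel => v; exact: coord_continuous.
rewrite -[X in measurable X]setTI; apply: mj => //.
rewrite (_ : [set x | _] = `[(- k)%R, k]%classic); first exact: measurable_itv.
by apply/seteqP; split => x /=; rewrite in_itv /= ler_norml.
Qed.

Lemma cube_row_mx n (t k : R) (v : 'rV[R]_n) :
  cube (1 + n) k (row_mx (const_mx t : 'rV[R]_1) v) <-> (`|t| <= k)%R /\ cube n k v.
Proof.
split => [H|[tk H] j].
  split => [|j]; last first.
    by have := H (rshift 1 j); rewrite row_mxEr.
  by have := H (lshift n 0%R); rewrite row_mxEl mxE.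
by have [a ->|a ->] := split_ordP j; [rewrite row_mxEl mxE|rewrite row_mxEr; exact: H].
Qed.

Lemma lebesgue_integral_rV0 n : lebesgue_integral_rV (fun _ : 'rV[R]_n => 0) = 0.
Proof.
elim: n => //= n IH; under eq_integral do rewrite IH.
by rewrite integral0.
Qed.

Lemma lebesgue_integral_cube n k : (0 <= k)%R ->
  lebesgue_integral_rV (fun v => (\1_(cube n k) v)%:E) = ((2 * k) ^+ n)%:E.
Proof.
move=> k0; elim: n => [|n IH] /=.
  by rewrite indicE mem_set//= => -[].
transitivity (\int[lebesgue_measure]_(t in [set: R])
    ((\1_(`[(- k)%R, k]%classic) t)%:E * ((2 * k) ^+ n)%:E)).
  apply: eq_integral => t _.
  rewrite -IH.
  have [tk|tk] := boolP (t \in `[(- k)%R, k]%classic).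
    rewrite indicE tk mul1e; congr lebesgue_integral_rV; apply/funext => v.
    rewrite !indicE; congr ((nat_of_bool _)%:R%:E).
    move: tk; rewrite inE /= in_itv /= -ler_norml => tk.
    apply/idP/idP; rewrite !inE => H; first exact: ((cube_row_mx _ _ _).1 H).2.
    exact: (cube_row_mx _ _ _).2.
  rewrite indicE (negbTE tk) mul0e -[RHS](lebesgue_integral_rV0 n).
  congr lebesgue_integral_rV; apply/funext => v; rewrite indicE memNset//= => H.
  move: tk; rewrite notin_setE /= in_itv /= -ler_norml; apply.
  exact: ((cube_row_mx _ _ _).1 H).1.
have mI : measurable_fun [set: measurableTypeR R] (EFin \o (\1_(`[(- k)%R, k]%classic : set (measurableTypeR R)) : _ -> R)).
  apply/measurable_EFinP; apply: measurable_indic; exact: measurable_itv.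
rewrite (@ge0_integralZr _ (measurableTypeR R) _ lebesgue_measure setT measurableT _ mI); last 2 first.
- by move=> t _; rewrite lee_fin.
- by rewrite lee_fin exprn_ge0// mulr_ge0.
have mi : measurable (`[(- k)%R, k]%classic : set (measurableTypeR R)) by exact: measurable_itv.
rewrite (integral_indic _ measurableT mi) setIT /= lebesgue_measure_itv /= lte_fin.
case: ltrP => kk; first by rewrite opprK -EFinD -EFinM exprS; congr (_%:E); ring.
(* The interval is degenerate, and both sides vanish because the exponent is a successor. *)
have -> : k = 0%R by lra.
by rewrite mul0e mulr0 exprS mul0r.
Qed.

Lemma integrates_rV_cube n mu k : @integrates_rV n mu -> (0 <= k)%R ->
  mu (cube n k) = ((2 * k) ^+ n)%:E.
Proof.
move=> Hmu k0; rewrite -lebesgue_integral_cube// Hmu.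
- by rewrite integral_indic ?setIT//; exact: measurable_cube.
- by apply: measurableT_comp => //; apply: measurable_indic; exact: measurable_cube.
- by move=> y; rewrite lee_fin.
Qed.

Lemma bigcup_cube n : \bigcup_i cube n i%:R = [set: 'rV[R]_n].
Proof.
apply/seteqP; split=> // v _.
exists (Num.trunc `|v|).+1 => // j.
apply: le_trans (ltW (truncnS_gt _)).
rewrite [leRHS]/Num.norm/= mx_normrE.
exact: (le_bigmax _ (fun ij => `|v ij.1 ij.2|%R) (0%R, j)).
Qed.

Lemma integrates_rV_sigma_finite n mu : @integrates_rV n mu -> sigma_finite setT mu.
Proof.
move=> Hmu; exists (fun i => cube n i%:R); first by rewrite bigcup_cube.
move=> i; split; first exact: measurable_cube.
by rewrite integrates_rV_cube// ltry.
Qed.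

(** Induction on the dimension, starting from the Dirac mass at the only row vector of size 0: the
    product with the Lebesgue measure of the line is pushed forward by concatenation, and Tonelli's
    theorem gives the iterated integral. Volumes of cubes provide the sigma-finiteness required at
    each stage. *)
Lemma lebesgue_rV_exists n :
  exists mu : {sigma_finite_measure set (Borel 'rV[R]_n) -> \bar R}, integrates_rV mu.
Proof.
suff [mu Hmu] : exists mu : {measure set (Borel 'rV[R]_n) -> \bar R}, integrates_rV mu.
  by exists (sigma_finite_pack (integrates_rV_sigma_finite Hmu)).
elim: n => [|n [mu Hmu]].
  exists (dirac (0%R : Borel 'rV[R]_0)) => f mf f0 /=.
  by rewrite integral_dirac// diracT mul1e.
pose mu' : {sigma_finite_measure set (Borel 'rV[R]_n) -> \bar R} :=
  sigma_finite_pack (integrates_rV_sigma_finite Hmu).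
pose phi := ((fun p : R * 'rV[R]_n => row_mx (const_mx p.1 : 'rV[R]_1) p.2)
     : measurableTypeR R * Borel 'rV[R]_n -> Borel 'rV[R]_(1 + n)).
have mphi : measurable_fun setT phi by exact: measurable_row_mx.
pose l1 : {sigma_finite_measure set (measurableTypeR R) -> \bar R} := lebesgue_measure.
exists (pushforward (l1 \x mu') phi) => f mf f0 /=.
rewrite (ge0_integral_pushforward mphi _ measurableT mf (fun y _ => f0 y)).
rewrite preimage_setT (fubini_tonelli1 _ (measurableT_comp mf mphi) (fun y => f0 _)).
apply: eq_integral => t _; rewrite /fubini_F.
have mt : measurable_fun setT ((fun v => f (phi (t, v))) : Borel 'rV[R]_n -> \bar R).
  apply: (measurableT_comp mf); exact: (measurableT_comp mphi (pair1_measurable t)).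
by rewrite (Hmu _ mt (fun v => f0 _)).
Unshelve. all: exact: mphi.
Qed.

End lebesgue_rV.
Arguments cube {R} n k.

(** * Translation invariance *)

Section translation.
Variable R : realType.
Local Open Scope ereal_scope.

(** The image of the Lebesgue measure by a translation agrees with it on half-open intervals, hence
    everywhere by uniqueness. *)
Lemma ge0_integral_shift (f : R -> \bar R) (a : R) :
  measurable_fun [set: measurableTypeR R] f -> (forall t, 0 <= f t) ->
  \int[lebesgue_measure]_t f (t + a)%R = \int[lebesgue_measure]_t f t.
Proof.
move=> mf f0.
pose s := (fun t => (t + a)%R) : measurableTypeR R -> measurableTypeR R.
have ms : measurable_fun setT s by exact: measurable_funD.
rewrite -[LHS](@ge0_integral_pushforward _ _ _ _ _ s ms lebesgue_measure setT f measurableT mf)//.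
apply: eq_measure_integral => A mA _; apply/esym.
apply: lebesgue_measure_unique => //= _ [[b c]] _ <- /=.
rewrite /pushforward.
have -> : s @^-1` `]b, c]%classic = `](b - a)%R, (c - a)%R]%classic.
  by apply/seteqP; split=> t /=; rewrite /s !in_itv /= ltrBlDr lerBrDr.
rewrite !lebesgue_measure_itv /= !lte_fin ltrD2r.
by case: ifP => // _; rewrite -!EFinB opprB addrA subrK.
Qed.

Lemma measurable_shift_rV n (v : 'rV[R]_n) :
  measurable_fun setT ((fun y => y + v)%R : Borel 'rV[R]_n -> Borel 'rV[R]_n).
Proof.
apply: measurable_rV => j; apply: continuous_measurable_borel => y.
rewrite (_ : (fun _ => _) = (fun y : 'rV[R]_n => y 0%R j + v 0%R j)%R); last first.
  by apply/funext => z; rewrite mxE.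
apply: (@continuousD _ _ _ (fun y : 'rV[R]_n => y 0%R j) (cst (v 0%R j))).
  exact: coord_continuous.
exact: cst_continuous.
Qed.

Lemma lebesgue_integral_rV_shift n (f : 'rV[R]_n -> \bar R) (v : 'rV[R]_n) :
  measurable_fun setT (f : Borel 'rV[R]_n -> \bar R) -> (forall y, 0 <= f y) ->
  lebesgue_integral_rV (fun y => f (y + v)%R) = lebesgue_integral_rV f.
Proof.
elim: n f v => [|n IH] f v mf f0 /=; first by congr f; apply/rowP => -[].
have [lam Hlam] := lebesgue_rV_exists R n.
pose phi := ((fun p : R * 'rV[R]_n => row_mx (const_mx p.1 : 'rV[R]_1) p.2)
     : measurableTypeR R * Borel 'rV[R]_n -> Borel 'rV[R]_(1 + n)).
have mphi : measurable_fun setT phi by exact: measurable_row_mx.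
have mt t : measurable_fun setT ((fun w => f (phi (t, w))) : Borel 'rV[R]_n -> \bar R).
  by apply: (measurableT_comp mf); exact: (measurableT_comp mphi (pair1_measurable t)).
pose F t := lebesgue_integral_rV (fun w => f (phi (t, w))).
have FE : F = fun t => \int[lam]_w f (phi (t, w)).
  by apply/funext => t; rewrite /F Hlam.
have mF : measurable_fun [set: measurableTypeR R] F.
  rewrite FE.
  exact: (@measurable_fun_fubini_tonelli_F _ _ (measurableTypeR R) (Borel 'rV[R]_n) R
    lam (f \o phi) (measurableT_comp mf mphi) (fun y => f0 _)).
have F0 t : 0 <= F t by rewrite FE; apply: integral_ge0.
pose a := v 0%R (lshift n 0%R : 'I_(1 + n)).
pose v' : 'rV[R]_n := rsubmx (v : 'rV[R]_(1 + n)).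
rewrite -[RHS](ge0_integral_shift a mF F0).
apply: eq_integral => t _.
rewrite /F -[RHS](IH _ v' (mt _))//.
have E w : (row_mx (const_mx t : 'rV[R]_1) w + (v : 'rV[R]_(1 + n)) =
    row_mx (const_mx (t + a)%R) (w + v'))%R.
  rewrite -[in LHS](hsubmxK (v : 'rV[R]_(1 + n))) [LHS]add_row_mx; congr row_mx.
  by apply/rowP => i; rewrite !mxE (ord1 i).
by congr lebesgue_integral_rV; apply/funext => w; rewrite E.
Qed.

Lemma integral_rV_shift n (lam : {measure set (Borel 'rV[R]_n) -> \bar R})
  (f : 'rV[R]_n -> \bar R) (v : 'rV[R]_n) : integrates_rV lam ->
  measurable_fun setT (f : Borel 'rV[R]_n -> \bar R) ->
  \int[lam]_y f (y + v)%R = \int[lam]_y f y.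
Proof.
move=> Hlam mf.
have H g : measurable_fun setT (g : Borel 'rV[R]_n -> \bar R) -> (forall y, 0 <= g y) ->
  \int[lam]_y g (y + v)%R = \int[lam]_y g y.
  move=> mg g0; rewrite -Hlam//.
    by rewrite lebesgue_integral_rV_shift// Hlam.
  exact: (measurableT_comp mg (measurable_shift_rV v)).
rewrite [LHS]integralE [RHS]integralE; congr (_ - _).
  rewrite -(H _ (measurable_funepos mf) (funepos_ge0 f)).
  by apply: eq_integral => y _; rewrite !funeposE.
rewrite -(H _ (measurable_funeneg mf) (funeneg_ge0 f)).
by apply: eq_integral => y _; rewrite !funenegE.
Qed.

End translation.

(** * Integration against a density *)

Section integral_density.
Local Open Scope ereal_scope.
Import HBNNSimple.
Context d1 d2 (Y : measurableType d1) (T : measurableType d2) (R : realType).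
Variables (lam : {measure set Y -> \bar R}) (mu : {measure set T -> \bar R}).
Variables (D : set T) (c : Y -> T) (w : Y -> R).
Hypotheses (mD : measurable D) (mc : measurable_fun setT c)
  (mw : measurable_fun setT w) (w0 : forall y, (0 <= w y)%R).
Hypothesis muE : forall E, measurable E ->
  mu (E `&` D) = \int[lam]_y (\1_E (c y) * w y)%:E.

Let sfun_density (f : {nnsfun T >-> R}) :
  \int[mu]_(p in D) (f p)%:E = \int[lam]_y (f (c y) * w y)%:E.
Proof.
have fE x : (f x)%:E = \sum_(k \in range f) k%:E * (\1_(f @^-1` [set k]) x)%:E.
  by rewrite fsumEFin //= fimfunE.
have fcE y : (f (c y) * w y)%:E =
    \sum_(k \in range f) k%:E * (\1_(f @^-1` [set k]) (c y) * w y)%:E.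
  rewrite EFinM fE muleC ge0_mule_fsumr; last by move=> k; exact: nnfun_muleindic_ge0.
  by apply: eq_fsbigr => k _; rewrite EFinM muleCA [(w y)%:E * _]muleC.
have mk k : measurable_fun setT (fun y => (\1_(f @^-1` [set k]) (c y) * w y)%:E).
  apply/measurable_EFinP; apply: measurable_funM => //.
  by apply: (measurableT_comp _ mc); apply: measurable_indic.
under [LHS]eq_integral do rewrite fE.
have mD1 k : measurable_fun D (fun p => k%:E * (\1_(f @^-1` [set k]) p)%:E).
  refine (measurable_funS measurableT (@subsetT _ D) _).
  by apply: measurable_funeM; exact/measurable_EFinP/measurable_indic.
have mD2 k : measurable_fun setT (fun y => k%:E * (\1_(f @^-1` [set k]) (c y) * w y)%:E).
  by apply: measurable_funeM; exact: mk.
have D10 k p : D p -> 0 <= k%:E * (\1_(f @^-1` [set k]) p)%:E.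
  by move=> _; exact: nnfun_muleindic_ge0.
have D20 k y : [set: Y] y -> 0 <= k%:E * (\1_(f @^-1` [set k]) (c y) * w y)%:E.
  by move=> _; rewrite EFinM muleA mule_ge0 ?lee_fin//; exact: nnfun_muleindic_ge0.
rewrite (ge0_integral_fsum mu mD mD1 D10)//.
under [RHS]eq_integral do rewrite fcE.
rewrite (ge0_integral_fsum lam measurableT mD2 D20)//.
apply: eq_fsbigr => k; rewrite inE => -[z _ <-{k}].
have mp : measurable (f @^-1` [set f z]) by exact: measurable_sfunP.
have mI : measurable_fun D (fun p => (\1_(f @^-1` [set f z]) p : R)%:E).
  refine (measurable_funS measurableT (@subsetT _ D) _); exact/measurable_EFinP/measurable_indic.
have fz0 : 0 <= (f z)%:E by rewrite lee_fin.
rewrite (ge0_integralZl mu mD mI _ fz0); last by move=> p _; rewrite lee_fin.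
rewrite (integral_indic mu mD mp) (muE mp) (ge0_integralZl lam measurableT (mk (f z)) _ fz0)//.
by move=> y _; rewrite lee_fin mulr_ge0.
Qed.

(** The identity [muE] for indicators extends to simple functions by linearity, then to nonnegative
    functions by monotone convergence on both sides. *)
Lemma ge0_integral_density (F : T -> \bar R) : measurable_fun setT F ->
  (forall p, 0 <= F p) -> \int[mu]_(p in D) F p = \int[lam]_y (F (c y) * (w y)%:E).
Proof.
move=> mF F0; pose g := nnsfun_approx measurableT mF.
have L : \int[mu]_(p in D) (g n p)%:E @[n \oo] --> \int[mu]_(p in D) F p.
  have -> : \int[mu]_(p in D) F p = \int[mu]_(p in D) limn (EFin \o g ^~ p).
    by apply: eq_integral => p _; apply/esym/cvg_lim => //; exact: cvg_nnsfun_approx.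
  apply: cvg_monotone_convergence => //.
  - by move=> n; apply: measurable_funTS; exact/measurable_EFinP.
  - by move=> n y _; rewrite lee_fin.
  - by move=> y _ a b ab; rewrite lee_fin; exact/lefP/nd_nnsfun_approx.
have L2 : \int[lam]_y (g n (c y) * w y)%:E @[n \oo] --> \int[lam]_y (F (c y) * (w y)%:E).
  have -> : \int[lam]_y (F (c y) * (w y)%:E) =
      \int[lam]_y limn (fun n => (g n (c y) * w y)%:E).
    apply: eq_integral => y _; apply/esym/cvg_lim => //.
    under eq_fun do rewrite EFinM muleC.
    rewrite muleC; apply: cvgeZl => //; exact: cvg_nnsfun_approx.
  apply: cvg_monotone_convergence => //.
  - move=> n; apply/measurable_EFinP; apply: measurable_funM => //.
    exact: measurableT_comp.
  - by move=> n y _; rewrite lee_fin mulr_ge0.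
  - move=> y _ a b ab; rewrite lee_fin ler_wpM2r//; exact/lefP/nd_nnsfun_approx.
have E : (fun n => \int[mu]_(p in D) (g n p)%:E) = (fun n => \int[lam]_y (g n (c y) * w y)%:E).
  by apply/funext => n; exact: sfun_density.
rewrite E in L; exact: cvg_unique L L2.
Qed.

Lemma integral_density (F : T -> R) : measurable_fun setT F ->
  \int[mu]_(p in D) (F p)%:E = \int[lam]_y (F (c y) * w y)%:E.
Proof.
move=> mF; rewrite [LHS]integralE [RHS]integralE; congr (_ - _).
  rewrite ge0_integral_density//; last first.
    by apply: measurable_funepos; exact/measurable_EFinP.
  apply: eq_integral => y _; rewrite !funeposE /=.
  by rewrite -!EFin_max -EFinM maxr_pMl// mul0r.
rewrite ge0_integral_density//; last first.
  by apply: measurable_funeneg; exact/measurable_EFinP.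
apply: eq_integral => y _; rewrite !funenegE /=.
by rewrite -!EFin_max -EFinM maxr_pMl// mul0r mulNr.
Qed.

End integral_density.

(** * Paths and the induced distance *)

Section smoothstep.
Variable R : realType.
Implicit Types t : R.

Definition pos_sqr t : R := Num.max 0 t ^+ 2.

Lemma pos_sqr_ge0 t : 0 <= pos_sqr t. Proof. exact: sqr_ge0. Qed.

Lemma is_derive_pos_sqr t : is_derive t 1 pos_sqr (2 * Num.max 0 t).
Proof.
have [t0|t0|->] := ltgtP t 0.
- rewrite mulr0; apply: (@near_eq_is_derive _ _ _ (cst 0)).
  have : \forall z \near t, z < 0 by exact: lt_nbhsl.
  by apply: filterS => z z0; rewrite /pos_sqr max_l ?expr0n// ltW.
- have D : is_derive t (1 : R) (fun z : R => z ^+ 2) (2 * t).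
    by apply: is_derive_eq; rewrite /GRing.scale /=; ring.
  refine (near_eq_is_derive _ D).
  have : \forall z \near t, 0 < z by exact: lt_nbhsr.
  by apply: filterS => z z0; rewrite /pos_sqr max_r// ltW.
- rewrite mulr0.
  have H : (fun h : R => h^-1 *: ((pos_sqr \o shift 0) (h *: 1) - pos_sqr 0)) @ 0^' --> (0 : R).
    apply/cvgrPdist_le => e e0; near=> h.
    have h0 : h != 0 by near: h; exact: nbhs_dnbhs_neq.
    rewrite /= addr0 [h *: 1]mulr1 /pos_sqr maxxx expr0n subr0 sub0r normrN.
    rewrite normrM normfV ler_pdivrMl ?normr_gt0//.
    have he : `|h| <= e by near: h; apply: dnbhs0_le.
    rewrite normrX; have [h1|h1] := leP 0 h.
      by rewrite (ger0_norm h1) expr2 ler_wpM2l// (le_trans _ he)// ler_norm.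
    by rewrite normr0 expr0n mulr_ge0// ltW.
  split; first by apply/cvg_ex; exists 0.
  exact/cvg_lim.
Unshelve. all: by end_near. Qed.

(** A monotone step of class C1, constant outside of the unit interval. It serves to stop paths at
    their ends, so that they can be joined or kept in a domain for all times, and to build bump
    functions. *)
Definition smoothstep t : R := pos_sqr t / (pos_sqr t + pos_sqr (1 - t)).

Let den_gt0 t : 0 < pos_sqr t + pos_sqr (1 - t).
Proof.
have [t0|t0] := leP t 0.
  by rewrite ltr_wpDl ?pos_sqr_ge0// exprn_gt0// lt_max; apply/orP; right; lra.
by rewrite ltr_pwDl ?pos_sqr_ge0// exprn_gt0// lt_max t0 orbT.
Qed.

Lemma smoothstep_le0 t : t <= 0 -> smoothstep t = 0.
Proof. by move=> t0; rewrite /smoothstep {1}/pos_sqr max_l// expr0n mul0r. Qed.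

Lemma smoothstep_ge1 t : 1 <= t -> smoothstep t = 1.
Proof.
move=> t1; have p0 : pos_sqr (1 - t) = 0 by rewrite /pos_sqr max_l ?expr0n// subr_le0.
by have := den_gt0 t; rewrite /smoothstep p0 addr0 => /lt0r_neq0/divff.
Qed.

Lemma smoothstep_ge0 t : 0 <= smoothstep t.
Proof. by rewrite divr_ge0 ?pos_sqr_ge0// ltW. Qed.

Lemma smoothstep_le1 t : smoothstep t <= 1.
Proof. by rewrite ler_pdivrMr// mul1r lerDl pos_sqr_ge0. Qed.

(** The quotient rule after cancellation, in a form whose sign is visible. *)
Definition dsmoothstep t : R :=
  (2 * Num.max 0 t * pos_sqr (1 - t) + pos_sqr t * (2 * Num.max 0 (1 - t)))
  / (pos_sqr t + pos_sqr (1 - t)) ^+ 2.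

Lemma dsmoothstep_ge0 t : 0 <= dsmoothstep t.
Proof.
have m0 (a : R) : 0 <= 2 * Num.max 0 a by rewrite mulr_ge0// le_max lexx.
by rewrite divr_ge0 ?sqr_ge0// addr_ge0// mulr_ge0 ?pos_sqr_ge0.
Qed.

Lemma is_derive_onem t : is_derive t (1 : R) (fun z : R => 1 - z) (-1).
Proof.
have := @is_deriveB _ _ _ (cst 1 : R -> R) (id : R -> R) t 1 0 1 (is_derive_cst _ _ _) (is_derive_id _ _).
by rewrite sub0r.
Qed.

Lemma is_derive_continuous (V : normedModType R) (f : R -> V) t df :
  is_derive t (1 : R) f df -> {for t, continuous f}.
Proof. by move=> [d _]; apply/differentiable_continuous/derivable1_diffP. Qed.

Lemma is_derive_smoothstep t : is_derive t 1 smoothstep (dsmoothstep t).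
Proof.
have D1 := is_derive_pos_sqr t.
have D2 : is_derive t 1 (fun z => pos_sqr (1 - z)) (- (2 * Num.max 0 (1 - t))).
  have d1 := is_derive_pos_sqr (1 - t).
  have d2 := is_derive_onem t.
  have := @is_derive1_comp R pos_sqr (fun z : R => 1 - z) t _ _ d1 d2.
  by rewrite mulrN1.
have D3 := @is_deriveD _ _ _ _ _ _ _ _ _ D1 D2.
have n0 := lt0r_neq0 (den_gt0 t).
have D4 := @is_deriveV _ (pos_sqr + (fun z => pos_sqr (1 - z))) t _ 1 n0 D3.
have D5 := @is_deriveM _ _ _ _ _ _ _ _ D1 D4.
apply: (@is_derive_eq _ _ _ _ _ _ _ _ D5).
rewrite /dsmoothstep /GRing.scale /= !fctE.
move: n0; move: (pos_sqr t) (pos_sqr (1 - t)) (Num.max 0 t) (Num.max 0 (1 - t)) => a b u v n0.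
by field.
Qed.

Lemma continuous_pos_sqr : continuous pos_sqr.
Proof.
move=> t; apply/differentiable_continuous/derivable1_diffP.
by have [] := is_derive_pos_sqr t.
Qed.

Lemma continuous_dsmoothstep : continuous dsmoothstep.
Proof.
have cm : continuous (fun t : R => Num.max 0 t).
  apply: (@max_fun_continuous _ _ R (cst 0) id); [exact: cst_continuous|by move=> t; exact: cvg_id].
have c1 : continuous (fun t : R => 1 - t).
  by move=> t; exact: is_derive_continuous (is_derive_onem t).
have c2 : continuous (fun t : R => pos_sqr (1 - t)).
  move=> t; apply: (@continuous_comp _ _ _ (fun t : R => 1 - t) pos_sqr); first exact: c1.
  exact: continuous_pos_sqr.
have c3 : continuous (fun t : R => Num.max 0 (1 - t)).
  move=> t; apply: (@continuous_comp _ _ _ (fun t : R => 1 - t) (fun t : R => Num.max 0 t)); first exact: c1.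
  exact: cm.
have m2 (f : R -> R) : continuous f -> continuous (fun t => 2 * f t).
  by move=> cf t; apply: (@continuousM _ _ (cst 2) f); [exact: cst_continuous|exact: cf].
have cM (f g : R -> R) : continuous f -> continuous g -> continuous (fun t => f t * g t).
  by move=> cf cg t; apply: (@continuousM _ _ f g); [exact: cf|exact: cg].
have cD (f g : R -> R) : continuous f -> continuous g -> continuous (fun t => f t + g t).
  by move=> cf cg t; apply: (@continuousD _ _ _ f g); [exact: cf|exact: cg].
refine (cM _ _ _ _).
  refine (cD _ _ _ _); [exact: (cM _ _ (m2 _ cm) c2)|exact: (cM _ _ continuous_pos_sqr (m2 _ c3))].
have c4 : continuous (fun t : R => (pos_sqr t + pos_sqr (1 - t)) ^+ 2).
  exact: (cM _ _ (cD _ _ continuous_pos_sqr c2) (cD _ _ continuous_pos_sqr c2)).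
move=> t; apply: (@continuousV _ _ (fun t : R => (pos_sqr t + pos_sqr (1 - t)) ^+ 2)).
  by rewrite expf_neq0// lt0r_neq0.
exact: c4.
Qed.

End smoothstep.

(** * The sup norm and the Euclidean norm *)

Section matrix_norms.
Variable R : realType.

Lemma mx_entry_le p q (A : 'M[R]_(p, q)) i j : `|A i j| <= `|A|.
Proof.
rewrite [leRHS]/Num.norm/= mx_normrE.
exact: (le_bigmax _ (fun ij => `|A ij.1 ij.2|) (i, j)).
Qed.

Lemma mx_norm_le p q (A : 'M[R]_(p, q)) e : 0 <= e ->
  (forall i j, `|A i j| <= e) -> `|A| <= e.
Proof.
move=> e0 H; rewrite [leLHS]/Num.norm/= mx_normrE.
by apply: bigmax_le => // -[i j] _; exact: H.
Qed.

(** The factor [q] is there because the norm is the largest modulus of an entry, which is not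
    submultiplicative. *)
Lemma mx_norm_mul p q r (A : 'M[R]_(p, q)) (B : 'M[R]_(q, r)) :
  `|A *m B| <= q%:R * `|A| * `|B|.
Proof.
apply: mx_norm_le => [|i j]; first by rewrite !mulr_ge0.
rewrite mxE; apply: (le_trans (ler_norm_sum _ _ _)).
apply: (@le_trans _ _ (\sum_(k < q) `|A| * `|B|)).
  by apply: ler_sum => k _; rewrite normrM ler_pM// mx_entry_le.
by rewrite sumr_const card_ord -[_ *+ q]mulr_natl mulrA.
Qed.

Lemma sqr_enorm m (v : 'rV[R]_m) : enorm v ^+ 2 = dotv v v.
Proof. by rewrite sqr_sqrtr// dotv_ge0. Qed.

Lemma enorm_ge0 m (v : 'rV[R]_m) : 0 <= enorm v.
Proof. exact: sqrtr_ge0. Qed.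

Lemma entry_le_enorm m (v : 'rV[R]_m) j : `|v 0 j| <= enorm v.
Proof.
rewrite -(@ler_pXn2r _ 2) ?nnegrE ?enorm_ge0// sqr_enorm real_normK ?num_real//.
rewrite /dotv mxE (bigD1 j)//= mxE expr2 lerDl sumr_ge0// => i _.
by rewrite mxE -expr2 sqr_ge0.
Qed.

Lemma mx_norm_le_enorm m (v : 'rV[R]_m) : `|v| <= enorm v.
Proof. by apply: mx_norm_le => [|i j]; rewrite ?enorm_ge0// (ord1 i) entry_le_enorm. Qed.

Lemma enorm_le_mx_norm m (v : 'rV[R]_m) : enorm v <= m%:R * `|v|.
Proof.
rewrite -(@ler_pXn2r _ 2) ?nnegrE ?enorm_ge0 ?mulr_ge0// sqr_enorm.
rewrite /dotv mxE.
apply: (@le_trans _ _ (\sum_(j < m) `|v| ^+ 2)).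
  apply: ler_sum => j _; rewrite mxE -expr2 -real_normK ?num_real//.
  by rewrite ler_pXn2r ?nnegrE// mx_entry_le.
rewrite sumr_const card_ord -[_ *+ m]mulr_natl exprMn ler_wpM2r ?sqr_ge0//.
by rewrite -natrX ler_nat; case: (m) => // k; rewrite -mulnn leq_pmulr.
Qed.

Lemma enormZ m (a : R) (v : 'rV[R]_m) : enorm (a *: v) = `|a| * enorm v.
Proof.
by rewrite /enorm /dotv -scalemxAl linearZ /= -scalemxAr scalerA mxE -expr2 sqrtrM ?sqr_ge0// sqrtr_sqr.
Qed.

Lemma continuous_mx (T : topologicalType) p q (A : T -> 'M[R]_(p, q)) t :
  (forall i j, {for t, continuous (fun s => A s i j)}) -> {for t, continuous A}.
Proof.
move=> cA; apply/cvgrPdist_le => e e0; near=> s.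
apply: mx_norm_le => [|i j]; first exact: ltW.
rewrite !mxE; move: i j; near: s.
apply: filter_forall => i; apply: filter_forall => j.
by have /cvgrPdist_le/(_ _ e0) := cA i j.
Unshelve. all: by end_near. Qed.

Lemma continuous_entry (T : topologicalType) p q (A : T -> 'M[R]_(p, q)) t i j :
  {for t, continuous A} -> {for t, continuous (fun s => A s i j)}.
Proof.
move=> cA; apply: (@continuous_comp _ _ _ A (fun M : 'M[R]_(p, q) => M i j)) => //.
exact: coord_continuous.
Qed.

Lemma continuous_mulmx (T : topologicalType) p q r (A : T -> 'M[R]_(p, q))
    (B : T -> 'M[R]_(q, r)) t :
  {for t, continuous A} -> {for t, continuous B} -> {for t, continuous (fun s => A s *m B s)}.
Proof.
move=> cA cB; apply: continuous_mx => i j.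
rewrite (_ : (fun _ => _) = fun s => \sum_k A s i k * B s k j); last first.
  by apply/funext => s; rewrite mxE.
elim: (index_enum _) => [|k s IH].
  rewrite (_ : (fun _ => _) = cst 0); first exact: cst_continuous.
  by apply/funext => u; rewrite big_nil.
rewrite (_ : (fun _ => _) = (fun u => A u i k * B u k j) \+ (fun u => \sum_(k <- s) A u i k * B u k j)).
  apply: continuousD IH.
  by apply: (@continuousM _ _ (fun s => A s i k) (fun s => B s k j)); exact: continuous_entry.
by apply/funext => u; rewrite big_cons.
Qed.

Lemma continuous_trmx (T : topologicalType) p q (A : T -> 'M[R]_(p, q)) t :
  {for t, continuous A} -> {for t, continuous (fun s => (A s)^T)}.
Proof.
move=> cA; apply: continuous_mx => i j.
rewrite (_ : (fun _ => _) = fun s => A s j i); first exact: continuous_entry.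
by apply/funext => s; rewrite mxE.
Qed.

Lemma continuous_dotv (T : topologicalType) m (u v : T -> 'rV[R]_m) t :
  {for t, continuous u} -> {for t, continuous v} ->
  {for t, continuous (fun s => dotv (u s) (v s))}.
Proof.
move=> cu cv; have ct : {for t, continuous (fun s => (v s)^T)} by exact: continuous_trmx.
have cm : {for t, continuous (fun s => u s *m (v s)^T)} by exact: continuous_mulmx cu ct.
exact: continuous_entry cm.
Qed.

Lemma continuous_enorm (T : topologicalType) m (v : T -> 'rV[R]_m) t :
  {for t, continuous v} -> {for t, continuous (fun s => enorm (v s))}.
Proof.
move=> cv; apply: (@continuous_comp _ _ _ (fun s => dotv (v s) (v s)) Num.sqrt).
  by refine (continuous_dotv cv cv).
exact: sqrt_continuous.
Qed.

End matrix_norms.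

Section smooth_maps.
Variables (R : realType) (n m : nat).
Implicit Types (U : set 'rV[R]_n) (f : 'rV[R]_n -> 'rV[R]_m).

Lemma differentiable_C1mx U f : open U -> (forall y, U y -> differentiable f y) ->
  (forall v y, U y -> {for y, continuous ('D_v f)}) -> C1mx U f.
Proof.
move=> oU df cf i j.
apply: (@C1on_intro _ _ _ _ (fun v y => 'D_v f y i j)) => //.
- move=> y Uy; apply: (@differentiable_comp _ _ _ _ f (fun A : 'rV[R]_m => A i j)).
    exact: df.
  exact: differentiable_coord.
- by move=> v y Uy; rewrite derive_mx ?mxE//; apply: diff_derivable; exact: df.
- by move=> v y Uy; apply: continuous_entry; exact: cf.
Qed.

Lemma smooth_on_C2 U f : open U -> smooth_on U f ->
  [/\ forall y, U y -> differentiable f y, C1mx U f & forall v, C1mx U ('D_v f)].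
Proof.
move=> oU sf; have [df H] := sf 2.
split => //.
- apply: differentiable_C1mx => // v y Uy.
  by apply: differentiable_continuous; have [+ _] := H v; apply.
- move=> v; have [d c] := H v.
  by apply: differentiable_C1mx.
Qed.

Definition C1path (gam : R -> 'rV[R]_m) :=
  (forall t, derivable gam t 1) /\ continuous (derive1 gam).

Lemma is_derive1P (W : normedModType R) (gam : R -> W) t : derivable gam t 1 ->
  is_derive t (1 : R) gam (derive1 gam t).
Proof. by move=> d; rewrite derive1E; exact: derivableP. Qed.

Lemma is_derive1_val (W : normedModType R) (gam : R -> W) t dg :
  is_derive t (1 : R) gam dg -> derive1 gam t = dg.
Proof. by move=> d; rewrite derive1E; exact: derive_val. Qed.

Lemma C1path_intro (gam dgam : R -> 'rV[R]_m) :
  (forall t, is_derive t (1 : R) gam (dgam t)) -> continuous dgam -> C1path gam.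
Proof.
move=> H c; split; first by move=> t; have [] := H t.
by have -> : derive1 gam = dgam by apply/funext => t; exact: is_derive1_val.
Qed.

Lemma is_derive_chain (X : 'rV[R]_n -> 'rV[R]_m) (Y : R -> 'rV[R]_n) t dY :
  differentiable X (Y t) -> is_derive t (1 : R) Y dY ->
  is_derive t (1 : R) (fun s => X (Y s)) (dY *m 'J X (Y t)).
Proof.
move=> dX [dYt DY].
have dY' : differentiable Y t by exact/derivable1_diffP.
have dXY : differentiable (X \o Y) t by exact: differentiable_comp.
split; first exact: diff_derivable.
have E1 : 'D_1 (X \o Y) t = 'd (X \o Y) t 1 by exact: deriveE.
have E2 : 'D_1 Y t = 'd Y t 1 by exact: deriveE.
apply: (etrans E1); rewrite diff_comp//= -E2 DY -(deriveE _ dX).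
by rewrite (deriveEjacobian _ dX).
Qed.

End smooth_maps.

(** * Curves on the manifold and paths in its image *)

Section curves_on_manifold.
Variables (R : realType) (n m : nat) (M : oriented_manifold R n) (x : M -> 'rV[R]_m).
Hypothesis ex : embedding x.

Let sx : smooth_map x. Proof. by case: ex. Qed.

Lemma atlas_C2 (c : chart R n M) : atlas c ->
  [/\ forall y, ccod c y -> differentiable (x \o cinv c) y,
   C1mx (ccod c) (x \o cinv c) & forall v, C1mx (ccod c) ('D_v (x \o cinv c))].
Proof. by move=> ac; apply: smooth_on_C2; [exact: ccod_open|exact: sx]. Qed.

Lemma embedding_nbhs (p : M) (A : set M) : nbhs p A ->
  exists2 B, nbhs (x p) B & x @^-1` B `<=` A.
Proof.
rewrite nbhsE /= => -[A' [oA' A'p] A'A].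
have [_ _ _ /(_ A') [+ _]] := ex => /(_ oA')[B oB E].
exists B; first by apply: open_nbhs_nbhs; split => //; move: A'p; rewrite E.
by rewrite -E.
Qed.

Lemma continuous_from_image (T : topologicalType) (g : T -> M) t :
  {for t, continuous (x \o g)} -> {for t, continuous g}.
Proof.
move=> c A /embedding_nbhs[B nB BA].
by have := c _ nB; rewrite /nbhs /=; apply: filterS => s /= Bs; exact: BA.
Qed.

Lemma C1_curve_path (g : R -> M) : C1_curve g -> C1path (x \o g).
Proof.
move=> [cg Hg].
have D t : exists dg, is_derive t (1 : R) (x \o g) (dg t) /\
   (\forall s \near t, is_derive s (1 : R) (x \o g) (dg s)) /\ {for t, continuous dg}.
  pose c := chart_at (g t).
  have ac : atlas c by exact: atlas_chart_at.
  have [dX CX CX2] := atlas_C2 ac.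
  have [dY cY] := Hg c ac.
  have oU : open (g @^-1` cdom c).
    by apply: open_comp; [move=> s _; exact: cg|exact: cdom_open].
  have Ut : (g @^-1` cdom c) t by exact: cdom_chart_at.
  pose Y := cmap c \o g; pose X := x \o cinv c.
  have YU s : (g @^-1` cdom c) s -> ccod c (Y s) by move=> Us; exists (g s).
  pose dg s := 'D_1 Y s *m 'J X (Y s).
  have near_dg s : (g @^-1` cdom c) s -> is_derive s (1 : R) (x \o g) (dg s).
    move=> Us; apply: (@near_eq_is_derive _ _ _ (fun s => X (Y s))).
      apply: filterS (open_near oU Us) => r Ur.
      by rewrite /X /Y /= cmapK.
    apply: is_derive_chain; first by apply: dX; exact: YU.
    by apply: derivableP; apply: diff_derivable; exact: dY.
  exists dg; split; first exact: near_dg.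
  split; first by apply: filterS (open_near oU Ut); exact: near_dg.
  apply: continuous_mulmx; first exact: cY.
  apply: continuous_mx => i j.
  apply: (@continuous_comp _ _ _ Y (fun y => 'J X y i j)).
    exact: (differentiable_continuous (dY t Ut)).
  refine (C1on_continuous (C1mx_jacobian (@ccod_open _ _ _ c) dX CX2 i j) _).
  exact: YU.
split => [t|t]; first by have [dg [[]]] := D t.
have [dg [_ [nd cd]]] := D t.
apply: near_eq_continuous cd; apply: filterS nd => s; exact: is_derive1_val.
Qed.

(** Continuity of [g] comes from the topological embedding. In a chart, the curve [Y] is recovered
    from [X \o Y] by the right inverse of the Jacobian of the immersion [X], with an error that is
    small relative to the increment of [Y] itself and has to be absorbed. *)
Lemma path_C1_curve (g : R -> M) : C1path (x \o g) -> C1_curve g.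
Proof.
move=> [dg cg'].
have cg : continuous g.
  move=> t; apply: continuous_from_image.
  by apply/differentiable_continuous/derivable1_diffP.
split => // c ac.
have [dX CX CX2] := atlas_C2 ac.
have oU : open (g @^-1` cdom c).
  by apply: open_comp; [move=> s _; exact: cg|exact: cdom_open].
pose Y := cmap c \o g; pose X := x \o cinv c.
have YU s : (g @^-1` cdom c) s -> ccod c (Y s) by move=> Us; exists (g s).
have Jf y : ccod c y -> row_free ('J X y).
  move=> [p cp <-]; have [_ + _ _] := ex; exact.
pose Jp y := ('J X y)^T *m invmx ('J X y *m ('J X y)^T).
have JJp y : ccod c y -> 'J X y *m Jp y = 1%:M.
  by move=> cy; rewrite /Jp mulmxA mulmxV// gram_unit// Jf.
have cY s : (g @^-1` cdom c) s -> {for s, continuous Y}.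
  move=> Us; apply: (@continuous_comp _ _ _ g (cmap c)); first exact: cg.
  exact: cmap_continuous.
have D t : (g @^-1` cdom c) t -> is_derive t (1 : R) Y (derive1 (x \o g) t *m Jp (Y t)).
  move=> Ut; have cYt := YU t Ut.
  pose J := 'J X (Y t); pose Q := Jp (Y t).
  pose K := m%:R * `|Q| + 1.
  have K0 : 0 < K by rewrite ltr_wpDl// mulr_ge0.
  have QK (v : 'rV[R]_m) : `|v *m Q| <= K * `|v|.
    apply: (le_trans (mx_norm_mul _ _)).
    by rewrite mulrAC ler_wpM2r// /K lerDl.
  pose L := `|derive1 (x \o g) t| + 1.
  have L0 : 0 < L by rewrite ltr_wpDl.
  have dgt : differentiable (x \o g) t by exact/derivable1_diffP.
  suff H : (fun h : R => h^-1 *: ((Y \o shift t) (h *: 1) - Y t)) @ 0^' -->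
      derive1 (x \o g) t *m Q.
    by split; [apply/cvg_ex; eexists; exact: H|exact: cvg_lim H].
  apply/cvgrPdist_le => e e0.
  (* The first bound makes [K * e1] at most one half, which absorbs the increment of [Y]; the second
     makes the remaining error at most half of [e]. *)
  pose e1 := Num.min (2^-1) (e / (4 * K * L)) / K.
  have e10 : 0 < e1.
    by rewrite divr_gt0// lt_min invr_gt0 ltr0n /= divr_gt0// !mulr_gt0.
  pose e2 := Num.min 1 (e / (2 * K)).
  have e20 : 0 < e2 by rewrite lt_min ltr01 divr_gt0// mulr_gt0.
  have nX := diff_eps (dX _ cYt) e10.
  have ng := diff_eps dgt e20.
  have cYh : (fun h : R => Y (h + t) - Y t) @ (0 : R) --> (0 : 'rV[R]_n).
    have c1 : (Y \o shift t) h @[h --> (0 : R)] --> Y t.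
      by rewrite (@cvg_comp_shift R R _ t 0 Y) add0r; exact: cY.
    apply/cvgrPdist_le => e' e'0; have /cvgrPdist_le/(_ _ e'0) := c1.
    by apply: filterS => h /=; rewrite sub0r opprB.
  have nXY : \forall h \near (0 : R), `|X (Y (h + t)) - X (Y t) - 'd X (Y t) (Y (h + t) - Y t)|
      <= e1 * `|Y (h + t) - Y t|.
    move: (cYh _ nX); rewrite /nbhs /= /nbhs /=; apply: (@filterS _ (nbhs (0 : R))) => h /=.
    by rewrite subrK.
  have nU : \forall h \near (0 : R), (g @^-1` cdom c) (h + t).
    have c2 : (id \o shift t) h @[h --> (0 : R)] --> t.
      by rewrite (@cvg_comp_shift R R _ t 0 id) add0r.
    exact: (c2 _ (open_near oU Ut)).
  have n3 := filterI (filterI nXY ng) nU.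
  near=> h.
  have h0 : h != 0 by near: h; exact: nbhs_dnbhs_neq.
  have [[Ha Hb] Uh] : ((`|X (Y (h + t)) - X (Y t) - 'd X (Y t) (Y (h + t) - Y t)|
      <= e1 * `|Y (h + t) - Y t|) /\
      `|(x \o g) (h + t) - (x \o g) t - 'd (x \o g) t h| <= e2 * `|h|) /\
      (g @^-1` cdom c) (h + t).
    by near: h; apply: nbhs_dnbhs; exact: n3.
  have XY s : (g @^-1` cdom c) s -> X (Y s) = (x \o g) s.
    by move=> Us; rewrite /X /Y /= cmapK.
  have dXE : 'd X (Y t) (Y (h + t) - Y t) = (Y (h + t) - Y t) *m J.
    by rewrite -(deriveE _ (dX _ cYt)) (deriveEjacobian _ (dX _ cYt)).
  have dgE : 'd (x \o g) t h = h *: derive1 (x \o g) t by rewrite (diff1E dgt).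
  rewrite (XY _ Uh) (XY _ Ut) dXE in Ha; rewrite dgE in Hb.
  rewrite /= [h *: 1]mulr1.
  move: Ha Hb.
  move: (Y (h + t) - Y t) ((x \o g) (h + t) - (x \o g) t) => dy dz Ha Hb.
  have JQ : J *m Q = 1%:M by exact: JJp.
  (* [dy] is [dy *m J *m Q]; the first term is the error of the ambient path, the second the
     linearization error of the immersion. *)
  have E : dy - h *: derive1 (x \o g) t *m Q =
     (dz - h *: derive1 (x \o g) t) *m Q - (dz - dy *m J) *m Q.
    rewrite !mulmxBl -(mulmxA dy) JQ mulmx1 opprB [RHS]addrC.
    by rewrite (subrKA (dz *m Q)).
  have hn0 : 0 < `|h| by rewrite normr_gt0.
  have B1 : `|dy - h *: derive1 (x \o g) t *m Q| <= K * (e2 * `|h| + e1 * `|dy|).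
    rewrite E; apply: (le_trans (ler_normB _ _)); rewrite mulrDr.
    apply: lerD; apply: (le_trans (QK _)); by rewrite ler_wpM2l// ltW.
  have B2 : `|h *: derive1 (x \o g) t *m Q| <= K * (`|h| * (L - 1)).
    by apply: (le_trans (QK _)); rewrite normrZ /L addrK.
  have Ke1 : K * e1 = Num.min (2^-1) (e / (4 * K * L)) by rewrite /e1 mulrC divfK ?gt_eqF.
  have Ke1h : K * e1 <= 2^-1 by rewrite Ke1 ge_min lexx.
  have Ke1e : K * e1 <= e / (4 * K * L) by rewrite Ke1 ge_min lexx orbT.
  have e21 : e2 <= 1 by rewrite ge_min lexx.
  have Ke2 : K * e2 <= e / 2.
    rewrite -[leRHS](_ : K * (e / (2 * K)) = _) ?ler_wpM2l ?ge_min ?lexx ?orbT// ?ltW//.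
    by field; rewrite gt_eqF.
  (* An a priori Lipschitz bound for [Y], which turns errors relative to [dy] into errors relative
     to [h]. *)
  have dyB : `|dy| <= 2 * K * L * `|h|.
    have T : `|dy| <= `|dy - h *: derive1 (x \o g) t *m Q| + `|h *: derive1 (x \o g) t *m Q|.
      by rewrite -{1}(subrK (h *: derive1 (x \o g) t *m Q) dy) ler_normD.
    have T2 : `|dy| <= K * (`|h| * L) + K * e1 * `|dy|.
      apply: (le_trans T); apply: (le_trans (lerD B1 B2)).
      have T3 : K * (e2 * `|h|) <= K * (1 * `|h|) by rewrite ler_wpM2l ?ler_wpM2r// ltW.
      by move: T3; rewrite mul1r; clear; move: (`|h|) (`|dy|) => p q; lra.
    have T4 : K * e1 * `|dy| <= 2^-1 * `|dy| by rewrite ler_wpM2r.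
    have -> : 2 * K * L * `|h| = 2 * (K * (`|h| * L)) by ring.
    by lra.
  have B3 : `|dy - h *: derive1 (x \o g) t *m Q| <= e * `|h|.
    apply: (le_trans B1).
    have -> : K * (e2 * `|h| + e1 * `|dy|) = K * e2 * `|h| + K * e1 * `|dy| by ring.
    have -> : e * `|h| = e / 2 * `|h| + e / 2 * `|h| by field.
    apply: lerD; first by rewrite ler_wpM2r.
    apply: (@le_trans _ _ (e / (4 * K * L) * (2 * K * L * `|h|))).
      by apply: ler_pM => //; rewrite mulr_ge0 ?ltW.
    rewrite le_eqVlt; apply/orP; left; apply/eqP; field.
    by rewrite !gt_eqF.
  have -> : derive1 (x \o g) t *m Q - h^-1 *: dy =
     - (h^-1 *: (dy - h *: derive1 (x \o g) t *m Q)).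
    by rewrite scalerBr -scalemxAl scalerA mulVf// scale1r opprB.
  rewrite normrN normrZ normfV mulrC ler_pdivrMr//.
have cJp y : ccod c y -> {for y, continuous Jp}.
  move=> cy; apply: continuous_mx => i j.
  have CJ := C1mx_jacobian (@ccod_open _ _ _ c) dX CX2.
  have CQ := C1mx_mul (@ccod_open _ _ _ c) (C1mx_tr (@ccod_open _ _ _ c) CJ)
    (C1mx_inv (@ccod_open _ _ _ c) (C1mx_mul (@ccod_open _ _ _ c) CJ (C1mx_tr (@ccod_open _ _ _ c) CJ))
       (fun y cy => gram_unit (Jf y cy))).
  exact: (C1on_continuous (CQ i j) cy).
have cont t : (g @^-1` cdom c) t ->
    {for t, continuous (fun t => derive1 (x \o g) t *m Jp (Y t))}.
  move=> Ut; apply: continuous_mulmx; first exact: cg'.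
  by apply: (@continuous_comp _ _ _ Y Jp); [exact: cY|apply: cJp; exact: YU].
split => [t Ut|v t Ut /=].
  by apply/derivable1_diffP; have [] := D t Ut.
apply: (@near_eq_continuous _ _ _ _ (fun t => v *: (derive1 (x \o g) t *m Jp (Y t)))).
  apply: filterS (open_near oU Ut) => s Us.
  have dYs : differentiable Y s by apply/derivable1_diffP; have [] := D s Us.
  have -> : 'D_v (cmap c \o g) s = 'd Y s v by exact: deriveE.
  by rewrite (diff1E dYs) (is_derive1_val (D s Us)).
apply: (@continuousZ _ _ _ (cst v) (fun t => derive1 (x \o g) t *m Jp (Y t))).
  exact: cst_continuous.
exact: cont.
Unshelve. all: by end_near. Qed.

End curves_on_manifold.

(** * Lengths of paths in the ambient space *)

Section path_length.
Variables (R : realType) (m : nat).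
Implicit Types (gam : R -> 'rV[R]_m) (S : set 'rV[R]_m).

Definition path_length gam : \bar R :=
  (\int[lebesgue_measure]_(t in `[0%R, 1%R]) (enorm (derive1 gam t))%:E)%E.

(** The interval is larger than the unit interval, so that arc length has two-sided derivatives at
    both ends. *)
Lemma primitive_exists (f : R -> R) : continuous f ->
  exists F : R -> R, forall t : R, -1 < t < 2 -> is_derive t (1 : R) F (f t).
Proof.
move=> cf.
have fi : lebesgue_measure.-integrable `[-1, 2] (EFin \o f).
  apply: continuous_compact_integrable; first exact: segment_compact.
  by apply: continuous_subspaceT => t; exact: cf.
exists (fun t => \int[lebesgue_measure]_(s in [set` `[-1, t]]) f s)%R.
move=> t /andP[t1 t2].
have [d E] := continuous_FTC1_closed t2 fi t1 (cf t).
by rewrite -E; exact: is_derive1P.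
Qed.

Lemma path_length_primitive gam (F : R -> R) : C1path gam ->
  (forall t : R, -1 < t < 2 -> is_derive t (1 : R) F (enorm (derive1 gam t))) ->
  path_length gam = (F 1 - F 0)%:E.
Proof.
move=> [dg cg] dF; rewrite /path_length (@continuous_FTC2 _ _ F)//.
- apply: continuous_subspaceT => t; apply: continuous_enorm; exact: cg.
- have I (t : R) : 0 <= t <= 1 -> -1 < t < 2 by move=> /andP[? ?]; apply/andP; split; lra.
  split => //.
  + move=> t; rewrite in_itv /= => /andP[t0 t1].
    by have [] := dF t (I t ltac:(by apply/andP; split; lra)).
  + apply: cvg_at_right_filter.
    exact: (is_derive_continuous (dF 0 (I 0 ltac:(by apply/andP; split; lra)))).
  + apply: cvg_at_left_filter.
    exact: (is_derive_continuous (dF 1 (I 1 ltac:(by apply/andP; split; lra)))).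
- move=> t; rewrite in_itv /= => /andP[t0 t1].
  by apply: is_derive1_val; apply: dF; apply/andP; split; lra.
Qed.

Lemma continuous_speed gam : C1path gam -> continuous (fun t => enorm (derive1 gam t)).
Proof. by move=> [_ cg] t; apply: continuous_enorm; exact: cg. Qed.

Lemma is_derive_reparam gam (s : R -> R) t ds : derivable gam (s t) 1 ->
  is_derive t (1 : R) s ds ->
  is_derive t (1 : R) (fun t => gam (s t)) (ds *: derive1 gam (s t)).
Proof.
move=> dg [dst Ds].
have ds' : differentiable s t by exact/derivable1_diffP.
have dg' : differentiable gam (s t) by exact/derivable1_diffP.
have dgs : differentiable (gam \o s) t by exact: differentiable_comp.
split; first exact: diff_derivable.
have E1 : 'D_1 (gam \o s) t = 'd (gam \o s) t 1 by exact: deriveE.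
have E2 : 'D_1 s t = 'd s t 1 by exact: deriveE.
by apply: (etrans E1); rewrite diff_comp//= -E2 Ds (diff1E dg').
Qed.

Lemma C1path_reparam gam (s ds : R -> R) : C1path gam ->
  (forall t : R, is_derive t (1 : R) s (ds t)) -> continuous ds ->
  C1path (fun t => gam (s t)) /\
  forall t, derive1 (fun t => gam (s t)) t = ds t *: derive1 gam (s t).
Proof.
move=> [dg cg] Ds cds.
have D t := is_derive_reparam (dg (s t)) (Ds t).
split; last by move=> t; exact: is_derive1_val.
apply: (C1path_intro D) => t.
apply: (@continuousZ _ _ _ ds (fun t => derive1 gam (s t))); first exact: cds.
apply: (@continuous_comp _ _ _ s (derive1 gam)); last exact: cg.
exact: is_derive_continuous (Ds t).
Qed.

(** The relation that the distance inside [S] is smaller than [a]. Being strict, it is witnessed by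
    a path. *)
Definition path_dist_lt S (p q : 'rV[R]_m) (a : R) := exists gam,
  [/\ C1path gam, forall t, S (gam t), gam 0 = p, gam 1 = q & (path_length gam < a%:E)%E].

Lemma C1path_primitive gam : C1path gam -> exists F : R -> R,
  (forall t : R, -1 < t < 2 -> is_derive t (1 : R) F (enorm (derive1 gam t))) /\
  path_length gam = (F 1 - F 0)%:E.
Proof.
move=> Cg; have [F dF] := primitive_exists (continuous_speed Cg).
by exists F; split => //; exact: path_length_primitive.
Qed.

Lemma is_derive_affine (a b t : R) : is_derive t (1 : R) (fun t => a + b * t) b.
Proof.
have := @is_deriveD _ _ _ (cst a : R -> R) (fun t : R => b * t) t 1 0 b (is_derive_cst _ _ _).
rewrite add0r; apply.
have := @is_deriveZ _ _ _ (id : R -> R) b t 1 1 (is_derive_id _ _).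
by rewrite [b *: 1]mulr1.
Qed.

(** Used to reverse a path and to cut it in two; the sign of [b] accounts for the orientation. *)
Lemma path_length_affine gam (F : R -> R) (a b : R) : C1path gam ->
  (forall t : R, -1 < t < 2 -> is_derive t (1 : R) F (enorm (derive1 gam t))) ->
  (forall t : R, -1 < t < 2 -> -1 < a + b * t < 2) -> b != 0 ->
  C1path (fun t => gam (a + b * t)) /\
  path_length (fun t => gam (a + b * t)) = (Num.sg b * (F (a + b) - F a))%:E.
Proof.
move=> Cg dF I b0.
have [C D] := @C1path_reparam gam (fun t => a + b * t) (fun=> b) Cg (is_derive_affine a b)
  (fun t => cst_continuous (x := b) (x0 := t)).
split => //.
suff L : forall t : R, -1 < t < 2 -> is_derive t (1 : R) (fun t => Num.sg b * F (a + b * t))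
    (enorm (derive1 (fun t => gam (a + b * t)) t)).
  by rewrite (path_length_primitive C L) !mulr1 !mulr0 !addr0 mulrBr.
move=> t It; rewrite D enormZ.
have dc := @is_derive1_comp _ F (fun t => a + b * t) t _ _ (dF _ (I t It)) (is_derive_affine a b t).
have := @is_deriveZ _ _ _ (F \o (fun t => a + b * t)) (Num.sg b) t 1 _ dc.
have -> : Num.sg b *: (enorm (derive1 gam (a + b * t)) * b) =
    `|b| * enorm (derive1 gam (a + b * t)).
  by rewrite /GRing.scale /= mulrCA -normrEsg mulrC.
exact.
Qed.

Lemma path_dist_sym S p q a : path_dist_lt S p q a -> path_dist_lt S q p a.
Proof.
move=> [gam [Cg Sg g0 g1 lg]]; have [F [dF EF]] := C1path_primitive Cg.
have [||C E] := @path_length_affine gam F 1 (-1) Cg dF.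
- by move=> t /andP[? ?]; apply/andP; split; lra.
- by rewrite oppr_eq0 oner_eq0.
exists (fun t => gam (1 + (-1) * t)); split; [exact: C|by move=> t; exact: Sg| | |].
- by rewrite mulr0 addr0; exact: g1.
- by rewrite mulr1 subrr; exact: g0.
- by rewrite E subrr sgrN sgr1 mulN1r opprB -EF; exact: lg.
Qed.

Lemma path_dist_refl S p a : S p -> 0 < a -> path_dist_lt S p p a.
Proof.
move=> Sp a0; exists (fun=> p).
have D (t : R) : is_derive t (1 : R) (fun _ : R => p) 0 by exact: is_derive_cst.
split; [ | by move=> t | by [] | by [] | ].
  apply: (C1path_intro D) => t; exact: cst_continuous.
rewrite /path_length (_ : \int[_]_(_ in _) _ = 0)%E ?lte_fin//.
apply: integral0_eq => t _.
by rewrite (is_derive1_val (D t)) /enorm /dotv mul0mx mxE sqrtr0.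
Qed.

(** Each path is slowed down by [smoothstep] so as to stop at the junction: the first one runs
    during the first half of the unit interval, the second one during the second half. *)
Lemma path_dist_trans S p q r a b : path_dist_lt S p q a -> path_dist_lt S q r b ->
  path_dist_lt S p r (a + b).
Proof.
move=> [g1 [C1 S1 g10 g11 l1]] [g2 [C2 S2 g20 g21 l2]].
have [F1 [dF1 E1]] := C1path_primitive C1; have [F2 [dF2 E2]] := C1path_primitive C2.
pose s1 (t : R) := smoothstep (0 + 2 * t); pose s2 (t : R) := smoothstep (-1 + 2 * t).
have Ds (c t : R) : is_derive t (1 : R) (fun t => smoothstep (c + 2 * t)) (dsmoothstep (c + 2 * t) * 2).
  exact: (@is_derive1_comp _ (@smoothstep R) (fun t => c + 2 * t) t _ _ (is_derive_smoothstep _) (is_derive_affine c 2 t)).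
have cds (c : R) : continuous (fun t : R => dsmoothstep (c + 2 * t) * 2).
  move=> t; apply: (@continuousM _ _ (fun t : R => dsmoothstep (c + 2 * t)) (fun _ : R => 2 : R)); last exact: cst_continuous.
  apply: (@continuous_comp _ _ _ (fun t : R => c + 2 * t) (@dsmoothstep R)); last exact: continuous_dsmoothstep.
  exact: is_derive_continuous (is_derive_affine c 2 t).
have [D1 E1'] := C1path_reparam C1 (Ds 0) (cds 0).
have [D2 E2'] := C1path_reparam C2 (Ds (-1)) (cds (-1)).
(* At every time one of the two terms is at rest at [q]; this formula without cases makes the
   concatenation C1 at once. *)
pose gam t := g1 (s1 t) + g2 (s2 t) - q.
have gE t : gam t = if t <= 2^-1 then g1 (s1 t) else g2 (s2 t).
  rewrite /gam; case: ifPn => [tl|]; last rewrite -ltNge => tl.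
    by rewrite /s2 smoothstep_le0 ?g20 ?addrK//; lra.
  by rewrite /s1 smoothstep_ge1 ?g11 1?addrC ?addKr//; lra.
have dgam t : is_derive t (1 : R) gam (derive1 (fun t => g1 (s1 t)) t + derive1 (fun t => g2 (s2 t)) t).
  have d1 := is_derive1P (D1.1 t); have d2 := is_derive1P (D2.1 t).
  have := is_deriveB (is_deriveD d1 d2) (is_derive_cst q t 1).
  by rewrite subr0.
have Cgam : C1path gam.
  apply: (C1path_intro dgam) => t.
  apply: (@continuousD _ _ _ (derive1 (fun t => g1 (s1 t))) (derive1 (fun t => g2 (s2 t)))).
    exact: D1.2.
  exact: D2.2.
have s01 (c t : R) : -1 < smoothstep (c + 2 * t) < 2.
  by have := smoothstep_ge0 (c + 2 * t); have := smoothstep_le1 (c + 2 * t) => ? ?; apply/andP; split; lra.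
exists gam; split; [exact: Cgam | | | | ].
- by move=> t; rewrite gE; case: ifP => _; [exact: S1|exact: S2].
- by rewrite gE ifT ?invr_ge0// /s1 mulr0 addr0 smoothstep_le0.
- rewrite gE ifF; last by apply/negbTE; rewrite -ltNge; lra.
  by rewrite /s2 smoothstep_ge1 ?g21//; lra.
suff L : forall t : R, -1 < t < 2 -> is_derive t (1 : R) (fun t => F1 (s1 t) + F2 (s2 t))
    (enorm (derive1 gam t)).
  rewrite (path_length_primitive Cgam L) /s1 /s2 !mulr0 !mulr1 !addr0 !add0r.
  rewrite (@smoothstep_ge1 _ 2) ?ler1n// (@smoothstep_ge1 _ (-1 + 2)); last by lra.
  rewrite (@smoothstep_le0 _ 0)// (@smoothstep_le0 _ (-1)); last by lra.
  by move: l1 l2; rewrite E1 E2 !lte_fin => l1 l2; lra.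
move=> t _.
have e1 := @is_derive1_comp _ F1 s1 t _ _ (dF1 _ (s01 0 t)) (Ds 0 t).
have e2 := @is_derive1_comp _ F2 s2 t _ _ (dF2 _ (s01 (-1) t)) (Ds (-1) t).
apply: (is_derive_eq (is_deriveD e1 e2)).
rewrite (is_derive1_val (dgam t)) E1' E2' -/(s1 t) -/(s2 t).
move: (derive1 g1 _) (derive1 g2 _) => v1 v2.
have p0 (c : R) : 0 <= dsmoothstep c * 2 by rewrite mulr_ge0 ?dsmoothstep_ge0.
(* One of the two speeds vanishes, so the norm of the sum is the sum of the norms. *)
have [tl|tl] := leP t 2^-1.
  have z : dsmoothstep (-1 + 2 * t) = 0.
    rewrite /dsmoothstep /pos_sqr max_l; last by lra.
    by rewrite mulr0 mul0r expr0n mul0r addr0 mul0r.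
  by rewrite z mul0r scale0r mulr0 !addr0 enormZ (ger0_norm (p0 _)) mulrC.
have z : dsmoothstep (0 + 2 * t) = 0.
  rewrite /dsmoothstep /pos_sqr (@max_l _ _ _ (1 - _)); last by lra.
  by rewrite mulr0 expr0n mulr0 mulr0 addr0 mul0r.
by rewrite z mul0r scale0r mulr0 !add0r enormZ (ger0_norm (p0 _)) mulrC.
Qed.

(** Arc length minus or plus a coordinate is nondecreasing along the path, because each coordinate
    of the velocity is bounded by the speed. *)
Lemma path_dist_chord S p q a : path_dist_lt S p q a -> `|q - p| <= a.
Proof.
move=> [gam [Cg _ <- <- lg]]; have [F [dF EF]] := C1path_primitive Cg.
move: lg; rewrite EF lte_fin => lF.
have cF (t : R) : 0 <= t <= 1 -> is_derive t (1 : R) F (enorm (derive1 gam t)).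
  by move=> /andP[? ?]; apply: dF; apply/andP; split; lra.
have F01 : F 0 <= F 1.
  have [t||c c01 E] := @MVT_segment R F (fun t => enorm (derive1 gam t)) 0 1 ler01.
  - by rewrite in_itv /= => /andP[? ?]; apply: cF; rewrite !ltW.
  - apply: derivable_within_continuous => t; rewrite in_itv /= => t01.
    by have [] := cF t t01.
  by rewrite -subr_ge0 E mulr_ge0 ?enorm_ge0 ?subr_ge0.
apply: mx_norm_le => [|i j]; first by move: lF F01; lra.
rewrite (ord1 i) !mxE.
have dj t : is_derive t (1 : R) (fun t => gam t 0 j) (derive1 gam t 0 j).
  have dgt := Cg.1 t; rewrite derive1E derive_mx// mxE.
  exact: derivableP ((derivable_mxP _ _ _).1 dgt 0 j).
have B (e : R) : `|e| = 1 -> e * (gam 1 0 j - gam 0 0 j) <= F 1 - F 0.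
  move=> e1.
  pose G t := F t - e * gam t 0 j.
  have dG (t : R) : 0 <= t <= 1 -> is_derive t (1 : R) G (enorm (derive1 gam t) - e * derive1 gam t 0 j).
    move=> t01; have := is_deriveZ e (dj t); exact: (is_deriveB (cF t t01)).
  have [t||c c01] := @MVT_segment R G (fun t => enorm (derive1 gam t) - e * derive1 gam t 0 j) 0 1 ler01.
  - by rewrite in_itv /= => /andP[? ?]; apply: dG; rewrite !ltW.
  - apply: derivable_within_continuous => t; rewrite in_itv /= => t01.
    by have [] := dG t t01.
  rewrite subr0 mulr1 /G => E.
  have : 0 <= enorm (derive1 gam c) - e * derive1 gam c 0 j.
    rewrite subr_ge0; apply: (le_trans (ler_norm _)); rewrite normrM e1 mul1r.
    exact: entry_le_enorm.
  by rewrite -E mulrBr; lra.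
rewrite ler_norml; apply/andP; split; last first.
  by apply: (le_trans _ (ltW lF)); have := B 1 (normr1 _); rewrite mul1r.
by have := B (-1) (normrN1 _); rewrite mulN1r; lra.
Qed.

(** A nearly shortest path is cut at an intermediate arc length, given by the intermediate value
    theorem; no minimizing path is needed. *)
Lemma path_dist_mid S p q a b : 0 < a -> 0 < b -> path_dist_lt S p q (a + b) ->
  exists2 z, path_dist_lt S p z a & path_dist_lt S z q b.
Proof.
move=> a0 b0 [gam [Cg Sg g0 g1 lg]]; have [F [dF EF]] := C1path_primitive Cg.
move: lg; rewrite EF lte_fin => lF.
have I (t : R) : 0 <= t <= 1 -> -1 < t < 2 by move=> /andP[? ?]; apply/andP; split; lra.
have cF (t : R) : 0 <= t <= 1 -> is_derive t (1 : R) F (enorm (derive1 gam t)).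
  by move=> t01; apply: dF; exact: I.
have cFw : {within `[0, 1], continuous F}.
  apply: derivable_within_continuous => t; rewrite in_itv /= => t01.
  by have [] := cF t t01.
have [l0|l0] := leP (F 1 - F 0) 0.
  exists q; last by apply: path_dist_refl; [rewrite -g1; exact: Sg|exact: b0].
  exists gam; split; [exact: Cg|exact: Sg|exact: g0|exact: g1|].
  by rewrite EF lte_fin; lra.
(* The midpoint of the interval of arc lengths [s] for which both pieces are nontrivial, the first
   shorter than [a] and the second shorter than [b]. *)
pose s := (Num.max 0 (F 1 - F 0 - b) + Num.min a (F 1 - F 0)) / 2.
have [s0 s1 sa sb] : [/\ 0 < s, s < F 1 - F 0, s < a & F 1 - F 0 - s < b].
  rewrite /s; move: (F 1 - F 0) l0 lF => l l0 lF.
  have [?|?] := leP 0 (l - b); have [?|?] := leP a l; split; lra.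
have Iv : Num.min (F 0) (F 1) <= F 0 + s <= Num.max (F 0) (F 1).
  by rewrite ge_min le_max; apply/andP; split; apply/orP; [left|right]; lra.
have [t] := @IVT R F 0 1 (F 0 + s) ler01 cFw Iv.
rewrite in_itv /= => t01 Ft.
have /andP[t0 t1] := t01.
have t0' : 0 < t.
  by rewrite lt_neqAle t0 andbT; apply/eqP => tE; move: Ft; rewrite -tE; lra.
have t1' : t < 1.
  by rewrite lt_neqAle t1 andbT; apply/eqP => tE; move: Ft; rewrite tE; lra.
exists (gam t).
  have [||C E] := @path_length_affine gam F 0 t Cg dF.
  - by move=> u /andP[? ?]; apply/andP; split; nra.
  - by rewrite gt_eqF.
  exists (fun u => gam (0 + t * u)); split; [exact: C|by move=> u; exact: Sg| | |].
  - by rewrite mulr0 addr0; exact: g0.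
  - by rewrite mulr1 add0r.
  - by rewrite E gtr0_sg// mul1r add0r lte_fin Ft; lra.
have [||C E] := @path_length_affine gam F t (1 - t) Cg dF.
- by move=> u /andP[? ?]; apply/andP; split; nra.
- by rewrite gt_eqF// subr_gt0.
exists (fun u => gam (t + (1 - t) * u)); split; [exact: C|by move=> u; exact: Sg| | |].
- by rewrite mulr0 addr0.
- by rewrite mulr1 addrC subrK; exact: g1.
- by rewrite E gtr0_sg ?subr_gt0// mul1r [t + _]addrC subrK lte_fin Ft; lra.
Qed.

End path_length.

(** * The induced distance and the Hopf-Rinow theorem *)

Section distance.
Variables (R : realType) (n m : nat) (M : oriented_manifold R n) (x : M -> 'rV[R]_m).
Hypothesis ex : embedding x.

Lemma riemannian_dist_ltP p q a :
  (riemannian_dist x p q < a%:E)%E <-> path_dist_lt (range x) (x p) (x q) a.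
Proof.
split.
  move=> /ereal_inf_lt[_ [g [Cg g0 g1] <-] lg].
  exists (x \o g); split; [exact: (C1_curve_path ex Cg)| |by rewrite /= g0|by rewrite /= g1|exact: lg].
  by move=> t; exists (g t).
move=> [gam [Cgam Sg g0 g1 lg]].
have [_ _ ix _] := ex.
have /choice[g gE] : forall t, exists p, x p = gam t.
  by move=> t; have [q' _ <-] := Sg t; exists q'.
have xg : x \o g = gam by apply/funext => t; rewrite /= gE.
apply: le_lt_trans lg; apply: ereal_inf_lbound; exists g; last first.
  by rewrite /curve_length xg.
split; first by apply: (path_C1_curve ex); rewrite xg.
  by apply: ix; rewrite gE.
by apply: ix; rewrite gE.
Qed.

Definition dlt (p q : M) (a : R) := path_dist_lt (range x) (x p) (x q) a.

Lemma dlt_sym p q a : dlt p q a -> dlt q p a. Proof. exact: path_dist_sym. Qed.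
Lemma dlt_refl p a : 0 < a -> dlt p p a.
Proof. by move=> a0; apply: path_dist_refl => //; exists p. Qed.
Lemma dlt_trans p q r a b : dlt p q a -> dlt q r b -> dlt p r (a + b).
Proof. exact: path_dist_trans. Qed.
Lemma dlt_mid p q a b : 0 < a -> 0 < b -> dlt p q (a + b) ->
  exists2 z, dlt p z a & dlt z q b.
Proof.
move=> a0 b0 /(path_dist_mid a0 b0)[y H1 H2].
have [gam [_ Sg _ g1 _]] := H1; have [z _ zE] := Sg 1; rewrite g1 in zE.
by exists z; rewrite /dlt zE.
Qed.
Lemma dlt_le p q a b : a <= b -> dlt p q a -> dlt p q b.
Proof.
move=> ab [gam [C S g0 g1 l]]; exists gam; split; [exact: C|exact: S|exact: g0|exact: g1|].
by apply: (lt_le_trans l); rewrite lee_fin.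
Qed.
Lemma dlt_chord p q a : dlt p q a -> `|x q - x p| <= a.
Proof. exact: path_dist_chord. Qed.

(** The segment is travelled with [smoothstep], so that the path, which is defined on the whole
    line, never leaves it. *)
Lemma dlt_segment (c : chart R n M) (y y' : 'rV[R]_n) (Lam a : R) : atlas c ->
  (forall s : R, 0 <= s <= 1 -> ccod c (s *: (y' - y) + y) /\
     enorm ((y' - y) *m 'J (x \o cinv c) (s *: (y' - y) + y)) <= Lam) ->
  Lam < a -> dlt (cinv c y) (cinv c y') a.
Proof.
move=> ac H La; have [dX CX CX2] := atlas_C2 ex ac.
set X := x \o cinv c in dX CX CX2 H.
pose Y t := smoothstep t *: (y' - y) + y.
pose gam t := X (Y t).
have s01 (t : R) : 0 <= smoothstep t <= 1 by rewrite smoothstep_ge0 smoothstep_le1.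
have YU t : ccod c (Y t) by exact: (H _ (s01 t)).1.
have dY t : is_derive t (1 : R) Y (dsmoothstep t *: (y' - y)).
  have D1 := is_derive_smoothstep t.
  have d1 : differentiable (@smoothstep R) t by apply/derivable1_diffP; have [] := D1.
  have d2 : differentiable (fun t : R => smoothstep t *: (y' - y)) t by exact: differentiableZl.
  have D2 : is_derive t (1 : R) (fun t : R => smoothstep t *: (y' - y)) (dsmoothstep t *: (y' - y)).
    split; first exact: diff_derivable.
    have -> : 'D_1 (fun t : R => smoothstep t *: (y' - y)) t =
        'd (fun t : R => smoothstep t *: (y' - y)) t 1 by exact: deriveE.
    have E2 : 'D_1 (@smoothstep R) t = 'd (@smoothstep R) t 1 by exact: deriveE.
    by rewrite diffZl// -E2; have [_ ->] := D1.
  have := is_deriveD D2 (is_derive_cst y t 1).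
  by rewrite addr0.
have dgam t : is_derive t (1 : R) gam (dsmoothstep t *: (y' - y) *m 'J X (Y t)).
  by apply: is_derive_chain (dY t); exact: dX.
have Cgam : C1path gam.
  apply: (C1path_intro dgam) => t.
  apply: (@continuous_mulmx _ _ _ _ _ (fun t => dsmoothstep t *: (y' - y)) (fun t => 'J X (Y t)) t).
    apply: (@continuousZ _ _ _ (@dsmoothstep R) (cst (y' - y))); last exact: cst_continuous.
    exact: continuous_dsmoothstep.
  apply: continuous_mx => i j.
  apply: (@continuous_comp _ _ _ Y (fun y => 'J X y i j)).
    exact: is_derive_continuous (dY t).
  refine (C1on_continuous (C1mx_jacobian (@ccod_open _ _ _ c) dX CX2 i j) _).
  exact: YU.
exists gam; split; [exact: Cgam| | | |].
- by move=> t; exists (cinv c (Y t)).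
- by rewrite /gam /Y smoothstep_le0// scale0r add0r.
- by rewrite /gam /Y smoothstep_ge1// scale1r subrK.
have [F [dF ->]] := C1path_primitive Cgam.
rewrite lte_fin; apply: le_lt_trans La.
have dG (t : R) : 0 <= t <= 1 ->
    is_derive t (1 : R) (fun t => Lam * smoothstep t - F t)
     (Lam * dsmoothstep t - enorm (derive1 gam t)).
  move=> /andP[t0 t1]; have dFt := dF t ltac:(by apply/andP; split; lra).
  have := is_deriveZ Lam (is_derive_smoothstep t) => dL.
  exact: (is_deriveB dL dFt).
have [t||t t01] := @MVT_segment R (fun t => Lam * smoothstep t - F t)
   (fun t => Lam * dsmoothstep t - enorm (derive1 gam t)) 0 1 ler01.
- by rewrite in_itv /= => /andP[? ?]; apply: dG; rewrite !ltW.
- apply: derivable_within_continuous => t; rewrite in_itv /= => t01.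
  by have [] := dG t t01.
rewrite smoothstep_ge1// smoothstep_le0// subr0 !mulr1 mulr0 => E.
have : 0 <= Lam * dsmoothstep t - enorm (derive1 gam t).
  rewrite (is_derive1_val (dgam t)) -scalemxAl enormZ (ger0_norm (dsmoothstep_ge0 _)).
  rewrite mulrC -mulrBr mulr_ge0 ?dsmoothstep_ge0// subr_ge0.
  exact: (H _ (s01 t)).2.
by rewrite -E; lra.
Qed.

Lemma compact_chart_nbhs (p : M) : exists2 K, compact K & nbhs p K.
Proof.
pose c := chart_at p; have cp : cdom c p by exact: cdom_chart_at.
have [d /= d0 dU] : exists2 d : R, 0 < d & ball (cmap c p) d `<=` ccod c.
  have /nbhs_ballP[d d0 H] := open_nbhs_nbhs (conj (@ccod_open _ _ _ c) (ex_intro2 _ _ p cp erefl : ccod c (cmap c p))).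
  by exists d.
have d2 : 0 < d / 2 by rewrite divr_gt0.
have BU : closed_ball (cmap c p) (d / 2) `<=` ccod c.
  move=> y; rewrite closed_ballE// /closed_ball_ /= => H; apply: dU.
  by rewrite -ball_normE /ball_ /=; apply: (le_lt_trans H); rewrite ltr_pdivrMr//; lra.
exists (cinv c @` closed_ball (cmap c p) (d / 2)).
  apply: continuous_compact.
    apply: continuous_in_subspaceT => y; rewrite inE => /BU; exact: cinv_continuous.
  apply: bounded_closed_compact; last exact: closed_ball_closed.
  exists (`|cmap c p| + d); split; first exact: num_real.
  move=> r rd y; rewrite closed_ballE// /closed_ball_ /= => H.
  apply: le_trans (ltW rd); rewrite -lerBlDl.
  apply: (le_trans (lerB_dist _ _)); rewrite distrC; apply: (le_trans H).
  by rewrite ler_pdivrMr//; lra.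
have nb : nbhs (cmap c p) (closed_ball (cmap c p) (d / 2)).
  by apply: filterS (nbhsx_ballx (cmap c p) (d / 2) d2) => y; exact: subset_closed_ball.
have n2 : nbhs p (cdom c) by apply: open_nbhs_nbhs; split => //; exact: cdom_open.
have n3 : nbhs p ((cmap c @^-1` closed_ball (cmap c p) (d / 2)) `&` cdom c).
  by apply: filterI n2; apply: (cmap_continuous cp); exact: nb.
apply: filterS n3.
by move=> q [Hq cq]; exists (cmap c q) => //; rewrite cmapK.
Qed.

Definition precompact_set (A : set M) := exists2 K, compact K & A `<=` K.
Definition dball (p : M) (r : R) := [set q | dlt p q r].

Lemma precompact_dball_small p : exists2 r : R, 0 < r & precompact_set (dball p r).
Proof.
have [K cK nK] := compact_chart_nbhs p.
have [B nB BK] := embedding_nbhs ex nK.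
have /nbhs_ballP[d /= d0 dB] := nB.
exists (d / 2); first by rewrite divr_gt0.
exists K => // q /dlt_chord H; apply: BK; apply: dB.
rewrite -ball_normE /ball_ /= distrC; apply: (le_lt_trans H).
by rewrite ltr_pdivrMr//; lra.
Qed.

Lemma nbhs_dball p e : 0 < e -> nbhs p (dball p e).
Proof.
move=> e0; pose c := chart_at p; have ac : atlas c by exact: atlas_chart_at.
have cp : cdom c p by exact: cdom_chart_at.
have [dX CX CX2] := atlas_C2 ex ac.
have oC : open (ccod c) by exact: ccod_open.
have cy : ccod c (cmap c p) by exists p.
set X := x \o cinv c in dX CX CX2.
have cJ : {for cmap c p, continuous (jacobian X)}.
  apply: continuous_mx => i j; refine (C1on_continuous (C1mx_jacobian oC dX CX2 i j) _).
  exact: cy.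
(* Near [p] lengths are at most [K] times chart lengths: the Jacobian has grown by at most 1, and
   [m] and [n] come from comparing norms. The last 1 makes [K] positive. *)
pose K := m%:R * (n%:R * (`|'J X (cmap c p)| + 1)) + 1.
have K0 : 0 < K by rewrite ltr_wpDl// !mulr_ge0// addr_ge0.
have /cvgrPdist_lt/(_ _ ltr01) nJ := cJ.
have N : nbhs (cmap c p) ([set z | `|'J X (cmap c p) - 'J X z| < 1] `&` ccod c).
  by apply: filterI; [exact: nJ|exact: open_near oC cy].
have [d /= d0 dU] := (nbhs_ballP _ _).1 N.
pose r := Num.min d (e / (2 * K)).
have r0 : 0 < r by rewrite lt_min d0 divr_gt0// mulr_gt0.
have nb : nbhs (cmap c p) (ball (cmap c p) r) by exact: nbhsx_ballx.
have n2 : nbhs p (cdom c) by apply: open_nbhs_nbhs; split => //; exact: cdom_open.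
have n3 : nbhs p ((cmap c @^-1` ball (cmap c p) r) `&` cdom c).
  by apply: filterI n2; apply: (cmap_continuous cp); exact: nb.
apply: filterS n3.
move=> q [Hq cq]; rewrite /dball /= -(cmapK cp) -(cmapK cq).
rewrite -ball_normE /ball_ /= in Hq.
apply: (@dlt_segment c _ _ (K * r)) => //; last first.
  apply: (@le_lt_trans _ _ (K * (e / (2 * K)))).
    by rewrite ler_wpM2l ?ge_min ?lexx ?orbT// ltW.
  have -> : K * (e / (2 * K)) = e / 2 by field; rewrite gt_eqF.
  by rewrite ltr_pdivrMr//; lra.
move=> s /andP[s0 s1].
have [Js Us] : (`|'J X (cmap c p) - 'J X (s *: (cmap c q - cmap c p) + cmap c p)| < 1)
   /\ ccod c (s *: (cmap c q - cmap c p) + cmap c p).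
  apply: dU; rewrite -ball_normE /ball_ /= opprD addrCA subrr addr0 normrN normrZ ger0_norm//.
  apply: (@le_lt_trans _ _ (1 * `|cmap c q - cmap c p|)); first by rewrite ler_wpM2r.
  by rewrite mul1r distrC (lt_le_trans Hq)// ge_min lexx.
split => //.
apply: (le_trans (enorm_le_mx_norm _)).
apply: (@le_trans _ _ (m%:R * (n%:R * r * (`|'J X (cmap c p)| + 1)))).
  rewrite ler_wpM2l//; apply: (le_trans (mx_norm_mul _ _)).
  apply: ler_pM; [by rewrite mulr_ge0|exact: normr_ge0| |].
    by rewrite ler_wpM2l// distrC ltW.
  rewrite -lerBlDl; apply: (le_trans (lerB_dist _ _)); rewrite distrC; exact: ltW.
rewrite /K; move: (`|'J X _|) => u.
have -> : (m%:R * (n%:R * (u + 1)) + 1) * r = m%:R * (n%:R * r * (u + 1)) + r by ring.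
by rewrite lerDl ltW.
Qed.

Lemma precompact_bigcup (s : seq M) (B : M -> set M) :
  (forall f, f \in s -> precompact_set (B f)) ->
  precompact_set [set q | exists2 f, f \in s & B f q].
Proof.
elim: s => [|a s IH] H.
  by exists set0; [exact: compact0|move=> q []].
have [K cK BK] := H a (mem_head _ _).
have [|K' cK' BK'] := IH; first by move=> f fs; apply: H; rewrite inE fs orbT.
exists (K `|` K'); first exact: compactU.
move=> q [f]; rewrite inE => /orP[/eqP ->|fs] Bq; first by left; exact: BK.
by right; apply: BK'; exists f.
Qed.

(** If all balls of radius [eta] centred in the ball of radius [r] were precompact, a precompact
    ball of radius just below the critical one could be enlarged, by finitely many of them, past the
    critical radius. *)
Lemma dball_step z r eta : 0 < r -> 0 < eta -> ~ precompact_set (dball z r) ->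
  exists z', dlt z z' r /\ ~ precompact_set (dball z' eta).
Proof.
move=> r0 eta0 bad.
pose A := [set s : R | 0 < s /\ ~ precompact_set (dball z s)].
have Ar : A r by split.
have lbA : has_lbound A by exists 0 => s [/ltW].
have hiA : has_inf A by split => //; exists r.
have eta4 : 0 < eta / 4 by rewrite divr_gt0.
have [s0 [s00 bad0] s0lt] := inf_adherent eta4 hiA.
have mono a b : a <= b -> ~ precompact_set (dball z a) -> ~ precompact_set (dball z b).
  by move=> ab ba [K cK HK]; apply: ba; exists K => // q /(dlt_le ab)/HK.
(* A bad radius less than [eta / 4] above the infimum of bad radii, so that [s - eta / 2] is a good
   radius as soon as it is positive. *)
pose s := Num.min s0 r.
have As : A s.
  by rewrite /s; case: leP => _.
have slt : s < inf A + eta / 4 by apply: le_lt_trans s0lt; rewrite ge_min lexx.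
have sr : s <= r by rewrite ge_min lexx orbT.
have [s'0|s'0] := leP (s - eta / 2) 0.
  exists z; split; first exact: dlt_refl.
  by apply: (mono s); [lra|case: As].
have [K cK HK] : precompact_set (dball z (s - eta / 2)).
  apply: contrapT => ba; have : inf A <= s - eta / 2 by apply: inf_lbound.
  by lra.
apply: contrapT => /forallNP noz.
have good f : dlt z f r -> precompact_set (dball f eta).
  by move=> zf; apply: contrapT => bf; apply: (noz f).
have eta8 : 0 < eta / 8 by rewrite divr_gt0.
have := cK; rewrite compact_cover => /(_ M setT (fun k => (dball k (eta / 8))°)).
case.
- by move=> i _; exact: open_interior.
- move=> k _; exists k => //; exact: nbhs_dball.
move=> D' _ cov.
(* The centres of the finite cover lie in [K], possibly outside of the ball; each useful one is
   replaced by a nearby point of the ball, where balls of radius [eta] are precompact. *)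
have [pick Hpick] : exists pick : M -> M, forall k,
    (exists f, dlt k f (eta / 8) /\ dlt z f (s - eta / 2)) ->
    dlt k (pick k) (eta / 8) /\ dlt z (pick k) (s - eta / 2).
  suff /choice[pick Hp] : forall k, exists f', (exists f, dlt k f (eta / 8) /\ dlt z f (s - eta / 2)) ->
    dlt k f' (eta / 8) /\ dlt z f' (s - eta / 2) by exists pick.
  move=> k; case: (pselect (exists f, dlt k f (eta / 8) /\ dlt z f (s - eta / 2))).
    by move=> [f Hf]; exists f.
  by move=> nf; exists k.
pose B k := if `[< exists f, dlt k f (eta / 8) /\ dlt z f (s - eta / 2) >]
  then dball (pick k) eta else set0.
have [|K2 cK2 HK2] := @precompact_bigcup (finmap.enum_fset D') B.
  move=> k _; rewrite /B; case: asboolP => [Hk|_].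
    apply: good; apply: dlt_le (Hpick k Hk).2; lra.
  by exists set0; [exact: compact0|].
case: As => _; apply; exists K2 => // q zq; apply: HK2.
have eta2 : 0 < eta / 2 by rewrite divr_gt0.
have [|z1 zz1 z1q] := @dlt_mid z q _ _ s'0 eta2; first by rewrite subrK.
have [k kD /interior_subset kz1] := cov _ (HK _ zz1).
exists k => //; rewrite /B asboolT; last by exists z1.
have [kf zf] := Hpick k (ex_intro _ z1 (conj kz1 zz1)).
apply: (@dlt_le _ _ (eta / 8 + (eta / 8 + eta / 2))); first by lra.
apply: dlt_trans (dlt_sym kf) _; exact: dlt_trans kz1 z1q.
Qed.

(** From a ball that is not precompact, [dball_step] builds points [z k] whose balls of radius
    [2^-k] are not precompact and which form a Cauchy sequence. A small ball around the limit is
    precompact and contains one of them. *)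
Lemma Hopf_Rinow p r : complete_induced_metric x -> precompact_set (dball p r).
Proof.
move=> complete.
have [r0|r0] := ltP 0 r; last first.
  have [r' r'0 [K cK HK]] := precompact_dball_small p.
  by exists K => // q pq; apply: HK; apply: dlt_le pq; exact: le_trans (ltW r'0).
apply: contrapT => bad.
pose e k : R := 2^-1 ^+ k.
have e0 k : 0 < e k by rewrite exprn_gt0// invr_gt0.
have eS k : e k = 2 * e k.+1 by rewrite /e exprS mulrA divff ?mul1r// pnatr_eq0.
have [z0 [_ bad0]] := dball_step r0 (e0 0) bad.
have [f Hf] : exists f : M * nat -> M, forall p, ~ precompact_set (dball p.1 (e p.2)) ->
   dlt p.1 (f p) (e p.2) /\ ~ precompact_set (dball (f p) (e p.2.+1)).
  suff /choice[f Hf] : forall p : M * nat, exists z', ~ precompact_set (dball p.1 (e p.2)) ->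
   dlt p.1 z' (e p.2) /\ ~ precompact_set (dball z' (e p.2.+1)) by exists f.
  move=> [z k] /=; case: (pselect (precompact_set (dball z (e k)))).
    by move=> ?; exists z.
  by move=> b; have [z' Hz'] := dball_step (e0 k) (e0 k.+1) b; exists z'.
pose z := fix z k := if k is k'.+1 then f (z k', k') else z0.
have badz k : ~ precompact_set (dball (z k) (e k)).
  by elim: k => //= k IH; exact: (Hf (z k, k) IH).2.
have zS k : dlt (z k) (z k.+1) (e k) by exact: (Hf (z k, k) (badz k)).1.
(* The geometric sum telescopes to [2 * e i - 2 * e (i + k)]; the extra [e i] keeps the strict
   relation true for [k = 0]. *)
have zz i k : dlt (z i) (z (i + k)%N) (3 * e i - 2 * e (i + k)%N).
  elim: k => [|k IH].
    by rewrite addn0; apply: dlt_refl; have := e0 i; lra.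
  rewrite addnS; apply: dlt_le (dlt_trans IH (zS _)); rewrite (eS (i + k)%N); lra.
have cvge (d : R) : 0 < d -> exists K, forall k, (K <= k)%N -> e k < d.
  move=> d0; have : e k @[k --> \oo] --> (0 : R).
    by apply: cvg_expr; rewrite ger0_norm ?invr_ge0// invf_lt1 ?ltr1n.
  move=> /cvgrPdist_lt/(_ _ d0)[K _ HK]; exists K => k Kk.
  by have := HK k Kk; rewrite /= sub0r normrN ger0_norm// ltW.
have [q Hq] : exists q : M, forall d : R, 0 < d -> exists K : nat, forall i : nat,
      (K <= i)%N -> (riemannian_dist x (z i) q < d%:E)%E.
  apply: complete => d d0; have d3 : 0 < d / 3 by rewrite divr_gt0.
  have [K HK] := cvge _ d3; exists K => i j Ki Kj.
  apply/riemannian_dist_ltP.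
  have main a b : (K <= a)%N -> (a <= b)%N -> dlt (z a) (z b) d.
    move=> Ka ab; have := zz a (b - a)%N; rewrite subnKC//; apply: dlt_le.
    by have := HK a Ka; have := e0 b; lra.
  have [ij|/ltnW ji] := leqP i j; first exact: main.
  by apply: dlt_sym; exact: main.
have [d d0 [K cK HK]] := precompact_dball_small q.
have d2 : 0 < d / 2 by rewrite divr_gt0.
have [K1 HK1] := Hq _ d2; have [K2 HK2] := cvge _ d2.
have := HK1 (maxn K1 K2) (leq_maxl _ _) => /riemannian_dist_ltP dz.
apply: (badz (maxn K1 K2)); exists K => // w zw; apply: HK.
apply: (@dlt_le _ _ (d / 2 + e (maxn K1 K2))).
  by have := HK2 _ (leq_maxr K1 K2); lra.
exact: dlt_trans (dlt_sym dz) zw.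
Qed.

End distance.

(** * The shape operator in ambient coordinates *)

Section second_form_symmetric.
Variables (R : realType) (n : nat) (U : set 'rV[R]_n).
Variables (X N : 'rV[R]_n -> 'rV[R]_n.+1).
Hypothesis oU : open U.
Hypotheses (dX : forall y, U y -> differentiable X y) (CX : C1mx U X)
  (CX2 : forall v, C1mx U ('D_v X)).
Hypotheses (dN : forall y, U y -> differentiable N y) (CN : C1mx U N).
Hypotheses (XN : forall y, U y -> 'J X y *m (N y)^T = 0).

(** Differentiating the orthogonality of [N] and the coordinate fields expresses the second
    fundamental form by the normal part of the second derivatives of [X], which are symmetric. *)
Lemma second_form_sym y : U y ->
  ('J N y *m ('J X y)^T)^T = 'J N y *m ('J X y)^T.
Proof.
move=> Uy.
have CJ := C1mx_jacobian oU dX CX2.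
have E i k : ('J X y *m ('J N y)^T) k i = - ('D_(delta_mx 0 i) (jacobian X) y *m (N y)^T) k 0.
  have dJ : derivable (jacobian X) y (delta_mx 0 i) by exact: C1mx_derivable CJ Uy.
  have dNy : derivable N y (delta_mx 0 i) by exact: C1mx_derivable CN Uy.
  have [dNT DNT] := derivable_trmx dNy.
  have [dJN DJN] := derivable_mulmx dJ dNT.
  have Z : 'D_(delta_mx 0 i) (fun z => 'J X z *m (N z)^T) y = 0.
    apply: (@etrans _ _ ('D_(delta_mx 0 i) (fun=> 0) y)); last exact: derive_cst.
    apply: near_eq_derive.
    by apply: filterS (open_near oU Uy) => z Uz; exact: XN.
  have RN : 'D_(delta_mx 0 i) N y = row i ('J N y) by rewrite (row_jacobian dN i Uy).
  have H := etrans (esym DJN) Z; rewrite DNT RN in H.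
  have := congr1 (fun M : 'cV[R]_n => M k 0) H.
  rewrite mxE [in X in _ = X]mxE => /eqP; rewrite addrC addr_eq0 => /eqP <-.
  rewrite tr_row [LHS]mxE [RHS]mxE; apply: eq_bigr => l _; congr (_ * _).
  by rewrite [LHS]mxE [RHS]mxE [RHS]mxE.
have S : ('J X y *m ('J N y)^T)^T = 'J X y *m ('J N y)^T.
  apply/matrixP => i k; rewrite [LHS]mxE !E; congr (- _).
  rewrite [LHS]mxE [RHS]mxE; apply: eq_bigr => l _; congr (_ * _).
  exact: (jacobian_sym oU dX CX CX2 i k l Uy).
move: S; move: ('J X y) ('J N y) => J L S.
by rewrite trmx_mul trmxK -S trmx_mul trmxK.
Qed.

End second_form_symmetric.

Section frobenius.
Variable R : realType.

Lemma mxtrace_sqr_sym m (K : 'M[R]_m) : K^T = K -> \tr (K *m K) = \sum_i \sum_j K i j ^+ 2.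
Proof.
move=> S; rewrite /mxtrace; apply: eq_bigr => i _; rewrite mxE; apply: eq_bigr => j _.
by rewrite -{2}S mxE expr2.
Qed.

Lemma mxtrace_sqr_sym_ge0 m (K : 'M[R]_m) : K^T = K -> 0 <= \tr (K *m K).
Proof. by move=> S; rewrite mxtrace_sqr_sym// !sumr_ge0// => i _; rewrite sumr_ge0// => j _; rewrite sqr_ge0. Qed.

Lemma mxtrace_sqr_sym_eq0 m (K : 'M[R]_m) : K^T = K -> \tr (K *m K) = 0 -> K = 0.
Proof.
move=> S; rewrite mxtrace_sqr_sym// => /eqP.
rewrite psumr_eq0; last by move=> i _; rewrite sumr_ge0// => j _; rewrite sqr_ge0.
move=> /allP H; apply/matrixP => i j; rewrite mxE.
have := H i (mem_index_enum i); rewrite psumr_eq0; last by move=> k _; rewrite sqr_ge0.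
by move=> /allP/(_ j (mem_index_enum j)); rewrite sqrf_eq0 => /eqP.
Qed.

Lemma mx_norm_sqr_le_trace m (K : 'M[R]_m) : K^T = K -> `|K| ^+ 2 <= \tr (K *m K).
Proof.
move=> S; rewrite -[leRHS](sqr_sqrtr (mxtrace_sqr_sym_ge0 S)) ler_pXn2r ?nnegrE ?sqrtr_ge0//.
apply: mx_norm_le => [|i j]; first exact: sqrtr_ge0.
rewrite -(@ler_pXn2r _ 2) ?nnegrE ?sqrtr_ge0// (sqr_sqrtr (mxtrace_sqr_sym_ge0 S)).
rewrite mxtrace_sqr_sym// real_normK ?num_real// (bigD1 i)//= (bigD1 j)//= -addrA lerDl.
by rewrite addr_ge0// ?sumr_ge0// => k _; rewrite ?sqr_ge0// sumr_ge0// => l _; rewrite sqr_ge0.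
Qed.

Lemma enorm_mul_le m p (v : 'rV[R]_m) (K : 'M[R]_(m, p)) :
  enorm (v *m K) <= (p%:R * m%:R) * enorm v * `|K|.
Proof.
apply: (le_trans (enorm_le_mx_norm _)); rewrite -!mulrA ler_wpM2l//.
apply: (le_trans (mx_norm_mul _ _)); rewrite -!mulrA ler_wpM2l// ler_wpM2r//.
exact: mx_norm_le_enorm.
Qed.

End frobenius.

(** Under a change of chart both Jacobians are multiplied by the same matrix [T], which is
    invertible as [T *m J'] has full rank. The two products then agree after multiplication by [N]
    and by [J'], hence agree. *)
Lemma pinv_mul_chain (R : realType) n (T : 'M[R]_n) (J J' L L' : 'M[R]_(n, n.+1))
    (N : 'rV[R]_n.+1) :
  J = T *m J' -> L = T *m L' -> row_free J -> row_free J' ->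
  N *m N^T = 1%:M -> J *m N^T = 0 -> J' *m N^T = 0 ->
  pinv J *m L = pinv J' *m L'.
Proof.
move=> EJ EL fJ fJ' NN JN JN'.
have Tu : T \in unitmx.
  rewrite -row_free_unit -kermx_eq0; apply/eqP/row_matrixP => i; rewrite row0.
  have kT : row i (kermx T) *m T = 0 by apply/sub_kermxP; exact: row_sub.
  by apply: (row_free_inj fJ); rewrite EJ mulmxA kT !mul0mx.
have A1 : J' *m (pinv J *m L) = L'.
  have H : T *m (J' *m (pinv J *m L)) = T *m L'.
    by rewrite [LHS]mulmxA -EJ [LHS]mulmxA (mul_pinv fJ) mul1mx.
  by rewrite -[LHS]mul1mx -(mulVmx Tu) -[LHS]mulmxA H [LHS]mulmxA mulVmx// mul1mx.
have A2 : J' *m (pinv J' *m L') = L' by rewrite mulmxA (mul_pinv fJ') mul1mx.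
have N1 : N *m (pinv J *m L) = 0 by rewrite mulmxA normal_pinv// mul0mx.
have N2 : N *m (pinv J' *m L') = 0 by rewrite mulmxA normal_pinv// mul0mx.
rewrite -[LHS]mul1mx -[RHS]mul1mx -(pinv_mul fJ' NN JN') !mulmxDl -!(mulmxA N^T N) -!(mulmxA (pinv J') J').
by rewrite N1 N2 A1 A2.
Qed.

Lemma pinv_mul_sym (R : realType) n (J L : 'M[R]_(n, n.+1)) :
  L = L *m (pinv J *m J) -> (L *m J^T)^T = L *m J^T -> (pinv J *m L)^T = pinv J *m L.
Proof.
move=> LP S.
have Gs : (invmx (J *m J^T))^T = invmx (J *m J^T) by rewrite trmx_inv trmx_mul trmxK.
have E : pinv J *m L = J^T *m (invmx (J *m J^T) *m (L *m J^T) *m invmx (J *m J^T)) *m J.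
  by rewrite [in LHS]LP /pinv !mulmxA.
rewrite E; move: (L *m J^T) S (invmx _) Gs => K S Q Gs.
by rewrite !trmx_mul trmxK Gs S !mulmxA.
Qed.

Lemma mxtrace_sqr_swap (R : realType) m p (A : 'M[R]_(m, p)) (B : 'M[R]_(p, m)) :
  \tr (- (A *m B) *m - (A *m B)) = \tr (- (B *m A) *m - (B *m A)).
Proof.
rewrite !(mulNmx, mulmxN) !opprK.
by rewrite -!mulmxA [LHS]mxtrace_mulC !mulmxA.
Qed.

(** Turns chart coordinates of the field into the ambient vector; the hypothesis says that the rows
    of [L] are tangential. *)
Lemma field_chain (R : realType) m p (X : 'rV[R]_p) (Q : 'M[R]_(p, m)) (J L : 'M[R]_(m, p)) (H : R) :
  L *m (Q *m J) = L ->
  - (X *m Q *m (L *m Q + H%:M)) *m J = X *m (- (Q *m L) - H *: (Q *m J)).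
Proof.
move=> E; have -> : - (X *m Q *m (L *m Q + H%:M)) *m J = - (X *m (Q *m (L *m (Q *m J) + H *: J))).
  by rewrite mulNmx -!mulmxA mulmxDl -mulmxA mul_scalar_mx.
by rewrite E mulmxDr -scalemxAr !mulmxDr !mulmxN opprD.
Qed.

(** * The shape operator as an endomorphism of the ambient space *)

Section ambient_shape.
Variables (R : realType) (n : nat) (M : oriented_manifold R n) (x N : M -> 'rV[R]_n.+1).
Hypotheses (ex : embedding x) (uN : unit_normal x N).

Let sx : smooth_map x. Proof. by case: ex. Qed.
Let sN : smooth_map N. Proof. by case: uN. Qed.

Lemma jacobian_row_free c p : atlas c -> cdom c p -> row_free (cjacobian x c p).
Proof. by case: ex => _ + _ _; apply. Qed.

Lemma normal_unit p : N p *m (N p)^T = 1%:M.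
Proof.
have [_ + _] := uN => /(_ p) E.
apply/matrixP => i j; rewrite !ord1 [RHS]mxE eqxx.
by rewrite -[LHS]/(dotv (N p) (N p)) -sqr_enorm E expr1n.
Qed.

Lemma jacobian_normal c p : atlas c -> cdom c p -> cjacobian x c p *m (N p)^T = 0.
Proof.
move=> ac cp; have [_ _ +] := uN => /(_ c p ac cp) H.
apply/matrixP => i j; rewrite (ord1 j) [RHS]mxE -(H i) /dotv !mxE.
by apply: eq_bigr => k _; congr (_ * _); rewrite [RHS]mxE.
Qed.

Lemma smooth_map_C2 (f : M -> 'rV[R]_n.+1) (c : chart R n M) : smooth_map f -> atlas c ->
  [/\ forall y, ccod c y -> differentiable (f \o cinv c) y,
   C1mx (ccod c) (f \o cinv c) & forall v, C1mx (ccod c) ('D_v (f \o cinv c))].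
Proof. by move=> sf ac; apply: smooth_on_C2; [exact: ccod_open|exact: sf]. Qed.

Lemma cmap_cinv (c : chart R n M) y : ccod c y -> cdom c (cinv c y) /\ cmap c (cinv c y) = y.
Proof. by move=> [p cp <-]; rewrite cmapK. Qed.

Lemma cmap_ccod (c : chart R n M) p : cdom c p -> ccod c (cmap c p).
Proof. by move=> cp; exists p. Qed.

Lemma cjacobian_chain (f : M -> 'rV[R]_n.+1) c d p : smooth_map f -> atlas c -> atlas d ->
  cdom c p -> cdom d p ->
  cjacobian f c p = 'J (cmap d \o cinv c) (cmap c p) *m cjacobian f d p.
Proof.
move=> sf ac ad cp dp.
have [dfc _ _] := smooth_map_C2 sf ac; have [dfd _ _] := smooth_map_C2 sf ad.
have dT : differentiable (cmap d \o cinv c) (cmap c p).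
  by have [+ _] := atlas_smooth ac ad 1; apply; exists p.
have E : \forall y \near cmap c p, (f \o cinv c) y = ((f \o cinv d) \o (cmap d \o cinv c)) y.
  have n1 : \forall y \near cmap c p, ccod c y.
    by apply: open_nbhs_nbhs; split; [exact: ccod_open|exact: cmap_ccod].
  have n2 : \forall y \near cmap c p, cdom d (cinv c y).
    apply: (cinv_continuous (cmap_ccod cp)); rewrite cmapK//.
    by apply: open_nbhs_nbhs; split => //; exact: cdom_open.
  near=> y.
  by rewrite /= cmapK//; near: y.
have dTp : (cmap d \o cinv c) (cmap c p) = cmap d p by rewrite /= cmapK.
have dfd' : differentiable (f \o cinv d) ((cmap d \o cinv c) (cmap c p)).
  by rewrite dTp; apply: dfd; exact: cmap_ccod.
have dC := differentiable_comp dT dfd'.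
apply/row_matrixP => i; rewrite !rowE /cjacobian mulmxA.
have e1 := deriveEjacobian 'e_i (dfc _ (cmap_ccod cp)).
have e2 := deriveEjacobian 'e_i dT.
have e5 : 'D_'e_i ((f \o cinv d) \o (cmap d \o cinv c)) (cmap c p) =
    'D_('D_'e_i (cmap d \o cinv c) (cmap c p)) (f \o cinv d) ((cmap d \o cinv c) (cmap c p)).
  apply: (etrans (deriveE _ dC)); rewrite diff_comp//.
  apply: (etrans _ (esym (deriveE _ dfd'))) => /=.
  by congr ('d _ _ _); exact: (esym (deriveE _ dT)).
apply: (etrans (esym e1)); apply: (etrans (near_eq_derive _ E)); apply: (etrans e5).
apply: (etrans (deriveEjacobian _ dfd')).
exact: (congr2 mulmx e2 (congr1 (jacobian (f \o cinv d)) dTp)).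
Unshelve. all: by end_near. Qed.

(** The shape operator extended by 0 in the normal direction. As a matrix in the ambient basis it is
    symmetric, has the same traces, and does not depend on the chart. *)
Definition chart_shape c p : 'M[R]_n.+1 := - (pinv (cjacobian x c p) *m cjacobian N c p).

Lemma chart_shape_indep c d p : atlas c -> atlas d -> cdom c p -> cdom d p ->
  chart_shape c p = chart_shape d p.
Proof.
move=> ac ad cp dp.
refine (congr1 -%R _).
exact: (pinv_mul_chain (cjacobian_chain sx ac ad cp dp) (cjacobian_chain sN ac ad cp dp)
  (jacobian_row_free ac cp) (jacobian_row_free ad dp) (normal_unit p)
  (jacobian_normal ac cp) (jacobian_normal ad dp)).
Qed.

Definition amb_shape p := chart_shape (chart_at p) p.

Lemma amb_shapeE c p : atlas c -> cdom c p -> amb_shape p = chart_shape c p.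
Proof. by move=> ac cp; apply: chart_shape_indep => //; [exact: atlas_chart_at|exact: cdom_chart_at]. Qed.

Definition tan_proj p : 'M[R]_n.+1 := 1%:M - (N p)^T *m N p.

Lemma tan_projE c p : atlas c -> cdom c p ->
  pinv (cjacobian x c p) *m cjacobian x c p = tan_proj p.
Proof.
by move=> ac cp; apply: pinv_mulE (normal_unit p) (jacobian_normal ac cp); exact: jacobian_row_free.
Qed.

Lemma tangent_projE p v : tangent_proj x p v = v *m tan_proj p.
Proof.
by rewrite -(tan_projE (atlas_chart_at p) (cdom_chart_at p)) /tangent_proj /pinv !mulmxA.
Qed.

Lemma chart_data c : atlas c ->
  let X := x \o cinv c in let NX := N \o cinv c in
  [/\ forall y, ccod c y -> NX y *m (NX y)^T = 1%:M,
      forall y, ccod c y -> 'J X y *m (NX y)^T = 0 &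
      forall y, ccod c y -> row_free ('J X y)].
Proof.
move=> ac X NX; split=> y cy; have [dy yE] := cmap_cinv cy.
- exact: normal_unit.
- by have := jacobian_normal ac dy; rewrite /cjacobian yE.
- by have := jacobian_row_free ac dy; rewrite /cjacobian yE.
Qed.

Lemma cjacobian_normal_orth c p : atlas c -> cdom c p -> cjacobian N c p *m (N p)^T = 0.
Proof.
move=> ac cp; have [dN CN CN2] := smooth_map_C2 sN ac.
have [NN _ _] := chart_data ac.
have := jacobian_normal_orth (@ccod_open _ _ _ c) dN CN NN (cmap_ccod cp).
by rewrite /= cmapK.
Qed.

Lemma chart_shape_sym c p : atlas c -> cdom c p -> (chart_shape c p)^T = chart_shape c p.
Proof.
move=> ac cp; have [dN CN CN2] := smooth_map_C2 sN ac; have [dX CX CX2] := smooth_map_C2 sx ac.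
have [NN XN Jf] := chart_data ac.
have S := second_form_sym (@ccod_open _ _ _ c) dX CX CX2 dN CN XN (cmap_ccod cp).
rewrite -/(cjacobian x c p) -/(cjacobian N c p) in S.
have JNP : cjacobian N c p = cjacobian N c p *m (pinv (cjacobian x c p) *m cjacobian x c p).
  by rewrite (tan_projE ac cp) /tan_proj mulmxBr mulmx1 mulmxA (cjacobian_normal_orth ac cp) mul0mx subr0.
by rewrite /chart_shape linearN /= (pinv_mul_sym JNP S).
Qed.

Lemma amb_shape_sym p : (amb_shape p)^T = amb_shape p.
Proof. exact: chart_shape_sym (atlas_chart_at p) (cdom_chart_at p). Qed.

Lemma amb_shape_proj p : amb_shape p *m tan_proj p = amb_shape p.
Proof.
have Z := cjacobian_normal_orth (atlas_chart_at p) (cdom_chart_at p).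
have AN : amb_shape p *m (N p)^T = 0.
  by rewrite /amb_shape /chart_shape mulNmx -(mulmxA (pinv _) (cjacobian N _ p)) Z mulmx0 oppr0.
by rewrite /tan_proj mulmxBr mulmx1 mulmxA AN mul0mx subr0.
Qed.

Lemma tan_proj_sym p : (tan_proj p)^T = tan_proj p.
Proof. by rewrite /tan_proj linearB /= trmx1 trmx_mul trmxK. Qed.

Lemma tan_proj_idem p : tan_proj p *m tan_proj p = tan_proj p.
Proof.
rewrite {2}/tan_proj mulmxBr mulmx1 mulmxA /tan_proj mulmxBl mul1mx.
by rewrite -(mulmxA (N p)^T) normal_unit mulmx1 subrr mul0mx subr0.
Qed.

Lemma mxtrace_tan_proj p : \tr (tan_proj p) = n%:R.
Proof.
rewrite -(tan_projE (atlas_chart_at p) (cdom_chart_at p)) mxtrace_mulC.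
by rewrite (mul_pinv (jacobian_row_free (atlas_chart_at p) (cdom_chart_at p))) mxtrace1.
Qed.

Lemma shape_operatorE p : shape_operator x N p =
  - (cjacobian N (chart_at p) p *m pinv (cjacobian x (chart_at p) p)).
Proof.
rewrite /shape_operator /pinv /induced_metric; cbv zeta.
by move: (cjacobian x _ _) (cjacobian N _ _) => J L; rewrite mulNmx mulmxA.
Qed.

Lemma mxtrace_amb_shape p : \tr (amb_shape p) = \tr (shape_operator x N p).
Proof.
rewrite shape_operatorE /amb_shape /chart_shape.
by move: (pinv _) (cjacobian N _ _) => J L; rewrite !linearN /= mxtrace_mulC.
Qed.

Lemma mxtrace_sqr_amb_shape p : \tr (amb_shape p *m amb_shape p) =
  \tr (shape_operator x N p *m shape_operator x N p).
Proof.
rewrite shape_operatorE /amb_shape /chart_shape.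
exact: mxtrace_sqr_swap.
Qed.

Variables (C H : R).
Hypotheses (boundA : forall p, norm_sff x N p <= C) (cmc : forall p, mean_curvature x N p = H).
Hypothesis n0 : (0 < n)%N.

Lemma mxtrace_shape p : \tr (amb_shape p) = n%:R * H.
Proof.
rewrite mxtrace_amb_shape -(cmc p) /mean_curvature mulrC divfK//.
by rewrite pnatr_eq0 -lt0n.
Qed.

(* [field] below is the vector field [A x^T - H x^T], whose divergence on [M] is
   [<x, N> (|A|^2 - n H^2)]; [defect] is [|A|^2 - n H^2], the squared norm of the
   traceless part of [A]. *)
Definition traceless p : 'M[R]_n.+1 := amb_shape p - H *: tan_proj p.
Definition defect p := \tr (amb_shape p *m amb_shape p) - n%:R * H ^+ 2.

Lemma traceless_sym p : (traceless p)^T = traceless p.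
Proof. by rewrite /traceless linearB linearZ /= amb_shape_sym tan_proj_sym. Qed.

Lemma proj_traceless p : tan_proj p *m traceless p = traceless p.
Proof.
rewrite /traceless mulmxBr -scalemxAr tan_proj_idem; congr (_ - _).
by rewrite -[LHS]trmxK trmx_mul amb_shape_sym tan_proj_sym amb_shape_proj amb_shape_sym.
Qed.

(** Expand the square: the trace of [amb_shape] is [n * H] and that of the tangential projection is
    [n]. *)
Lemma defectE p : defect p = \tr (traceless p *m traceless p).
Proof.
rewrite {1}/traceless mulmxBl -scalemxAl proj_traceless /traceless.
rewrite mulmxBr -scalemxAr amb_shape_proj /defect.
move: (mxtrace_tan_proj p) (mxtrace_shape p); move: (amb_shape p) (tan_proj p) => A P tP tA.
by rewrite !raddfB /= ?scalerBr ?raddfB /= !mxtraceZ tA tP; ring.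
Qed.

Lemma defect_ge0 p : 0 <= defect p.
Proof. by rewrite defectE mxtrace_sqr_sym_ge0// traceless_sym. Qed.

Lemma defect_le p : defect p <= C ^+ 2.
Proof.
have := boundA p; rewrite /norm_sff -mxtrace_sqr_amb_shape => B.
have A0 : 0 <= \tr (amb_shape p *m amb_shape p).
  by apply: mxtrace_sqr_sym_ge0; exact: amb_shape_sym.
apply: (@le_trans _ _ (\tr (amb_shape p *m amb_shape p))).
  by rewrite /defect gerBl mulr_ge0// sqr_ge0.
by rewrite -(sqr_sqrtr A0) ler_pXn2r ?nnegrE ?sqrtr_ge0// (le_trans _ B) ?sqrtr_ge0.
Qed.

Definition support_fun p := dotv (x p) (N p).
Definition divergence p := support_fun p * defect p.
Definition field p := x p *m traceless p.

(** The field only sees the tangential part of the position, and the squared norm of [traceless] is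
    at most [defect], hence at most [C ^+ 2]. The powers of [n + 1] come from comparing norms. *)
Lemma field_bound p : enorm (field p) <=
  (n.+1%:R * n.+1%:R) * `|C| * enorm (tangent_proj x p (x p)).
Proof.
rewrite /field -proj_traceless mulmxA tangent_projE.
apply: (le_trans (enorm_mul_le _ _)); rewrite -[leRHS]mulrA [leRHS]mulrA -mulrA.
rewrite -[leRHS]mulrA ler_wpM2l// ?mulr_ge0// mulrC ler_wpM2r ?enorm_ge0//.
rewrite -(@ler_pXn2r _ 2) ?nnegrE// real_normK ?num_real//.
apply: le_trans (defect_le p); rewrite defectE; exact: mx_norm_sqr_le_trace (traceless_sym p).
Qed.

Lemma chart_trace c y : atlas c -> ccod c y ->
  \tr ('J (N \o cinv c) y *m pinv ('J (x \o cinv c) y)) = - (n%:R * H).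
Proof.
move=> ac cy; have [dy yE] := cmap_cinv cy.
rewrite -(mxtrace_shape (cinv c y)) (amb_shapeE ac dy) /chart_shape /cjacobian yE.
by move: (pinv _) ('J _ _) => J L; rewrite linearN /= opprK mxtrace_mulC.
Qed.

Lemma chart_field_jacobian c y : atlas c -> ccod c y ->
  chart_field (x \o cinv c) (N \o cinv c) H y *m 'J (x \o cinv c) y = field (cinv c y).
Proof.
move=> ac cy; have [dy yE] := cmap_cinv cy.
rewrite /field /traceless (amb_shapeE ac dy) -(tan_projE ac dy) /chart_shape.
have JNP := cjacobian_normal_orth ac dy.
have P := tan_projE ac dy; rewrite /tan_proj in P.
rewrite /chart_field /cjacobian yE in JNP P *.
rewrite /= in JNP *.
have JNP2 : 'J (N \o cinv c) y *m (pinv ('J (x \o cinv c) y) *m 'J (x \o cinv c) y) =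
   'J (N \o cinv c) y.
  by rewrite P mulmxBr mulmx1 mulmxA JNP mul0mx subr0.
exact: field_chain JNP2.
Qed.

Lemma chart_divergence c y : atlas c -> ccod c y ->
  \sum_i 'D_(delta_mx 0 i) (fun z => vol_density (x \o cinv c) z *
      chart_field (x \o cinv c) (N \o cinv c) H z 0 i) y =
  vol_density (x \o cinv c) y * divergence (cinv c y).
Proof.
move=> ac cy; have [dy yE] := cmap_cinv cy.
have [dN CN CN2] := smooth_map_C2 sN ac; have [dX CX CX2] := smooth_map_C2 sx ac.
have [NN XN Jf] := chart_data ac.
have T := fun y cy => @chart_trace c y ac cy.
rewrite (divergence_chart_field (@ccod_open _ _ _ c) dX CX CX2 dN CN CN2 NN XN Jf T cy).
rewrite /divergence /support_fun /defect (amb_shapeE ac dy) /chart_shape /cjacobian yE.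
congr (_ * (_ * (_ - _))).
by move: (pinv _) ('J _ _) => J L; rewrite mxtrace_sqr_swap !(mulNmx, mulmxN) !opprK.
Qed.

End ambient_shape.

(** * Integration by parts against Lipschitz cut-offs *)

Section euclidean_integrals.
Variables (R : realType) (n : nat) (lam : {measure set (Borel 'rV[R]_n) -> \bar R}).
Hypothesis Hlam : integrates_rV lam.
Local Open Scope ereal_scope.

Lemma bounded_support_integrable (f : 'rV[R]_n -> R) (A k : R) :
  measurable_fun setT (f : Borel 'rV[R]_n -> R) -> (0 <= k)%R ->
  (forall y, (`|f y| <= A)%R) -> (forall y, ~ cube n k y -> f y = 0%R) ->
  lam.-integrable setT (EFin \o f).
Proof.
move=> mf k0 fA f0.
have A0 : (0 <= A)%R by apply: le_trans (fA 0%R).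
have mc : measurable (cube n k : set (Borel 'rV[R]_n)) by exact: measurable_cube.
have m1 : measurable_fun setT (EFin \o (fun y : Borel 'rV[R]_n => A * \1_(cube n k) y)%R).
  apply/measurable_EFinP; apply: measurable_funM => //; exact: measurable_indic.
have I1 : lam.-integrable setT (EFin \o (fun y : Borel 'rV[R]_n => A * \1_(cube n k) y)%R).
  apply/integrableP; split => //.
  have -> : \int[lam]_y `|(EFin \o (fun y : Borel 'rV[R]_n => A * \1_(cube n k) y)%R) y| =
      \int[lam]_y (A%:E * (\1_(cube n k) y)%:E).
    apply: eq_integral => y _ /=; rewrite ger0_norm ?mulr_ge0//.
  have mi : measurable_fun setT (fun y : Borel 'rV[R]_n => (\1_(cube n k) y : R)%:E).
    by apply/measurable_EFinP; exact: measurable_indic.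
  rewrite (ge0_integralZl lam measurableT mi) ?lee_fin//.
  rewrite (integral_indic lam measurableT mc) setIT integrates_rV_cube//.
  by rewrite -EFinM ltry.
apply: (le_integrable measurableT _ _ I1).
  exact/measurable_EFinP.
move=> y _ /=; rewrite lee_fin [leRHS]ger0_norm ?mulr_ge0//.
have [cy|cy] := pselect (cube n k y); first by rewrite indicE mem_set// mulr1.
by rewrite f0// normr0 mulr_ge0.
Qed.

Lemma cube_ball (y0 y : 'rV[R]_n) r : (`|y - y0| <= r)%R -> cube n (`|y0| + r) y.
Proof.
move=> H j; apply: (le_trans (mx_entry_le _ _ _)).
by rewrite -lerBlDl; apply: (le_trans (lerB_dist _ _)).
Qed.

(** ['D_b W] is a limit of difference quotients. By translation invariance the difference is moved
    onto [phi], where it costs at most [t * kap]; dominated convergence passes to the limit. *)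
Lemma translation_by_parts (phi W : 'rV[R]_n -> R) (b y0 : 'rV[R]_n) (r t0 kap : R) :
  (0 < t0)%R -> (0 <= kap)%R -> (0 <= r)%R ->
  measurable_fun setT (phi : Borel 'rV[R]_n -> R) -> (forall y, (`|phi y| <= 1)%R) ->
  C1on setT W -> (forall y, (r < `|y - y0|)%R -> W y = 0%R) ->
  (forall y t, (0 < t < t0)%R -> W y <> 0%R -> (`|phi (y - t *: b) - phi y| <= t * kap)%R) ->
  lam.-integrable setT (fun y => (phi y * 'D_b W y)%:E) /\
  `| \int[lam]_y (phi y * 'D_b W y)%:E | <= kap%:E * \int[lam]_y (`|W y|)%:E.
Proof.
move=> t00 kap0 r0 mphi phi1 CW W0 lip.
have cW : continuous W by move=> y; exact: (C1on_continuous CW I).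
have cD : continuous ('D_b W) by move=> y; exact: (CW.2 b y I).
have dW y : derivable W y b by exact: (C1on_derivable CW I).
have mW : measurable_fun setT (W : Borel 'rV[R]_n -> R) by exact: continuous_measurable_borel.
have mD : measurable_fun setT ('D_b W : Borel 'rV[R]_n -> R) by exact: continuous_measurable_borel.
have D0 y : (r < `|y - y0|)%R -> 'D_b W y = 0%R.
  move=> ry; apply: (@etrans _ _ ('D_b (cst 0%R : 'rV[R]_n -> R) y)); last exact: derive_cst.
  apply: near_eq_derive.
  have : \forall z \near y, (r < `|z - y0|)%R.
    apply/nbhs_ballP; exists (`|y - y0| - r)%R; first by rewrite /= subr_gt0.
    move=> z; rewrite -ball_normE /= ltrBrDl => H.
    by rewrite -(ltrD2r `|y - z|%R); apply: (lt_le_trans H); rewrite [leRHS]addrC; exact: ler_distD.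
  by apply: filterS => z; exact: W0.
have bound (f : 'rV[R]_n -> R) : continuous f -> (forall y, (r < `|y - y0|)%R -> f y = 0%R) ->
    exists2 B, (0 <= B)%R & forall y, (`|f y| <= B)%R.
  move=> cf f0.
  have cK : compact (closed_ball y0 (r + 1)%R).
    apply: bounded_closed_compact; last exact: closed_ball_closed.
    exists (`|y0| + (r + 1))%R; split; first exact: num_real.
    move=> s rs y; rewrite closed_ballE ?ltr_wpDl// /closed_ball_ /= => Hy.
    apply: le_trans (ltW rs); rewrite -lerBlDl.
    by apply: (le_trans (lerB_dist _ _)); rewrite distrC.
  have cfn : {within closed_ball y0 (r + 1)%R, continuous (fun y => `|f y|%R)}.
    apply: continuous_subspaceT => y; exact: (cvg_norm (cf y)).
  have ne : (closed_ball y0 (r + 1)%R !=set0)%classic.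
    exists y0; apply: closed_ballxx; by rewrite ltr_wpDl.
  have [y1 _ H1] := compact_EVT_max ne cK cfn.
  exists `|f y1|%R => // y.
  have [yr|yr] := lerP `|y - y0|%R (r + 1)%R.
    apply: H1; rewrite inE closed_ballE ?ltr_wpDl// /closed_ball_ /= distrC.
    exact: yr.
  by rewrite f0 ?normr0//; apply: le_lt_trans yr; rewrite lerDl.
have [B B0 DB] := bound _ cD D0; have [BW BW0 WB] := bound _ cW W0.
(* Steps tending to 0, smaller than [t0] for the hypothesis on [phi], and at most 1 so that all
   shifted supports lie in one cube. *)
pose tk k : R := (Num.min 1 (t0 / 2) / k.+1%:R)%R.
have tk0 k : (0 < tk k)%R by rewrite divr_gt0// lt_min ltr01 divr_gt0.
have tk1 k : (tk k <= 1)%R.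
  rewrite /tk ler_pdivrMr// mul1r ge_min; apply/orP; left; by rewrite ler1n.
have tkt k : (tk k < t0)%R.
  apply: (@le_lt_trans _ _ (t0 / 2)%R); last by rewrite ltr_pdivrMr//; lra.
  rewrite /tk ler_pdivrMr// ge_min; apply/orP; right.
  by rewrite ler_peMr ?ler1n// divr_ge0// ltW.
pose R' := (`|y0| + (r + `|b|))%R.
have R'0 : (0 <= R')%R by rewrite !addr_ge0.
have cubeW t y : (0 <= t <= 1)%R -> W (y + t *: b)%R <> 0%R -> cube n R' y.
  move=> /andP[t0' t1] Wy; apply: cube_ball.
  have [H|H] := leP `|y + t *: b - y0|%R r; last by rewrite W0 in Wy.
  have -> : (y - y0 = y + t *: b - y0 - t *: b)%R.
    by rewrite [RHS]addrAC addrK.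
  apply: (le_trans (ler_normB _ _)); apply: lerD => //.
  by rewrite normrZ ger0_norm// ler_piMl.
have cubeW0 y : W y <> 0%R -> cube n R' y.
  by move=> Wy; apply: (@cubeW 0%R); rewrite ?lexx ?ler01// scale0r addr0.
have cubeWc t y : (0 <= t <= 1)%R -> ~ cube n R' y -> W (y + t *: b)%R = 0%R.
  by move=> tt nc; apply: contrapT => Wy; apply: nc; exact: cubeW tt Wy.
have cubeW0c y : ~ cube n R' y -> W y = 0%R.
  by move=> nc; apply: contrapT => Wy; apply: nc; exact: cubeW0.
have cubeDc y : ~ cube n R' y -> 'D_b W y = 0%R.
  move=> nc; apply: D0; rewrite ltNge; apply/negP => H; apply: nc.
  by apply: cube_ball; apply: (le_trans H); rewrite lerDl.
have mWt t : measurable_fun setT ((fun y => W (y + t *: b)%R) : Borel 'rV[R]_n -> R).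
  exact: (measurableT_comp mW (measurable_shift_rV (t *: b)%R)).
pose f k (y : Borel 'rV[R]_n) := (phi y * ((tk k)^-1 * (W (y + tk k *: b)%R - W y)))%R.
have tk01 k : (0 <= tk k <= 1)%R by rewrite (ltW (tk0 k)) tk1.
have mf k : measurable_fun setT (f k).
  by apply: measurable_funM => //; apply: measurable_funM => //; exact: measurable_funB.
have I0 : lam.-integrable setT (fun y => (phi y * 'D_b W y)%:E).
  apply: (@bounded_support_integrable _ B R') => //.
  - exact: measurable_funM.
  - by move=> y; rewrite normrM -[leRHS]mul1r ler_pM.
  - by move=> y /cubeDc ->; rewrite mulr0.
(* By the mean value theorem the difference quotients of [W] are bounded by the maximum of its
   derivative, uniformly in [k]. *)
have fB k y : (`|f k y| <= B)%R.
  have [c _ E] := @MVT_line _ _ W y b (tk k) (tk0 k) (fun s _ => dW _).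
  have -> : f k y = (phi y * 'D_b W (c *: b + y))%R.
    by rewrite /f [(y + _)%R]addrC E mulKf// gt_eqF.
  by rewrite normrM -[leRHS]mul1r ler_pM.
have fc k y : ~ cube n R' y -> f k y = 0%R.
  by move=> nc; rewrite /f cubeWc// cubeW0c// subrr mulr0 mulr0.
have Ig : lam.-integrable setT (EFin \o (fun y => B * \1_(cube n R') y)%R).
  apply: (@bounded_support_integrable _ B R') => //.
  - by apply: measurable_funM => //; apply: measurable_indic; exact: measurable_cube.
  - move=> y; rewrite ger0_norm ?mulr_ge0// indicE; case: (_ \in _); rewrite ?mulr1 ?mulr0//.
  - by move=> y ny; rewrite indicE memNset// mulr0.
have tkc : tk k @[k --> \oo] --> (0%R : R)^'.
  have t1 : tk k @[k --> \oo] --> (0%R : R).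
    rewrite -[X in _ --> X](mulr0 (Num.min 1 (t0 / 2))%R).
    exact: (@cvgM _ _ _ _ (fun _ => Num.min 1 (t0 / 2))%R _ _ _ (cvg_cst _) cvg_harmonic).
  move=> A HA; have HB : \forall k \near \oo, tk k != 0%R -> A (tk k) := t1 _ HA.
  have : \forall k \near \oo, A (tk k).
    by apply: filterS HB => k H; exact: (H (lt0r_neq0 (tk0 k))).
  exact: id.
have fcvg (y : Borel 'rV[R]_n) : (f k y)%:E @[k --> \oo] --> (phi y * 'D_b W y)%:E.
  suff h1 : ((tk k)^-1 * (W (y + tk k *: b) - W y))%R @[k --> \oo] --> ('D_b W y : R).
    have h2 : f k y @[k --> \oo] --> (phi y * 'D_b W y)%R by exact: (cvgM (cvg_cst (phi y)) h1).
    apply: cvg_EFin; first by apply: nearW.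
    exact: h2.
  have H : (h^-1 *: ((W \o shift y) (h *: b) - W y))%R @[h --> (0%R : R)^'] --> 'D_b W y.
    exact: dW.
  have := cvg_comp _ _ tkc H; apply: cvg_trans; apply: near_eq_cvg.
  by apply: nearW => k /=; rewrite [(_ *: b + y)%R]addrC.
have Lbound k : `| \int[lam]_y (f k y)%:E | <= kap%:E * \int[lam]_y (`|W y|)%:E.
  pose t := tk k.
  pose g1 y := (phi y * (t^-1 * W (y + t *: b)))%R.
  pose g2 y := (phi y * (t^-1 * W y))%R.
  pose g3 y := (phi (y - t *: b) * (t^-1 * W y))%R.
  have mphit : measurable_fun setT ((fun y => phi (y - t *: b)%R) : Borel 'rV[R]_n -> R).
    exact: (measurableT_comp mphi (measurable_shift_rV (- (t *: b))%R)).
  have Wi (p : 'rV[R]_n -> R) (q : 'rV[R]_n -> R) : measurable_fun setT (p : Borel 'rV[R]_n -> R) ->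
      (forall y, `|p y| <= 1)%R -> measurable_fun setT (q : Borel 'rV[R]_n -> R) ->
      (forall y, `|q y| <= BW)%R -> (forall y, ~ cube n R' y -> q y = 0%R) ->
      lam.-integrable setT (EFin \o (fun y => p y * (t^-1 * q y))%R).
    move=> mp p1 mq qB q0.
    apply: (@bounded_support_integrable _ (t^-1 * BW)%R R') => //.
    - by apply: measurable_funM => //; apply: measurable_funM.
    - move=> y; rewrite normrM -[leRHS]mul1r ler_pM// normrM ger0_norm; last first.
        by rewrite invr_ge0 ltW// tk0.
      by rewrite ler_wpM2l// invr_ge0 ltW// tk0.
    - by move=> y /q0 ->; rewrite !mulr0.
  have i1 : lam.-integrable setT (EFin \o g1).
    exact: (Wi phi (fun y => W (y + t *: b))%R mphi phi1 (mWt t) (fun y => WB _)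
      (fun y => @cubeWc t y (tk01 k))).
  have i2 : lam.-integrable setT (EFin \o g2) by exact: (Wi phi W mphi phi1 mW WB cubeW0c).
  have i3 : lam.-integrable setT (EFin \o g3).
    exact: (Wi (fun y => phi (y - t *: b))%R W mphit (fun y => phi1 _) mW WB cubeW0c).
  (* The integrals of [g1] and [g3] agree by translation; what is left is [W] times a difference
     quotient of [phi]. *)
  have E : \int[lam]_y (f k y)%:E = \int[lam]_y ((EFin \o g3) y - (EFin \o g2) y).
    rewrite (integralB measurableT i3 i2).
    have -> : \int[lam]_y (EFin \o g3) y = \int[lam]_y (EFin \o g1) y.
      rewrite -(integral_rV_shift (t *: b)%R Hlam (measurable_int _ i3)).
      by apply: eq_integral => y _ /=; rewrite /g3 addrK.
    rewrite -(integralB measurableT i1 i2); apply: eq_integral => y _ /=.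
    by rewrite -EFinB /f /g1 /g2 -mulrBr -mulrBr.
  rewrite E.
  have m32 : measurable_fun setT (fun y : Borel 'rV[R]_n => (EFin \o g3) y - (EFin \o g2) y).
    exact: emeasurable_funB (measurable_int _ i3) (measurable_int _ i2).
  apply: (le_trans (le_abse_integral lam measurableT m32)).
  have mW1 : measurable_fun setT (fun y : Borel 'rV[R]_n => (`|W y|%R)%:E).
    by apply/measurable_EFinP; exact: measurableT_comp.
  rewrite -(ge0_integralZl lam measurableT mW1) ?lee_fin//.
  apply: ge0_le_integral => //.
  - exact: measurableT_comp.
  - exact: measurable_funeM.
  move=> y _; rewrite /= /g3 /g2 lee_fin -mulrBl.
  have [->|Wy] := pselect (W y = 0%R); first by rewrite !mulr0 normr0 mulr0.
  rewrite mulrA normrM ler_wpM2r//.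
  have ti : (0 <= t^-1)%R by rewrite invr_ge0; exact: (ltW (tk0 k)).
  rewrite normrM (ger0_norm ti).
  have tt : (0 < t < t0)%R by rewrite tk0 tkt.
  rewrite ler_pdivrMr; last exact: tk0.
  rewrite [leRHS]mulrC; exact: lip.
split => //.
have mfE k : measurable_fun setT (fun y : Borel 'rV[R]_n => (f k y)%:E).
  exact/measurable_EFinP.
have fg : \forall y \ae lam, forall k, [set: Borel 'rV[R]_n] y ->
    `|(f k y)%:E| <= (EFin \o (fun y => B * \1_(cube n R') y)%R) y.
  apply: aeW => y k _ /=; rewrite lee_fin indicE.
  have [cy|cy] := pselect (cube n R' y); first by rewrite mem_set// mulr1.
  by rewrite fc// normr0 mulr_ge0.
have fcv : \forall y \ae lam, [set: Borel 'rV[R]_n] y ->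
    (f k y)%:E @[k --> \oo] --> (phi y * 'D_b W y)%:E.
  by apply: aeW => y _; exact: fcvg.
have [_ _ L] := @dominated_convergence _ _ _ lam _ measurableT (fun k y => (f k y)%:E) _ _
   mfE (measurable_int _ I0) fcv Ig fg.
apply: (cvge_le _ (cvg_abse L)); apply: nearW => k; exact: Lbound.
Unshelve. all: by end_near. Qed.

End euclidean_integrals.

(** * The induced volume in a chart *)

Section chart_integrals.
Variables (R : realType) (n : nat) (M : oriented_manifold R n) (x N : M -> 'rV[R]_n.+1).
Variable mu : {measure set (Borel M) -> \bar R}.
Hypotheses (ex : embedding x) (uN : unit_normal x N) (rv : riemannian_volume x mu).
Variable lam : {measure set (Borel 'rV[R]_n) -> \bar R}.
Hypothesis Hlam : integrates_rV lam.
Local Open Scope ereal_scope.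

Section one_chart.
Variable c : chart R n M.
Hypothesis ac : atlas c.

(* Outside of the codomain of the chart, [cinv c] is arbitrary. *)
Definition chart_param (y : 'rV[R]_n) : M := if `[< ccod c y >] then cinv c y else point.
Definition chart_weight (y : 'rV[R]_n) : R :=
  if `[< ccod c y >] then vol_density (x \o cinv c) y else 0%R.

Let oC : open (ccod c). Proof. exact: ccod_open. Qed.

Lemma measurable_chart_param :
  measurable_fun setT (chart_param : Borel 'rV[R]_n -> Borel M).
Proof.
apply: (@measurability _ _ _ (Borel M) _ _ (@open M)) => //.
move=> _ [A oA <-]; rewrite setTI.
have o1 : open (ccod c `&` cinv c @^-1` A).
  rewrite openE => y [cy Ay]; apply: filterI; first exact: open_nbhs_nbhs.
  by apply: (cinv_continuous cy); exact: open_nbhs_nbhs.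
have -> : chart_param @^-1` A = (ccod c `&` cinv c @^-1` A) `|`
    (if `[< A point >] then ~` ccod c else set0).
  apply/seteqP; split=> y; rewrite /chart_param /=.
    case: asboolP => cy Ay; first by left.
    by right; rewrite asboolT.
  by case=> [[cy Ay]|]; [rewrite asboolT|case: asboolP => // Ap ncy; rewrite asboolF].
apply: measurableU; first exact: (open_borel o1).
by case: asboolP => _ //; apply: measurableC; exact: open_borel.
Qed.

Lemma vol_density_C1 : C1on (ccod c) (vol_density (x \o cinv c)).
Proof.
have sx : smooth_map x by case: ex.
have [dX CX CX2] := smooth_map_C2 sx ac.
have [NN XN Jf] := chart_data ex uN ac.
exact: (C1on_vol_density oC dX CX2 NN XN Jf).
Qed.

Lemma chart_weight_gt0 y : ccod c y -> (0 < chart_weight y)%R.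
Proof.
move=> cy; have [NN XN Jf] := chart_data ex uN ac.
by rewrite /chart_weight asboolT//; exact: (vol_density_gt0 NN XN Jf cy).
Qed.

Lemma chart_weight_ge0 y : (0 <= chart_weight y)%R.
Proof.
have [cy|ncy] := pselect (ccod c y); first by rewrite ltW// chart_weight_gt0.
by rewrite /chart_weight asboolF.
Qed.

Lemma measurable_chart_weight : measurable_fun setT (chart_weight : Borel 'rV[R]_n -> R).
Proof.
have -> : chart_weight = vol_density (x \o cinv c) \_ (ccod c).
  apply/funext => y; rewrite /chart_weight patchE.
  by case: asboolP => cy; [rewrite mem_set|rewrite memNset].
apply/(measurable_restrictT _ (open_borel oC)).
by apply: (open_continuous_measurable_borel oC) => y cy; exact: (C1on_continuous vol_density_C1 cy).
Qed.

Lemma measurable_cdom : measurable (cdom c : set (Borel M)).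
Proof. apply: open_borel; exact: cdom_open. Qed.

Lemma chart_measure (E : set (Borel M)) : measurable E ->
  mu (E `&` cdom c) = \int[lam]_y (\1_E (chart_param y) * chart_weight y)%:E.
Proof.
move=> mE.
rewrite (rv ac (measurableI _ _ mE measurable_cdom)); last by move=> p [].
have -> : (fun y => (Num.sqrt (\det (induced_metric x c (cinv c y))))%:E)
      \_ [set cmap c p | p in E `&` cdom c] =
    (fun y => (\1_E (chart_param y) * chart_weight y)%:E).
  apply/funext => y; rewrite patchE /chart_param /chart_weight.
  case: asboolP => cy.
    have [dy yE] := cmap_cinv cy.
    rewrite indicE; have [Ey|Ey] := pselect (E (cinv c y)).
      rewrite mem_set; last by exists (cinv c y).
      by rewrite mem_set// mul1r /induced_metric /cjacobian yE.
    rewrite memNset; first by rewrite memNset// mul0r.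
    by move=> [p [Ep cp] pE]; apply: Ey; rewrite -pE cmapK.
  rewrite mulr0 memNset// => -[p [_ cp] pE]; apply: cy; exists p => //.
rewrite Hlam//.
  apply/measurable_EFinP; apply: measurable_funM; last exact: measurable_chart_weight.
  have mi : measurable_fun setT (\1_E : Borel M -> R) by exact: measurable_indic.
  exact: (measurableT_comp mi measurable_chart_param).
by move=> y; rewrite lee_fin mulr_ge0// chart_weight_ge0.
Qed.

Lemma chart_integral (F : M -> R) : measurable_fun setT (F : Borel M -> R) ->
  (forall p, ~ cdom c p -> F p = 0%R) ->
  \int[mu]_p (F p)%:E = \int[lam]_y (F (chart_param y) * chart_weight y)%:E.
Proof.
move=> mF F0.
rewrite -(integral_density measurable_cdom measurable_chart_param measurable_chart_weight
  chart_weight_ge0 chart_measure mF).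
rewrite [RHS]integral_mkcond; apply: eq_integral => p _; rewrite patchE.
by case: ifPn => // /negP pc; rewrite F0// => cp; apply: pc; rewrite inE.
Qed.

End one_chart.

(** In a chart, [A] contains a cube on which the density exceeds half of its value at [p]. *)
Lemma open_measure_gt0 (p : M) (A : set M) : nbhs p A -> measurable (A : set (Borel M)) ->
  0 < mu A.
Proof.
move=> nA mA; pose c := chart_at p; have ac : atlas c by exact: atlas_chart_at.
have cp : cdom c p by exact: cdom_chart_at.
have cy := cmap_ccod cp.
have mcd : measurable (cdom c : set (Borel M)) by exact: measurable_cdom.
apply: (@lt_le_trans _ _ (mu (A `&` cdom c))); last first.
  apply: (le_measure mu); rewrite ?inE; [exact: measurableI|exact: mA|exact: subIsetl].
rewrite (chart_measure ac mA).
pose w0 := vol_density (x \o cinv c) (cmap c p).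
have w00 : (0 < w0)%R by have := chart_weight_gt0 ac cy; rewrite /chart_weight asboolT.
have n1 : \forall y \near cmap c p, (w0 / 2 < vol_density (x \o cinv c) y)%R.
  apply: (cvgr_gt _ (C1on_continuous (vol_density_C1 ac) cy)).
  by rewrite ltr_pdivrMr//; rewrite -/w0; lra.
have n2 : \forall y \near cmap c p, A (cinv c y).
  by apply: (cinv_continuous cy); rewrite cmapK.
have n3 : nbhs (cmap c p) ([set y | (w0 / 2 < vol_density (x \o cinv c) y)%R] `&`
    ([set y | A (cinv c y)] `&` ccod c)).
  apply: filterI n1 _; apply: filterI n2 _; apply: open_nbhs_nbhs; split => //; exact: ccod_open.
have [d /= d0 dB] := (nbhs_ballP _ _).1 n3.
have d2 : (0 <= d / 2)%R by rewrite divr_ge0// ltW.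
have inB y : cube n (d / 2) (y - cmap c p)%R -> ball (cmap c p) d y.
  move=> H; rewrite rV_ball// => j /=; have := H j; rewrite !mxE distrC => h.
  by apply: (le_lt_trans h); rewrite ltr_pdivrMr//; lra.
pose g y : R := (w0 / 2 * \1_(cube n (d / 2)) (y - cmap c p))%R.
have mcube : measurable (cube n (d / 2) : set (Borel 'rV[R]_n)) by exact: measurable_cube.
have mi : measurable_fun setT (fun y : Borel 'rV[R]_n => (\1_(cube n (d / 2)) y : R)%:E).
  by apply/measurable_EFinP; exact: measurable_indic.
have E : \int[lam]_y (g y)%:E = (w0 / 2 * (2 * (d / 2)) ^+ n)%:E.
  rewrite (@integral_rV_shift _ _ _ (fun y => (w0 / 2 * \1_(cube n (d / 2)) y)%:E) _ Hlam); last first.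
    by apply/measurable_EFinP; apply: measurable_funM => //; exact: measurable_indic.
  under eq_integral do rewrite EFinM.
  rewrite (ge0_integralZl lam measurableT mi); last 2 first.
    - by move=> y _; rewrite lee_fin.
    - by rewrite lee_fin divr_ge0// ltW.
  by rewrite (integral_indic lam measurableT mcube) setIT integrates_rV_cube.
apply: (@lt_le_trans _ _ (\int[lam]_y (g y)%:E)).
  by rewrite E lte_fin mulr_gt0 ?divr_gt0// exprn_gt0// mulr_gt0// divr_gt0.
apply: ge0_le_integral => //.
- by move=> y _; rewrite lee_fin mulr_ge0// divr_ge0// ltW.
- apply/measurable_EFinP; apply: measurable_funM => //.
  have mic : measurable_fun setT (\1_(cube n (d / 2)) : Borel 'rV[R]_n -> R) by exact: measurable_indic.
  exact: (measurableT_comp mic (measurable_shift_rV (- cmap c p)%R)).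
- apply/measurable_EFinP; apply: measurable_funM; last exact: (measurable_chart_weight ac).
  have miA : measurable_fun setT (\1_A : Borel M -> R) by exact: measurable_indic.
  exact: (measurableT_comp miA (measurable_chart_param c)).
move=> y _; rewrite lee_fin /g indicE.
have [cyy|cyy] := pselect (cube n (d / 2) (y - cmap c p)%R); last first.
  by rewrite memNset// mulr0 mulr_ge0//; exact: chart_weight_ge0.
have [wy [Ay ccy]] := dB _ (inB _ cyy).
rewrite mem_set// mulr1 /chart_param /chart_weight asboolT// indicE mem_set// mul1r.
exact: ltW.
Qed.

End chart_integrals.

Section divergence_by_parts.
Variables (R : realType) (n : nat) (lam : {measure set (Borel 'rV[R]_n) -> \bar R}).
Hypothesis Hlam : integrates_rV lam.

Lemma derive_row_sum (f : 'rV[R]_n -> R) (b y : 'rV[R]_n) : differentiable f y ->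
  'D_b f y = \sum_i b 0 i * 'D_(delta_mx 0 i) f y.
Proof.
move=> df; apply: (etrans (deriveE _ df)); rewrite {1}(row_sum_delta b) linear_sum.
by apply: eq_bigr => i _; rewrite linearZ; congr (_ * _); exact: (esym (deriveE _ df)).
Qed.

Lemma derive_lin_comb (p : nat) (Z : 'rV[R]_n -> 'rV[R]_n) (q : 'I_p) (J : 'M[R]_(n, p)) b y :
  C1mx setT Z ->
  'D_b (fun z => (Z z *m J) 0 q) y = \sum_j J j q * 'D_b (fun z => Z z 0 j) y.
Proof.
move=> CZ.
have dZ : derivable Z y b by exact: (C1mx_derivable CZ I).
have [d E] := derivable_mulmx dZ (derivable_cst J y b).
have -> : 'D_b (fun z => (Z z *m J) 0 q) y = 'D_b (fun z => Z z *m J) y 0 q.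
  by rewrite (derive_mx d) [RHS]mxE.
rewrite E (derive_mx dZ) derive_cst mulmx0 addr0 mxE.
by apply: eq_bigr => j _; rewrite mulrC; congr (_ * _); rewrite mxE.
Qed.

(* Integrating by parts along a fixed frame [row a Q], with dual coordinates [J],
   only uses the values of [phi] along the frame directions. *)
Lemma divergence_by_parts (p : nat) (phi : 'rV[R]_n -> R) (Z : 'rV[R]_n -> 'rV[R]_n)
    (g : 'rV[R]_n -> R) (J : 'M[R]_(n, p)) (Q : 'M[R]_(p, n)) (y0 : 'rV[R]_n) (r t0 kap : R) :
  0 < t0 -> 0 <= kap -> 0 <= r ->
  measurable_fun setT (phi : Borel 'rV[R]_n -> R) -> (forall y, `|phi y| <= 1) ->
  C1mx setT Z -> (forall y, r < `|y - y0| -> Z y = 0) -> J *m Q = 1%:M ->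
  (forall y t a, 0 < t < t0 -> Z y <> 0 -> `|phi (y - t *: row a Q) - phi y| <= t * kap) ->
  measurable_fun setT (g : Borel 'rV[R]_n -> R) ->
  (forall y a, `|(Z y *m J) 0 a| <= g y) -> (forall y, 0 <= g y) ->
  lam.-integrable setT (fun y => (phi y * \sum_i 'D_(delta_mx 0 i) (fun z => Z z 0 i) y)%:E) /\
  (`| \int[lam]_y (phi y * \sum_i 'D_(delta_mx 0 i) (fun z => Z z 0 i) y)%:E | <=
  (p%:R * kap)%:E * \int[lam]_y (g y)%:E)%E.
Proof.
move=> t00 kap0 r0 mphi phi1 CZ Z0 JQ lip mg gZ g0.
pose W (a : 'I_p) y := (Z y *m J) 0 a.
have CW a : C1on setT (W a) by exact: (C1mx_mul openT CZ (C1mx_cst J openT)).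
have W0 a y : r < `|y - y0| -> W a y = 0 by move=> /Z0 E; rewrite /W E mul0mx mxE.
have lipW a y t : 0 < t < t0 -> W a y <> 0 -> `|phi (y - t *: row a Q) - phi y| <= t * kap.
  by move=> tt Wy; apply: lip => // E; apply: Wy; rewrite /W E mul0mx mxE.
have T a := translation_by_parts Hlam t00 kap0 r0 mphi phi1 (CW a) (@W0 a) (lipW a).
have cDi i j : continuous ('D_(delta_mx 0 i) (fun z => Z z 0 j)).
  by move=> y; exact: ((CZ 0 j).2 (delta_mx 0 i) y I).
have dZ j y : differentiable (fun z => Z z 0 j) y by exact: ((CZ 0 j).1 y I).
(* The divergence is the trace of the derivative, and [J *m Q = 1] allows it to be computed in the
   redundant frame. *)
have E y : \sum_i 'D_(delta_mx 0 i) (fun z => Z z 0 i) y = \sum_a 'D_(row a Q) (W a) y.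
  under [RHS]eq_bigr => a _.
    rewrite (derive_lin_comb _ _ _ _ CZ).
    under eq_bigr => j _ do rewrite (derive_row_sum _ (dZ j y)) mulr_sumr.
    over.
  rewrite exchange_big /=; apply: eq_bigr => j _; rewrite exchange_big /=.
  rewrite (bigD1 j)//= [X in _ = _ + X]big1 => [|i ij].
    rewrite addr0 -[LHS]mul1r; under [RHS]eq_bigr => a _ do rewrite mxE mulrA.
    rewrite -mulr_suml; congr (_ * _).
    by have := congr1 (fun A : 'M[R]_n => A j j) JQ; rewrite !mxE eqxx.
  under eq_bigr => a _ do rewrite mxE mulrA.
  rewrite -mulr_suml; have := congr1 (fun A : 'M[R]_n => A j i) JQ.
  by rewrite !mxE eq_sym (negPf ij) => ->; rewrite mul0r.
have F y : (phi y * \sum_i 'D_(delta_mx 0 i) (fun z => Z z 0 i) y)%:E =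
    \sum_a (phi y * 'D_(row a Q) (W a) y)%:E by rewrite E mulr_sumr sumEFin.
split.
  have -> : (fun y => (phi y * \sum_i 'D_(delta_mx 0 i) (fun z => Z z 0 i) y)%:E) =
      fun y => (\sum_a (phi y * 'D_(row a Q) (W a) y)%:E)%E.
    by apply/funext => y; exact: F.
  by apply: integrable_sum => // a _; exact: (T a).1.
under eq_integral => y _ do rewrite F.
rewrite integral_sum//; last by move=> a; exact: (T a).1.
apply: (le_trans (lee_abs_sum _ _ _)).
apply: (@le_trans _ _ (\sum_(a : 'I_p) (kap%:E * \int[lam]_y (g y)%:E)%E)).
  apply: lee_sum => a _; apply: (le_trans (T a).2).
  apply: lee_wpmul2l; first by rewrite lee_fin.
  apply: ge0_le_integral => //.
  - apply/measurable_EFinP; apply: measurableT_comp => //.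
    apply: continuous_measurable_borel => y; exact: (C1on_continuous (CW a) I).
  - exact/measurable_EFinP.
  - by move=> y _; rewrite lee_fin; exact: gZ.
rewrite big_const card_ord; move: (\int[lam]_y _)%E => K.
elim: p {J Q JQ lip gZ W CW W0 lipW T E F} => [|p IH] /=; first by rewrite mul0r mul0e.
rewrite -natr1 mulrDl mul1r EFinD ge0_muleDl ?lee_fin ?mulr_ge0//.
by rewrite addeC; exact: leeD2r.
Qed.

End divergence_by_parts.

Section continuity_on_manifold.
Variables (R : realType) (n : nat) (M : oriented_manifold R n) (x N : M -> 'rV[R]_n.+1).
Hypotheses (ex : embedding x) (uN : unit_normal x N).

Lemma continuous_charts (T : topologicalType) (f : M -> T) :
  (forall c y, atlas c -> ccod c y -> {for y, continuous (f \o cinv c)}) -> continuous f.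
Proof.
move=> H p; pose c := chart_at p.
have cp : cdom c p by exact: cdom_chart_at.
have h := H c _ (atlas_chart_at p) (cmap_ccod cp).
have hc := continuous_comp (cmap_continuous cp) h.
move=> A nA; have nA' : nbhs ((f \o cinv c \o cmap c) p) A by rewrite /= cmapK.
have h1 : \forall q \near p, A ((f \o cinv c \o cmap c) q) by exact: hc nA'.
have h2 : \forall q \near p, cdom c q by apply: open_nbhs_nbhs; split => //; exact: cdom_open.
have : \forall q \near p, A (f q).
  by near=> q; rewrite -(@cmapK _ _ _ c q); [near: q|near: q].
exact: id.
Unshelve. all: by end_near. Qed.

Lemma C1mx_continuous p q U (A : 'rV[R]_n -> 'M[R]_(p, q)) y : C1mx U A -> U y ->
  {for y, continuous A}.
Proof. by move=> CA Uy; apply: continuous_mx => i j; exact: (C1on_continuous (CA i j) Uy). Qed.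

Lemma continuous_smooth_map (f : M -> 'rV[R]_n.+1) : smooth_map f -> continuous f.
Proof.
move=> sf; apply: continuous_charts => c y ac cy.
by have [_ Cf _] := smooth_map_C2 sf ac; exact: C1mx_continuous Cf cy.
Qed.

Lemma continuous_amb_shape : continuous (amb_shape x N).
Proof.
have sx : smooth_map x by case: ex. have sN : smooth_map N by case: uN.
apply: continuous_charts => c y ac cy.
have [dX CX CX2] := smooth_map_C2 sx ac; have [dN CN CN2] := smooth_map_C2 sN ac.
have oU := @ccod_open _ _ _ c.
have [NN XN Jf] := chart_data ex uN ac.
have CJ := C1mx_jacobian oU dN CN2.
have CP := C1mx_pinv oU dX CX2 Jf.
have CA := C1mx_mul oU CP CJ.
have n1 : \forall z \near y, (amb_shape x N \o cinv c) z =
    - (pinv ('J (x \o cinv c) z) *m 'J (N \o cinv c) z).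
  apply: filterS (open_near oU cy) => z cz; have [dz zE] := cmap_cinv cz.
  by rewrite /= (amb_shapeE ex uN ac dz) /chart_shape /cjacobian zE.
have cA := C1mx_continuous CA cy.
apply: (near_eq_continuous n1); exact: (continuousN cA).
Qed.

Let cx : continuous x. Proof. by apply: continuous_smooth_map; case: ex. Qed.
Let cN : continuous N. Proof. by apply: continuous_smooth_map; case: uN. Qed.

Lemma continuous_tan_proj : continuous (tan_proj N).
Proof.
move=> p; have c1 := continuous_mulmx (continuous_trmx (@cN p)) (@cN p).
apply: continuous_mx => i j.
have -> : (fun q => tan_proj N q i j) = (fun q => 1%:M i j - ((N q)^T *m N q) i j :> R).
  by apply/funext => q; rewrite /tan_proj mxE [X in _ + X]mxE.
have c2 := @continuous_entry _ _ _ _ _ p i j c1.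
exact: (@continuousB _ _ _ (fun _ => 1%:M i j : R) _ p (@cst_continuous _ _ _ p) c2).
Qed.

Lemma continuous_traceless H : continuous (traceless x N H).
Proof.
move=> p; apply: (@continuousB _ _ _ (amb_shape x N) (fun q => H *: tan_proj N q)).
  exact: continuous_amb_shape.
apply: (@continuousZ _ _ _ (fun=> H) (tan_proj N)).
exact: cst_continuous. exact: continuous_tan_proj.
Qed.

Lemma continuous_field H : continuous (field x N H).
Proof. by move=> p; exact: (continuous_mulmx (@cx p) (@continuous_traceless H p)). Qed.

Lemma continuous_sum (T : topologicalType) (I : Type) (s : seq I) (F : I -> T -> R) t :
  (forall i, {for t, continuous (F i)}) -> {for t, continuous (fun u => \sum_(i <- s) F i u)}.
Proof.
move=> cF; elim: s => [|i s IH].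
  rewrite (_ : (fun _ => _) = cst 0); first exact: cst_continuous.
  by apply/funext => u; rewrite big_nil.
rewrite (_ : (fun _ => _) = F i \+ (fun u => \sum_(i <- s) F i u)).
  exact: continuousD (cF i) IH.
by apply/funext => u; rewrite big_cons.
Qed.

Lemma continuous_mxtrace (T : topologicalType) m (A : T -> 'M[R]_m) t :
  {for t, continuous A} -> {for t, continuous (fun s => \tr (A s))}.
Proof.
by move=> cA; apply: continuous_sum => i; exact: (continuous_entry cA).
Qed.

Lemma continuous_support_fun : continuous (support_fun x N).
Proof. by move=> p; exact: (continuous_dotv (@cx p) (@cN p)). Qed.

Lemma continuous_divergence H : continuous (divergence x N H).
Proof.
move=> p; apply: (@continuousM _ _ (support_fun x N) (defect x N H)).
  exact: continuous_support_fun.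
have cS := @continuous_amb_shape p.
have c1 := continuous_mxtrace (continuous_mulmx cS cS).
apply: (@continuousB _ _ _ (fun q => \tr (amb_shape x N q *m amb_shape x N q)) (fun=> n%:R * H ^+ 2)) => //.
exact: cst_continuous.
Qed.

Lemma continuous_derive_pair (T : topologicalType) m (f : 'rV[R]_m -> R) (u v : T -> 'rV[R]_m) t :
  C1on setT f -> {for t, continuous u} -> {for t, continuous v} ->
  {for t, continuous (fun s => 'D_(v s) f (u s))}.
Proof.
move=> Cf cu cv.
have -> : (fun s => 'D_(v s) f (u s)) = fun s => \sum_i v s 0 i * 'D_(delta_mx 0 i) f (u s).
  by apply/funext => s; rewrite (derive_row_sum _ (Cf.1 _ I)).
apply: continuous_sum => i.
apply: (@continuousM _ _ (fun s => v s 0 i) (fun s => 'D_(delta_mx 0 i) f (u s))).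
  exact: continuous_entry cv.
apply: (@continuous_comp _ _ _ u ('D_(delta_mx 0 i) f) _ cu); exact: (Cf.2 _ _ I).
Qed.

End continuity_on_manifold.

(** * Integration by parts in one chart of the manifold *)

Section chart_identities.
Variables (R : realType) (n : nat) (M : oriented_manifold R n) (x N : M -> 'rV[R]_n.+1).
Hypotheses (ex : embedding x) (uN : unit_normal x N).
Variable H : R.
Hypotheses (cmc : forall p, mean_curvature x N p = H) (n0 : (0 < n)%N).

(** The divergence on the manifold of the field multiplied by the restriction of [Psi]. *)
Definition stokes_term (Psi : 'rV[R]_n.+1 -> R) p :=
  Psi (x p) * divergence x N H p + 'D_(field x N H p) Psi (x p).

Lemma continuous_stokes_term Psi : C1on setT Psi -> continuous (stokes_term Psi).
Proof.
move=> CP p.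
have sx : smooth_map x by case: ex.
have cx : {for p, continuous x} by exact: (continuous_smooth_map sx).
have c1 : {for p, continuous (fun q => Psi (x q))}.
  apply: (@continuous_comp _ _ _ x Psi _ cx); exact: (C1on_continuous CP I).
have c2 := @continuous_divergence _ _ _ _ _ ex uN H p.
have c3 := continuous_derive_pair CP cx (@continuous_field _ _ _ _ _ ex uN H p).
exact: (continuousD (continuousM c1 c2) c3).
Qed.

Lemma derive_chain_row (Psi : 'rV[R]_n.+1 -> R) (X : 'rV[R]_n -> 'rV[R]_n.+1) y i :
  C1on setT Psi -> differentiable X y ->
  differentiable (fun z => Psi (X z)) y /\
  'D_(delta_mx 0 i) (fun z => Psi (X z)) y =
    \sum_k 'J X y i k * 'D_(delta_mx 0 k) Psi (X y).
Proof.
move=> CP dX; have dP : differentiable Psi (X y) by exact: (CP.1 _ I).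
have dC : differentiable (Psi \o X) y by exact: differentiable_comp.
split; first exact: dC.
apply: (etrans (deriveE _ dC)); rewrite diff_comp//=.
have -> : 'd X y (delta_mx 0 i : 'rV[R]_n) = row i ('J X y).
  by rewrite -(deriveE _ dX) (deriveEjacobian _ dX) rowE.
rewrite -(deriveE _ dP) (derive_row_sum _ dP).
by apply: eq_bigr => k _; congr (_ * _); rewrite mxE.
Qed.

Lemma C1on_comp_chart (Psi : 'rV[R]_n.+1 -> R) (X : 'rV[R]_n -> 'rV[R]_n.+1) U :
  open U -> C1on setT Psi -> (forall y, U y -> differentiable X y) -> C1mx U X ->
  (forall v, C1mx U ('D_v X)) -> C1on U (fun z => Psi (X z)).
Proof.
move=> oU CP dX CX CX2.
have dC y : U y -> differentiable (fun z => Psi (X z)) y.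
  move=> Uy; apply: (@differentiable_comp _ _ _ _ X Psi); first exact: dX.
  exact: (CP.1 _ I).
apply: (@C1on_intro _ _ _ _ (fun v y => 'D_('D_v X y) Psi (X y))) => //.
- move=> v y Uy; apply: (etrans (deriveE _ (dC y Uy))).
  rewrite (@diff_comp _ _ _ _ X Psi _ (dX y Uy) (CP.1 _ I)) /=.
  by rewrite -(deriveE _ (dX y Uy)) -(deriveE _ (CP.1 _ I)).
- move=> v y Uy; apply: (continuous_derive_pair CP); first exact: (C1mx_continuous CX Uy).
  exact: (C1mx_continuous (CX2 v) Uy).
Qed.

Lemma chart_stokes_identity c y Psi : atlas c -> ccod c y -> C1on setT Psi ->
  \sum_i 'D_(delta_mx 0 i) (fun z => Psi ((x \o cinv c) z) *
      (vol_density (x \o cinv c) z * chart_field (x \o cinv c) (N \o cinv c) H z 0 i)) y =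
  vol_density (x \o cinv c) y * stokes_term Psi (cinv c y).
Proof.
move=> ac cy CP.
have sx : smooth_map x by case: ex. have sN : smooth_map N by case: uN.
have [dX CX CX2] := smooth_map_C2 sx ac; have [dN CN CN2] := smooth_map_C2 sN ac.
have [NN XN Jf] := chart_data ex uN ac.
have oU := @ccod_open _ _ _ c.
have T := fun y cy => @chart_trace _ _ _ _ _ ex uN _ cmc n0 c y ac cy.
have CV := C1mx_chart_field H oU dX CX CX2 dN CN2 Jf.
have Cw := C1on_vol_density oU dX CX2 NN XN Jf.
have FE := chart_field_jacobian ex uN H ac cy.
have DE := chart_divergence ex uN cmc n0 ac cy.
move: CV Cw FE DE; set V := chart_field _ _ _; set w := vol_density _; set X := x \o cinv c.
move=> CV Cw FE DE.
have dv i : derivable (fun z => w z * V z 0 i) y (delta_mx 0 i : 'rV[R]_n).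
  exact: (C1on_derivable (C1onM oU Cw (CV 0 i)) cy).
have S i : 'D_(delta_mx 0 i) (fun z => Psi (X z) * (w z * V z 0 i)) y =
    Psi (X y) * 'D_(delta_mx 0 i) (fun z => w z * V z 0 i) y +
    (w y * V y 0 i) * \sum_k 'J X y i k * 'D_(delta_mx 0 k) Psi (X y).
  have [dP E] := derive_chain_row i CP (dX y cy).
  apply: (etrans (deriveM (diff_derivable dP) (dv i))); congr (_ + _).
  by apply: (etrans _ (congr2 *%R (erefl (w y * V y 0 i)) E)).
rewrite (eq_bigr _ (fun i _ => S i)) big_split /= -mulr_sumr DE.
have -> : \sum_i (w y * V y 0 i) * (\sum_k 'J X y i k * 'D_(delta_mx 0 k) Psi (X y)) =
   w y * 'D_(field x N H (cinv c y)) Psi (X y).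
  rewrite -FE (derive_row_sum _ (CP.1 _ I)) mulr_sumr.
  under eq_bigr => i _ do rewrite mulr_sumr.
  rewrite exchange_big /=; apply: eq_bigr => k _; rewrite [X in _ = _ * (X * _)]mxE.
  move: ('D__ Psi _) => a; rewrite mulr_suml mulr_sumr; apply: eq_bigr => i _.
  by move: ('J _ _ _ _) (w y) (V y 0 i) => j u v; ring.
rewrite /stokes_term /X /=.
by move: (Psi _) (w y) (divergence _ _ _ _) ('D__ _ _) => a u b d; ring.
Qed.

Lemma tan_proj_norm p : `|tan_proj N p| <= 2.
Proof.
have [_ uNp _] := uN.
apply: mx_norm_le => // i j; rewrite /tan_proj mxE [X in _ + X]mxE.
apply: (le_trans (ler_normB _ _)); apply: (@le_trans _ _ (1 + 1)); last by rewrite -[2]/(1 + 1).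
apply: lerD; first by rewrite mxE; case: (i == j); rewrite ?normr1 ?normr0.
rewrite mxE big_ord_recl big_ord0 addr0 mxE normrM -[leRHS]mul1r.
by apply: ler_pM => //; apply: (le_trans (entry_le_enorm _ _)); rewrite uNp.
Qed.

(** At [y0] both products are the tangential projection, whose norm is at most 2, and continuity
    leaves room up to 3. The bound is the same for all [p0]. The radius [2 * d] leaves room for
    translating points at distance less than [d]. *)
Lemma chart_frame p0 (c := chart_at p0) (y0 := cmap c p0) (J0 := cjacobian x c p0) :
  exists2 d : R, 0 < d & forall y, `|y - y0| < 2 * d ->
  [/\ ccod c y, `|pinv J0 *m 'J (x \o cinv c) y| <= 3 & `|pinv ('J (x \o cinv c) y) *m J0| <= 3].
Proof.
have ac : atlas c by exact: atlas_chart_at.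
have cp : cdom c p0 by exact: cdom_chart_at.
have cy : ccod c y0 by exact: cmap_ccod.
have sx : smooth_map x by case: ex.
have [dX CX CX2] := smooth_map_C2 sx ac.
have [NN XN Jf] := chart_data ex uN ac.
have oU := @ccod_open _ _ _ c.
have CJ := C1mx_jacobian oU dX CX2.
have CP := C1mx_pinv oU dX CX2 Jf.
have P0 : pinv J0 *m J0 = tan_proj N p0 by exact: (tan_projE ex uN ac cp).
have cj := C1mx_continuous CJ cy; have cpj := C1mx_continuous CP cy.
have c1 := continuous_mulmx (@cst_continuous _ _ (pinv J0) y0) cj.
have c2 := continuous_mulmx cpj (@cst_continuous _ _ J0 y0).
have near3 (A : 'rV[R]_n -> 'M[R]_n.+1) : {for y0, continuous A} -> `|A y0| <= 2 ->
    \forall y \near y0, `|A y| <= 3.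
  move=> cA A2; have /cvgrPdist_le/(_ 1 ltr01) := cA; apply: filterS => y h.
  have -> : A y = A y0 - (A y0 - A y) by rewrite opprB addrC subrK.
  apply: (le_trans (ler_normB _ _)); apply: (le_trans (lerD A2 h)).
  by rewrite -(natrD R 2 1).
have t2 := tan_proj_norm p0.
have n1 : \forall y \near y0, `|pinv J0 *m 'J (x \o cinv c) y| <= 3.
  by apply: near3; [exact: c1|rewrite -P0 in t2; exact: t2].
have n2 : \forall y \near y0, `|pinv ('J (x \o cinv c) y) *m J0| <= 3.
  by apply: near3; [exact: c2|rewrite -P0 in t2; exact: t2].
have n3 : nbhs y0 ([set y | ccod c y] `&` ([set y | `|pinv J0 *m 'J (x \o cinv c) y| <= 3] `&`
    [set y | `|pinv ('J (x \o cinv c) y) *m J0| <= 3])).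
  by apply: filterI (open_near oU cy) _; exact: filterI n1 n2.
have [e /= e0 eB] := (nbhs_ballP _ _).1 n3.
exists (e / 2); first by rewrite divr_gt0.
move=> y; rewrite mulrC divfK// => h.
have : ball y0 e y by rewrite -ball_normE /= distrC; exact: h.
move=> /eB [h1 [h2 h3]]; split; [exact: h1|exact: h2|exact: h3].
Qed.

End chart_identities.

Lemma open_far (R : realType) (n : nat) (y0 : 'rV[R]_n) (d : R) : open [set y | d < `|y - y0|].
Proof.
rewrite openE => y /= dy; apply/nbhs_ballP; exists (`|y - y0| - d); first by rewrite /= subr_gt0.
move=> z; rewrite -ball_normE /= ltrBrDl => h.
by rewrite -(ltrD2r `|y - z|); apply: (lt_le_trans h); rewrite [leRHS]addrC; exact: ler_distD.
Qed.

Lemma derive_near0 (R : realType) (V : normedModType R) (f : V -> R) y v :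
  (\forall z \near y, f z = 0) -> 'D_v f y = 0.
Proof.
move=> h; apply: (@etrans _ _ ('D_v (cst 0 : V -> R) y)); last exact: derive_cst.
exact: near_eq_derive.
Qed.

Lemma enorm_row_mul_le (R : realType) (p n m : nat) (a : 'I_p) (Q : 'M[R]_(p, n))
    (J : 'M[R]_(n, m)) (t B : R) : 0 <= t -> `|Q *m J| <= B ->
  enorm (- (t *: row a Q) *m J) <= t * (B * m%:R).
Proof.
move=> t0 QB; rewrite mulNmx -scalemxAl -row_mul -scaleNr enormZ normrN (ger0_norm t0).
rewrite ler_wpM2l// mulrC; apply: (le_trans (enorm_le_mx_norm _)).
rewrite ler_wpM2l//; apply: le_trans QB; apply: mx_norm_le => // i j.
by rewrite [row _ _ _ _]mxE; exact: mx_entry_le.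
Qed.

Section chart_stokes.
Variables (R : realType) (n : nat) (M : oriented_manifold R n) (x N : M -> 'rV[R]_n.+1).
Variable mu : {measure set (Borel M) -> \bar R}.
Hypotheses (ex : embedding x) (uN : unit_normal x N) (rv : riemannian_volume x mu).
Variable lam : {measure set (Borel 'rV[R]_n) -> \bar R}.
Hypothesis Hlam : integrates_rV lam.
Variable H : R.
Hypotheses (cmc : forall p, mean_curvature x N p = H) (n0 : (0 < n)%N).

(** The number of frame directions, times the displacement on the manifold per unit of translation
    ([cut_field_lip]), times the bound on the frame coordinates ([cut_field_coord]). *)
Definition stokes_const : R := (n.+1%:R * (6 * n.+1%:R)) * (3 * n.+1%:R).

Lemma stokes_const_ge0 : 0 <= stokes_const.
Proof. by rewrite !mulr_ge0. Qed.

Section localized.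
Variables (p0 : M) (Psi : 'rV[R]_n.+1 -> R) (d : R).
Let c := chart_at p0.
Let X := x \o cinv c.
Let y0 := cmap c p0.
Let J0 := 'J X y0.
Let Q0 := pinv J0.
Hypotheses (d0 : 0 < d) (CP : C1on setT Psi) (Psi0 : forall z, 0 <= Psi z).
Hypothesis frame : forall y, `|y - y0| < 2 * d ->
  [/\ ccod c y, `|Q0 *m 'J X y| <= 3 & `|pinv ('J X y) *m J0| <= 3].
Hypothesis supp : forall p, ~ (cdom c p /\ `|cmap c p - y0| < d) ->
  \forall z \near x p, Psi z = 0.

Let ac : atlas c. Proof. exact: atlas_chart_at. Qed.
Let w := vol_density X.
Let V := chart_field X (N \o cinv c) H.

(** The Riemannian divergence is the Euclidean divergence of the field multiplied by the volume
    density, divided by that density; hence the factor [w]. *)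
Definition cut_field (y : 'rV[R]_n) : 'rV[R]_n :=
  if `[< ccod c y >] then (Psi (X y) * w y) *: V y else 0.

Lemma cut_field0 y : d <= `|y - y0| -> cut_field y = 0.
Proof.
move=> dy; rewrite /cut_field; case: asboolP => // cy; have [dc yE] := cmap_cinv cy.
have n1 : \forall z \near x (cinv c y), Psi z = 0.
  by apply: supp => -[_]; rewrite yE ltNge dy.
by have -> : Psi (X y) = 0 by [exact: nbhs_singleton n1]; rewrite mul0r scale0r.
Qed.

Lemma cut_fieldE i y : ccod c y -> cut_field y 0 i = Psi (X y) * (w y * V y 0 i).
Proof. by move=> cy; rewrite /cut_field asboolT// mxE mulrA. Qed.

(** The codomain of the chart and the exterior of the closed ball of radius [d] are open and cover
    the space; on the second one the field is 0. *)
Lemma C1mx_cut_field : C1mx setT cut_field.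
Proof.
move=> i0 j; rewrite (ord1 i0).
have sx : smooth_map x by case: ex. have sN : smooth_map N by case: uN.
have [dX CX CX2] := smooth_map_C2 sx ac; have [dN CN CN2] := smooth_map_C2 sN ac.
have [NN XN Jf] := chart_data ex uN ac.
have oU := @ccod_open _ _ _ c.
have CV := C1mx_chart_field H oU dX CX CX2 dN CN2 Jf.
have Cw := C1on_vol_density oU dX CX2 NN XN Jf.
have CPX := C1on_comp_chart oU CP dX CX CX2.
have CU : C1on (ccod c) (fun y => cut_field y 0 j).
  apply: (C1on_eq oU _ (C1onM oU CPX (C1onM oU Cw (CV 0 j)))) => y cy; exact: cut_fieldE.
have CO : C1on [set y | d < `|y - y0|] (fun y => cut_field y 0 j).
  have C0 := C1on_cst (0 : R) (@open_far R n y0 d).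
  apply: (C1on_eq (@open_far R n y0 d) _ C0) => y /= dy.
  by rewrite cut_field0 ?mxE// ltW.
have far y : ~ ccod c y -> d < `|y - y0|.
  move=> ncy; rewrite ltNge; apply/negP => dy; apply: ncy.
  by have [] := frame (le_lt_trans dy _); rewrite ?mulr_natl ?mulr2n ?ltrDl.
split=> [y _|v y _].
- have [cy|/far dy] := pselect (ccod c y); [exact: CU.1|exact: CO.1].
- have [cy|/far dy] := pselect (ccod c y); [exact: CU.2|exact: CO.2].
Qed.

Lemma divergence_cut_field y :
  \sum_i 'D_(delta_mx 0 i) (fun z => cut_field z 0 i) y =
  stokes_term x N H Psi (chart_param c y) * chart_weight x c y.
Proof.
rewrite /chart_param /chart_weight; case: asboolP => cy; last first.
  rewrite mulr0 big1// => i _; apply: derive_near0.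
  have dy : d < `|y - y0|.
    rewrite ltNge; apply/negP => dy; apply: cy.
    by have [] := frame (le_lt_trans dy _); rewrite ?mulr_natl ?mulr2n ?ltrDl.
  apply: filterS (open_near (@open_far R n y0 d) dy) => z /= dz.
  by rewrite cut_field0 ?mxE// ltW.
rewrite mulrC -(chart_stokes_identity ex uN cmc n0 ac cy CP).
apply: eq_bigr => i _; apply: near_eq_derive.
apply: filterS (open_near (@ccod_open _ _ _ c) cy) => z cz; exact: cut_fieldE.
Qed.

(** Pushing the coordinates forward by [J0] instead of the Jacobian at [y] multiplies the ambient
    field by [pinv ('J X y) *m J0], which is controlled by [frame]. *)
Lemma cut_field_coord y a : `|(cut_field y *m J0) 0 a| <=
  (3 * n.+1%:R) * (Psi (x (chart_param c y)) * enorm (field x N H (chart_param c y)))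
    * chart_weight x c y.
Proof.
have [dy|dy] := leP d `|y - y0|.
  rewrite cut_field0// mul0mx mxE normr0 mulr_ge0 ?mulr_ge0 ?enorm_ge0//.
  exact: (chart_weight_ge0 ex uN ac).
have [cy _ B] : [/\ ccod c y, `|Q0 *m 'J X y| <= 3 & `|pinv ('J X y) *m J0| <= 3].
  by apply: frame; apply: (lt_trans dy); rewrite mulr_natl mulr2n ltrDl.
have [NN XN Jf] := chart_data ex uN ac.
have w0 : 0 < w y by exact: (vol_density_gt0 NN XN Jf cy).
have FE := chart_field_jacobian ex uN H ac cy.
have JP := mul_pinv (Jf y cy).
rewrite /cut_field /chart_param /chart_weight asboolT// -scalemxAl.
have -> : V y *m J0 = field x N H (cinv c y) *m (pinv ('J X y) *m J0).
  rewrite -FE -[RHS]mulmxA; congr (_ *m _).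
  by rewrite mulmxA JP mul1mx.
rewrite mxE normrM ger0_norm; last by rewrite mulr_ge0// ltW.
rewrite -/w -/X; move: (field _ _ _ _) (pinv _ *m _) B => f K B.
have h : `|(f *m K) 0 a| <= n.+1%:R * enorm f * 3.
  apply: (le_trans (mx_entry_le _ _ _)); apply: (le_trans (mx_norm_mul _ _)).
  apply: ler_pM => //.
  by rewrite ler_wpM2l// mx_norm_le_enorm.
have P0 : 0 <= Psi (X y) * w y by rewrite mulr_ge0// ltW.
apply: (le_trans (ler_wpM2l P0 h)); rewrite /X /=.
by move: (Psi _) (w y) (enorm _) => P u e; rewrite le_eqVlt; apply/orP; left; apply/eqP; ring.
Qed.

(** The translation segment has length at most [t * (3 * n.+1%:R)] on the manifold; the constant is
    doubled to make the distance bound strict. The bound on [t] keeps the segment where [frame]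
    applies. *)
Lemma cut_field_lip (phi : M -> R) (eps : R) y t a : 0 <= eps ->
  (forall p q b, dlt x p q b -> `|phi p - phi q| <= eps * b) ->
  0 < t < d / (1 + `|Q0|) -> cut_field y <> 0 ->
  `|phi (chart_param c (y - t *: row a Q0)) - phi (chart_param c y)| <=
    t * (eps * (6 * n.+1%:R)).
Proof.
move=> e0 lip /andP[t0 tt] Zy.
have dy : `|y - y0| < d.
  by rewrite ltNge; apply/negP => dy; apply: Zy; exact: cut_field0.
pose y' := y - t *: row a Q0.
have rQ : `|row a Q0| <= `|Q0|.
  by apply: mx_norm_le => // i j; rewrite mxE; exact: mx_entry_le.
have td : t * `|row a Q0| <= d.
  apply: (@le_trans _ _ (t * (1 + `|Q0|))).
    by rewrite ler_wpM2l ?(ltW t0)//; apply: (le_trans rQ); rewrite lerDr.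
  by rewrite -ler_pdivlMr ?(ltW tt)// ltr_pwDl.
have yy : y' - y = - (t *: row a Q0) by rewrite /y' addrC addKr.
have seg (s : R) : 0 <= s <= 1 -> `|s *: (y' - y) + y - y0| < 2 * d.
  move=> /andP[s0 s1].
  have -> : s *: (y' - y) + y - y0 = (y - y0) - (s * t) *: row a Q0.
    by rewrite yy scalerN scalerA [X in X - y0]addrC addrAC.
  apply: (le_lt_trans (ler_normB _ _)); rewrite mulr_natl mulr2n ltr_leD//.
  rewrite normrZ ger0_norm ?mulr_ge0 ?(ltW t0)// -mulrA; apply: le_trans td.
  by rewrite ler_piMl// mulr_ge0// ltW.
have D : dlt x (cinv c y) (cinv c y') (t * (6 * n.+1%:R)).
  apply: (dlt_segment ex (Lam := t * (3 * n.+1%:R)) ac); last first.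
    by rewrite ltr_pM2l// ltr_pM2r// ltr_nat.
  move=> s /seg/frame[cs B _]; split; first exact: cs.
  rewrite yy in B *; exact: (enorm_row_mul_le a (ltW t0) B).
have c0 : ccod c y.
  have [] := frame (lt_trans dy _) => //; by rewrite mulr_natl mulr2n ltrDl.
have c1 : ccod c y'.
  have h := seg 1; rewrite scale1r subrK in h.
  by have [] := frame (h _) => //; rewrite ler01 lexx.
rewrite /chart_param !asboolT// distrC; apply: (le_trans (lip _ _ _ D)).
by rewrite mulrCA.
Qed.

End localized.

Local Open Scope ereal_scope.

Lemma chart_stokes p0 : exists2 rho : R, (0 < rho)%R & forall (Psi : 'rV[R]_n.+1 -> R) (phi : M -> R) eps,
  C1on setT Psi -> (forall z, 0 <= Psi z)%R ->
  (forall p, (rho <= `|x p - x p0|)%R -> \forall z \near x p, Psi z = 0%R) ->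
  measurable_fun setT (phi : Borel M -> R) -> (forall p, `|phi p| <= 1)%R -> (0 <= eps)%R ->
  (forall p q b, dlt x p q b -> `|phi p - phi q| <= eps * b)%R ->
  mu.-integrable setT (fun p => (phi p * stokes_term x N H Psi p)%:E) /\
  `| \int[mu]_p (phi p * stokes_term x N H Psi p)%:E | <=
    (stokes_const * eps)%:E * \int[mu]_p (Psi (x p) * enorm (field x N H p))%:E.
Proof.
have ac : atlas (chart_at p0) by exact: atlas_chart_at.
have cp : cdom (chart_at p0) p0 by exact: cdom_chart_at.
have [d d0 frame] := chart_frame ex uN p0.
set c := chart_at p0 in ac cp frame; set y0 := cmap c p0 in frame.
have nA : nbhs p0 [set p | cdom c p /\ `|cmap c p - y0| < d]%R.
  apply: filterI; first by apply: open_nbhs_nbhs; split => //; exact: cdom_open.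
  have /cvgrPdist_lt/(_ _ d0) := cmap_continuous cp.
  by apply: filterS => p; rewrite distrC.
(* The embedding allows the support to be prescribed by an ambient distance, so that test functions
   can be taken on the ambient space. *)
have [B nB BA] := embedding_nbhs ex nA.
have [rho /= rho0 rB] := (nbhs_ballP _ _).1 nB.
exists rho => // Psi phi eps CP Psi0 far mphi phi1 eps0 lip.
have supp p : ~ (cdom c p /\ `|cmap c p - y0| < d)%R -> \forall z \near x p, Psi z = 0%R.
  move=> nAp; apply: far; rewrite leNgt; apply/negP => h; apply: nAp; apply: BA; apply: rB.
  by rewrite -ball_normE /= distrC.
have P0 p : ~ cdom c p -> Psi (x p) = 0%R.
  by move=> ncp; have := supp p (fun h => ncp h.1) => /nbhs_singleton.
have st0 p : ~ cdom c p -> stokes_term x N H Psi p = 0%R.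
  move=> ncp; rewrite /stokes_term P0// mul0r add0r; apply: derive_near0.
  by apply: supp => -[].
pose Z := cut_field p0 Psi.
pose phi' y := phi (chart_param c y).
pose Q := pinv ('J (x \o cinv c) y0).
have [NN XN Jf] := chart_data ex uN ac.
have JQ : 'J (x \o cinv c) y0 *m Q = 1%:M by exact: (mul_pinv (Jf y0 (cmap_ccod cp))).
have t00 : (0 < d / (1 + `|Q|))%R by rewrite divr_gt0// ltr_pwDl.
have kap0 : (0 <= eps * (6 * n.+1%:R))%R by rewrite !mulr_ge0.
have mcp := measurable_chart_param c.
have mphi' : measurable_fun setT (phi' : Borel 'rV[R]_n -> R) by exact: measurableT_comp mphi mcp.
have phi1' y : (`|phi' y| <= 1)%R by exact: phi1.
have CZ : C1mx setT Z by exact: (C1mx_cut_field d0 CP frame supp).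
have Z0 y : (d < `|y - y0|)%R -> Z y = 0%R by move=> /ltW dy; exact: (cut_field0 supp dy).
have lipZ y t a : (0 < t < d / (1 + `|Q|))%R -> Z y <> 0%R ->
    (`|phi' (y - t *: row a Q) - phi' y| <= t * (eps * (6 * n.+1%:R)))%R.
  by move=> tt Zy; exact: (cut_field_lip d0 frame supp a eps0 lip tt Zy).
pose G p := (3 * n.+1%:R * (Psi (x p) * enorm (field x N H p)))%R.
have sx : smooth_map x by case: ex.
have cPx : continuous (fun p => Psi (x p)).
  move=> p; apply: (@continuous_comp _ _ _ x Psi); first exact: (continuous_smooth_map sx).
  exact: (C1on_continuous CP I).
have cPf : continuous (fun p => Psi (x p) * enorm (field x N H p))%R.
  move=> p; apply: (@continuousM _ _ (fun p => Psi (x p)) (fun p => enorm (field x N H p)) _ (cPx p)).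
  apply: continuous_enorm; exact: (continuous_field ex uN).
have mPf : measurable_fun setT ((fun p => Psi (x p) * enorm (field x N H p))%R : Borel M -> R).
  exact: continuous_measurable_borel.
have mG : measurable_fun setT (G : Borel M -> R) by exact: measurable_funM.
have mw := measurable_chart_weight ex uN ac.
pose g y := (G (chart_param c y) * chart_weight x c y)%R.
have mg : measurable_fun setT (g : Borel 'rV[R]_n -> R).
  exact: (measurable_funM (measurableT_comp mG mcp) mw).
have gZ y a : (`|(Z y *m 'J (x \o cinv c) y0) 0 a| <= g y)%R.
  exact: (cut_field_coord d0 Psi0 frame supp).
have g0 y : (0 <= g y)%R by rewrite !mulr_ge0 ?enorm_ge0//; exact: (chart_weight_ge0 ex uN ac).
have [I1 I2] := divergence_by_parts Hlam t00 kap0 (ltW d0) mphi' phi1' CZ Z0 JQ lipZ mg gZ g0.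
pose F p := (phi p * stokes_term x N H Psi p)%R.
have mF : measurable_fun setT (F : Borel M -> R).
  apply: measurable_funM => //; apply: continuous_measurable_borel.
  exact: (continuous_stokes_term ex uN).
have F0 p : ~ cdom c p -> F p = 0%R by move=> /st0; rewrite /F => ->; rewrite mulr0.
have FE y : (phi' y * \sum_i 'D_(delta_mx 0 i) (fun z => Z z 0 i) y = F (chart_param c y) * chart_weight x c y)%R.
  rewrite (divergence_cut_field d0 CP frame supp) mulrA; exact: erefl.
have IF : \int[mu]_p (F p)%:E = \int[lam]_y (phi' y * \sum_i 'D_(delta_mx 0 i) (fun z => Z z 0 i) y)%:E.
  rewrite (chart_integral ex uN rv Hlam ac mF F0).
  by apply: eq_integral => y _; rewrite FE.
split.
  apply/integrableP; split; first exact/measurable_EFinP.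
  have -> : \int[mu]_p `|(F p)%:E| = \int[lam]_y `|(phi' y * \sum_i 'D_(delta_mx 0 i) (fun z => Z z 0 i) y)%:E|.
    transitivity (\int[mu]_p (`|F p|%R)%:E); first by apply: eq_integral.
    rewrite (@chart_integral _ _ _ _ _ _ ex uN rv _ Hlam _ ac (fun p => `|F p|%R)).
    - apply: eq_integral => y _; rewrite FE abse_EFin [in RHS]normrM.
      by rewrite (ger0_norm (chart_weight_ge0 ex uN ac y)).
    - exact: measurableT_comp.
    - by move=> p /F0 ->; rewrite normr0.
  by have /integrableP[] := I1.
rewrite IF; apply: (le_trans I2).
have -> : \int[lam]_y (g y)%:E = \int[mu]_p (G p)%:E.
  rewrite (chart_integral ex uN rv Hlam ac mG)// => p ncp.
  by rewrite /G P0// mul0r mulr0.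
have mPfE : measurable_fun setT (fun p : Borel M => (Psi (x p) * enorm (field x N H p))%:E).
  exact/measurable_EFinP.
have -> : \int[mu]_p (G p)%:E = (3 * n.+1%:R)%:E * \int[mu]_p (Psi (x p) * enorm (field x N H p))%:E.
  rewrite -(ge0_integralZl mu measurableT mPfE) ?lee_fin ?mulr_ge0//.
  by move=> p _; rewrite lee_fin mulr_ge0// enorm_ge0.
rewrite muleA -EFinM /stokes_const le_eqVlt; apply/orP; left; apply/eqP; congr (_%:E * _); ring.
Qed.

End chart_stokes.

Lemma C1on_dotv_sub (R : realType) (m : nat) (z0 : 'rV[R]_m) :
  C1on setT (fun z : 'rV[R]_m => dotv (z - z0) (z - z0)).
Proof.
have oT : open [set: 'rV[R]_m] by exact: openT.
have C1 : C1mx setT (fun z : 'rV[R]_m => z - z0).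
  apply: (differentiable_C1mx oT) => [y _|v y _].
    by [].
  have -> : 'D_v (fun z : 'rV[R]_m => z - z0) = fun=> v.
    apply/funext => z; apply: (@derive_val _ _ _ _ _ (fun z : 'rV[R]_m => z - z0)).
    have := @is_deriveB _ _ _ (id : 'rV[R]_m -> 'rV[R]_m) (cst z0) z v v 0
      (is_derive_id _ _) (is_derive_cst _ _ _).
    by rewrite subr0.
  exact: cst_continuous.
exact: (C1mx_mul oT C1 (C1mx_tr oT C1) 0 0).
Qed.

Lemma bump_exists (R : realType) (m : nat) (z0 : 'rV[R]_m) (rho : R) : 0 < rho ->
  exists eta : 'rV[R]_m -> R, [/\ C1on setT eta, forall z, 0 <= eta z <= 1,
    forall z, rho <= `|z - z0| -> \forall y \near z, eta y = 0 &
    \forall z \near z0, eta z = 1].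
Proof.
move=> rho0; pose s := rho ^+ 2 / 3.
have s0 : 0 < s by rewrite divr_gt0// exprn_gt0.
pose q (z : 'rV[R]_m) := dotv (z - z0) (z - z0).
have Cq : C1on setT q by exact: C1on_dotv_sub.
have cq (z : 'rV[R]_m) : {for z, continuous q} by exact: (C1on_continuous Cq I).
have oT : open [set: 'rV[R]_m] by exact: openT.
pose f z := 2 - s^-1 * q z.
have Cf : C1on setT f by exact: (C1onB oT (C1on_cst _ oT) (C1onM oT (C1on_cst _ oT) Cq)).
exists (fun z => smoothstep (f z)); split.
- apply: (C1on_comp oT Cf) => y _.
    by have [] := is_derive_smoothstep (f y).
  have -> : derive1 (@smoothstep R) = @dsmoothstep R.
    by apply/funext => t; exact: (is_derive1_val (is_derive_smoothstep t)).
  exact: continuous_dsmoothstep.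
- by move=> z; rewrite smoothstep_ge0 smoothstep_le1.
- move=> z rz.
  have qz : 2 * s < q z.
    apply: (@lt_le_trans _ _ (rho ^+ 2)).
      rewrite /s mulrCA -[ltRHS]mulr1 ltr_pM2l ?exprn_gt0// ltr_pdivrMr// mul1r.
      by rewrite (ltr_nat R 2 3).
    rewrite /q -sqr_enorm ler_pXn2r ?nnegrE ?enorm_ge0 ?(ltW rho0)//.
    exact: (le_trans rz (mx_norm_le_enorm _)).
  have n1 : \forall y \near z, 2 * s < q y by exact: (cvgr_gt _ (cq z)).
  apply: filterS n1 => y qy; apply: smoothstep_le0.
  by rewrite /f subr_le0 mulrC ler_pdivlMr// ltW.
- have q0 : q z0 < s by rewrite /q subrr /dotv mul0mx mxE.
  have n1 : \forall y \near z0, q y < s by exact: (cvgr_lt _ (cq z0)).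
  apply: filterS n1 => y qy; apply: smoothstep_ge1.
  rewrite /f lerBrDl -lerBrDr; have -> : 2 - 1 = 1 :> R by ring.
  by rewrite mulrC ler_pdivrMr// mul1r ltW.
Qed.

(** * From charts to compact supports by a partition of unity *)

Section global_stokes.
Variables (R : realType) (n : nat) (M : oriented_manifold R n) (x N : M -> 'rV[R]_n.+1).
Variable mu : {measure set (Borel M) -> \bar R}.
Hypotheses (ex : embedding x) (uN : unit_normal x N) (rv : riemannian_volume x mu).
Variable H : R.
Hypotheses (cmc : forall p, mean_curvature x N p = H) (n0 : (0 < n)%N).

Let cx : continuous x.
Proof. by apply: continuous_smooth_map; case: ex. Qed.
Local Open Scope ereal_scope.

(** For nonnegative weights this bound is stable under sums with the same constant: the integrand on
    the left and the integral on the right are additive in [Theta]. *)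
Definition stokes_bound (phi : M -> R) (eps : R) (Theta : 'rV[R]_n.+1 -> R) :=
  mu.-integrable setT (fun p => (phi p * stokes_term x N H Theta p)%:E) /\
  `| \int[mu]_p (phi p * stokes_term x N H Theta p)%:E | <=
    (stokes_const R n * eps)%:E * \int[mu]_p (Theta (x p) * enorm (field x N H p))%:E.

Definition cutoff (phi : M -> R) (eps : R) :=
  [/\ measurable_fun setT (phi : Borel M -> R), (forall p, `|phi p| <= 1)%R, (0 <= eps)%R &
      forall p q b, dlt x p q b -> (`|phi p - phi q| <= eps * b)%R].

Lemma local_stokes (p0 : M) : exists eta : 'rV[R]_n.+1 -> R,
  [/\ C1on setT eta, forall z, (0 <= eta z <= 1)%R,
   \forall q \near p0, \forall z \near x q, eta z = 1%R &
   forall Theta phi eps, C1on setT Theta -> (forall z, 0 <= Theta z)%R -> cutoff phi eps ->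
     stokes_bound phi eps (fun z => Theta z * eta z)%R].
Proof.
have [lam Hlam] := lebesgue_rV_exists R n.
have [rho rho0 S] := chart_stokes ex uN rv Hlam cmc n0 p0.
have [eta [Ce e01 efar enear]] := bump_exists (x p0) rho0.
exists eta; split=> //.
  have n1 : \forall z \near x p0, \forall y \near z, eta y = 1%R.
    exact: (nbhs_interior enear).
  exact: (@cx p0 _ n1).
move=> Theta phi eps CT T0 [mphi phi1 eps0 lip].
apply: (S _ _ _ _ _ _ mphi phi1 eps0 lip).
- exact: (C1onM openT CT Ce).
- by move=> z; rewrite mulr_ge0//; case/andP: (e01 z).
- move=> p /efar; apply: filterS => z ->; by rewrite mulr0.
Qed.

Lemma stokes_termD Th1 Th2 p : C1on setT Th1 -> C1on setT Th2 ->
  stokes_term x N H (fun z => Th1 z + Th2 z)%R p =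
  (stokes_term x N H Th1 p + stokes_term x N H Th2 p)%R.
Proof.
move=> C1 C2; rewrite /stokes_term.
have -> : 'D_(field x N H p) (fun z => Th1 z + Th2 z)%R (x p) =
    ('D_(field x N H p) Th1 (x p) + 'D_(field x N H p) Th2 (x p))%R.
  apply: deriveD; [exact: (C1on_derivable C1 I)|exact: (C1on_derivable C2 I)].
by rewrite mulrDl addrACA.
Qed.

Lemma stokes_term_near0 Th p : (\forall z \near x p, Th z = 0%R) -> stokes_term x N H Th p = 0%R.
Proof.
move=> h; rewrite /stokes_term (derive_near0 _ h).
by rewrite (nbhs_singleton h) mul0r addr0.
Qed.

Lemma measurable_test Th : C1on setT Th ->
  measurable_fun setT ((fun p => Th (x p) * enorm (field x N H p))%R : Borel M -> R).
Proof.
move=> CT; apply: continuous_measurable_borel => p.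
apply: (@continuousM _ _ (fun p => Th (x p)) (fun p => enorm (field x N H p))).
  apply: (@continuous_comp _ _ _ x Th); first exact: cx.
  exact: (C1on_continuous CT I).
apply: continuous_enorm; exact: (continuous_field ex uN).
Qed.

(** Induction on the bumps: [Theta] splits into [Theta * eta], which is local, and
    [Theta * (1 - eta)], which vanishes wherever [eta] is locally 1 and so needs one bump less. Once
    no bump is left, the integrand is 0. *)
Lemma stokes_list (s : seq ('rV[R]_n.+1 -> R)) phi eps Theta : cutoff phi eps ->
  (forall eta, List.In eta s -> [/\ C1on setT eta, forall z, (0 <= eta z <= 1)%R &
    forall Theta phi eps, C1on setT Theta -> (forall z, 0 <= Theta z)%R -> cutoff phi eps ->
     stokes_bound phi eps (fun z => Theta z * eta z)%R]) ->
  C1on setT Theta -> (forall z, 0 <= Theta z)%R ->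
  (forall q, phi q <> 0%R ->
    (exists2 eta, List.In eta s & \forall z \near x q, eta z = 1%R) \/
    \forall z \near x q, Theta z = 0%R) ->
  stokes_bound phi eps Theta.
Proof.
move=> Hphi; elim: s Theta => [|eta s IH] Theta Hs CT T0 cov.
  have E p : (phi p * stokes_term x N H Theta p)%:E = 0.
    have [->|/eqP p0] := eqVneq (phi p) 0%R; first by rewrite mul0r.
    by case: (cov p p0) => [[]//|/stokes_term_near0 ->]; rewrite mulr0.
  rewrite /stokes_bound; under eq_fun => p do rewrite E.
  split; first exact: integrable0.
  rewrite integral0 abse0 mule_ge0 ?lee_fin//.
    by rewrite mulr_ge0 ?stokes_const_ge0//; case: Hphi.
  by apply: integral_ge0 => p _; rewrite lee_fin mulr_ge0// enorm_ge0.
have [Ce e01 Se] := Hs eta (or_introl erefl).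
have C1e : C1on setT (fun z => 1 - eta z)%R by exact: (C1onB openT (C1on_cst _ openT) Ce).
pose T1 z := (Theta z * eta z)%R; pose T2 z := (Theta z * (1 - eta z))%R.
have C1T : C1on setT T1 by exact: (C1onM openT CT Ce).
have C2T : C1on setT T2 by exact: (C1onM openT CT C1e).
have T10 z : (0 <= T1 z)%R by rewrite mulr_ge0//; case/andP: (e01 z).
have T20 z : (0 <= T2 z)%R by rewrite mulr_ge0// subr_ge0; case/andP: (e01 z).
have [I1 B1] : stokes_bound phi eps T1 by exact: Se.
have [I2 B2] : stokes_bound phi eps T2.
  apply: (IH T2 (fun e es => Hs e (or_intror es)) C2T T20).
  move=> q /cov[[e [<-|es]]|] h; [right|by left; exists e|right].
    by apply: filterS h => z ez; rewrite /T2 ez subrr mulr0.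
  by apply: filterS h => z ez; rewrite /T2 ez mul0r.
have TE : Theta = fun z => (T1 z + T2 z)%R.
  by apply/funext => z; rewrite /T1 /T2 -mulrDr addrC subrK mulr1.
have E p : (phi p * stokes_term x N H Theta p)%:E =
    (phi p * stokes_term x N H T1 p)%:E + (phi p * stokes_term x N H T2 p)%:E.
  by rewrite {1}TE stokes_termD// mulrDr EFinD.
have mE Th : C1on setT Th ->
    measurable_fun setT (fun p : Borel M => (Th (x p) * enorm (field x N H p))%:E).
  by move=> CTh; apply/measurable_EFinP; exact: measurable_test.
split.
  under eq_fun => p do rewrite E.
  exact: integrableD.
under eq_integral => p _ do rewrite E.
rewrite (integralD measurableT I1 I2).
apply: (le_trans (lee_abs_add _ _)); apply: (le_trans (leeD B1 B2)).
rewrite -ge0_muleDr; last 2 first.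
- by apply: integral_ge0 => p _; rewrite lee_fin mulr_ge0// enorm_ge0.
- by apply: integral_ge0 => p _; rewrite lee_fin mulr_ge0// enorm_ge0.
rewrite -(ge0_integralD mu measurableT) //; last 4 first.
- by move=> p _; rewrite lee_fin mulr_ge0// enorm_ge0.
- exact: mE.
- by move=> p _; rewrite lee_fin mulr_ge0// enorm_ge0.
- exact: mE.
rewrite le_eqVlt; apply/orP; left; apply/eqP; congr (_ * _).
by apply: eq_integral => p _; rewrite -EFinD -mulrDl TE.
Qed.

(** The weight is the constant 1, and finitely many of the sets where a local bump is 1 cover
    [K]. *)
Lemma compact_stokes (K : set M) phi eps : compact K -> cutoff phi eps ->
  (forall q, phi q <> 0%R -> K q) ->
  mu.-integrable setT (fun p => (phi p * divergence x N H p)%:E) /\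
  `| \int[mu]_p (phi p * divergence x N H p)%:E | <=
    (stokes_const R n * eps)%:E * \int[mu]_p (enorm (field x N H p))%:E.
Proof.
move=> cK Hphi Ksupp.
have [eta Heta] := choice local_stokes.
pose good p := [set q | \forall z \near x q, eta p z = 1%R].
have := cK; rewrite compact_cover => /(_ M setT (fun p => (good p)°)).
case.
- by move=> i _; exact: open_interior.
- by move=> k _; exists k => //; have [_ _ + _] := Heta k.
move=> D' _ cov.
have C1 : C1on setT (fun _ : 'rV[R]_n.+1 => 1%R : R) by exact: (C1on_cst _ openT).
have [] := @stokes_list (map eta (finmap.enum_fset D')) phi eps (fun=> 1%R) Hphi _ C1.
- by move=> e /List.in_map_iff[p [<- _]]; have [] := Heta p.
- by move=> _; exact: ler01.
- move=> q /Ksupp/cov[p pD /interior_subset qp]; left; exists (eta p) => //.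
  apply/List.in_map_iff; exists p; split => //.
  have : p \in finmap.enum_fset D' by exact: pD.
  by elim: (finmap.enum_fset D') => // a l IH; rewrite inE => /orP[/eqP ->|/IH]; [left|right].
have E p : stokes_term x N H (fun=> 1%R) p = divergence x N H p.
  rewrite /stokes_term mul1r; have -> : 'D_(field x N H p) (fun=> 1%R : R) (x p) = 0%R.
    exact: derive_cst.
  exact: addr0.
under eq_fun => p do rewrite E.
move=> I B; split=> //; move: B.
by under [X in _ <= _ * X]eq_integral => p _ do rewrite mul1r.
Qed.

End global_stokes.

(** * Vanishing of the divergence *)

Section integral_identity.
Variables (R : realType) (n : nat) (M : oriented_manifold R n) (x N : M -> 'rV[R]_n.+1).
Variable mu : {measure set (Borel M) -> \bar R}.
Hypotheses (ex : embedding x) (uN : unit_normal x N) (rv : riemannian_volume x mu).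
Variables (C H : R).
Hypotheses (boundA : forall p, norm_sff x N p <= C) (cmc : forall p, mean_curvature x N p = H).
Hypothesis n0 : (0 < n)%N.
Hypothesis complete : complete_induced_metric x.

Lemma dlt_ge0 p q a : dlt x p q a -> 0 <= a.
Proof. by move=> /dlt_chord; apply: le_trans. Qed.

(** The cut-off is the positive part of [1 - eps * d], with [d] the distance to [p0]. It is
    supported in a ball of radius [eps^-1], which is precompact by Hopf-Rinow. *)
Lemma distance_cutoff p0 (eps : R) : 0 < eps -> exists phi : M -> R,
  [/\ cutoff x phi eps, forall p, 0 <= phi p, forall p, dlt x p0 p 1 -> 1 - eps <= phi p &
    exists2 K, compact K & forall q, phi q <> 0 -> K q].
Proof.
move=> e0.
(* The supremum of this set is the positive part; the element 0 also takes care of points not joined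
   to [p0]. *)
pose A p := [set t : R | t = 0 \/ exists2 a, dlt x p0 p a & t = 1 - eps * a].
have A0 p : A p 0 by left.
have A1 p t : A p t -> t <= 1.
  by move=> [->//|[a /dlt_ge0 a0 ->]]; rewrite gerBl mulr_ge0// ltW.
have hA p : has_sup (A p) by split; [exists 0|exists 1 => t /A1].
pose phi p := sup (A p).
have phi0 p : 0 <= phi p by apply: ub_le_sup => //; exists 1 => t /A1.
have phi1 p : phi p <= 1 by apply: ge_sup; [exists 0|move=> t /A1].
have lip1 p q b : dlt x p q b -> phi p <= phi q + eps * b.
  move=> pq; apply: ge_sup; first by exists 0.
  move=> t [->|[a pa ->]]; first by rewrite addr_ge0// mulr_ge0 ?(ltW e0)//; exact: dlt_ge0 pq.
  rewrite -lerBlDr; apply: ub_le_sup; first by exists 1 => t' /A1.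
  by right; exists (a + b); [exact: dlt_trans pa pq|ring].
have lip p q b : dlt x p q b -> `|phi p - phi q| <= eps * b.
  move=> pq; rewrite ler_norml lerBrDr lerBlDl (lip1 _ _ _ pq) andbT addrC lerBlDr.
  exact: (lip1 _ _ _ (dlt_sym pq)).
exists phi; split => //.
- split => //; last exact: ltW.
    apply: continuous_measurable_borel => p.
    apply/cvgrPdist_le => e he.
    have ee : 0 < e / eps by rewrite divr_gt0.
    have := nbhs_dball ex p ee; apply: filterS => q /lip.
    by rewrite mulrC divfK// gt_eqF.
  by move=> p; rewrite ger0_norm.
- move=> p p1; apply: ub_le_sup; first by exists 1 => t /A1.
  by right; exists 1 => //; rewrite mulr1.
have [K cK HK] := Hopf_Rinow ex p0 eps^-1 complete.
exists K => // q /eqP q0; apply: HK.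
have qp : 0 < phi q by rewrite lt0r q0 phi0.
have [t [->|[a qa ->]]] := sup_adherent qp (hA q); rewrite -/(phi q) subrr ?ltxx// => h.
apply: dlt_le qa; move: h; rewrite subr_gt0 mulrC -ltr_pdivlMr// mul1r; exact: ltW.
Qed.

Hypothesis intx : mu.-integrable [set: M] (fun p => (enorm (tangent_proj x p (x p)))%:E).

Lemma integrable_field : mu.-integrable setT (fun p => (enorm (field x N H p))%:E).
Proof.
have mf : measurable_fun setT ((fun p => enorm (field x N H p)) : Borel M -> R).
  apply: continuous_measurable_borel => p; apply: continuous_enorm.
  exact: (continuous_field ex uN).
have I := integrableZl measurableT (n.+1%:R * n.+1%:R * `|C|) intx.
apply: (le_integrable measurableT _ _ I); first exact/measurable_EFinP.
move=> p _ /=; rewrite lee_fin ger0_norm ?enorm_ge0//.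
apply: (le_trans (field_bound ex uN boundA cmc n0 p)); exact: ler_norm.
Qed.

(* If the divergence did not vanish at [p1], its integral against the cut-offs
   of slope [eps] would be bounded below, whereas it is [O(eps)]. *)
Lemma divergence_eq0 (sg : R) p1 : (forall p, 0 <= sg * support_fun x N p) -> `|sg| = 1 ->
  divergence x N H p1 = 0.
Proof.
have half (e : R) : e <= 2^-1 -> 2^-1 <= 1 - e by lra.
have dbl (a : R) : 0 < a + 1 -> 0 <= a -> a < 2 * (a + 1) by lra.
move=> s0 s1.
have d0 p : 0 <= sg * divergence x N H p.
  by rewrite /divergence mulrA mulr_ge0// (defect_ge0 ex uN cmc n0).
apply: contrapT => /eqP dp.
have dpos : 0 < sg * divergence x N H p1.
  rewrite lt0r d0 andbT mulf_neq0//.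
  by apply/eqP => E; move: s1; rewrite E normr0 => /eqP; rewrite eq_sym oner_eq0.
pose v := sg * divergence x N H p1 / 2.
have v0 : 0 < v by rewrite divr_gt0.
have cd := @continuous_divergence _ _ _ _ _ ex uN H.
have csd : {for p1, continuous (fun p => sg * divergence x N H p)}.
  apply: (@continuousM _ _ (fun _ => sg) (divergence x N H)); [exact: cst_continuous|exact: cd].
have n1 : \forall p \near p1, v < sg * divergence x N H p.
  by apply: (cvgr_gt _ csd); rewrite ltr_pdivrMr//; move: (sg * _) dpos => a; lra.
have n2 : nbhs p1 ([set p | v < sg * divergence x N H p] `&` dball x p1 1).
  by apply: filterI n1 _; exact: (nbhs_dball ex p1 ltr01).
pose A := ([set p | v < sg * divergence x N H p] `&` dball x p1 1)°.
have oA : open A by exact: open_interior.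
have AP p : A p -> v < sg * divergence x N H p /\ dlt x p1 p 1 by move=> /interior_subset.
have mA : measurable (A : set (Borel M)) by exact: open_borel.
have [lam Hlam] := lebesgue_rV_exists R n.
have nA : nbhs p1 A by exact: (nbhs_interior n2).
have muA : (0 < mu A)%E by exact: (open_measure_gt0 ex uN rv Hlam nA mA).
have If := integrable_field.
have mdiv : measurable_fun setT (divergence x N H : Borel M -> R).
  exact: continuous_measurable_borel.
(* On [A], within distance 1 of [p1], the cut-off is at least one half and the signed divergence
   exceeds [v]; elsewhere the integrand is nonnegative. *)
have key eps : 0 < eps -> eps <= 2^-1 ->
    ((v / 2)%:E * mu A <= (stokes_const R n * eps)%:E * \int[mu]_p (enorm (field x N H p))%:E)%E.
  move=> e0 e2; have [phi [Hphi phi0 phi1 [K cK HK]]] := distance_cutoff p1 e0.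
  have [I B] := compact_stokes ex uN rv cmc n0 cK Hphi HK.
  have [mphi _ _ _] := Hphi.
  apply: le_trans B.
  have E : (`| \int[mu]_p (phi p * divergence x N H p)%:E | =
      \int[mu]_p (phi p * (sg * divergence x N H p))%:E)%E.
    have -> : (\int[mu]_p (phi p * (sg * divergence x N H p))%:E =
        sg%:E * \int[mu]_p (phi p * divergence x N H p)%:E)%E.
      rewrite -(integralZl measurableT I); apply: eq_integral => p _.
      by rewrite -EFinM mulrCA.
    have pos : (0 <= sg%:E * \int[mu]_p (phi p * divergence x N H p)%:E)%E.
      rewrite -(integralZl measurableT I); apply: integral_ge0 => p _.
      rewrite -EFinM lee_fin mulrCA; exact: (mulr_ge0 (phi0 p) (d0 p)).
    by rewrite -(gee0_abs pos) abseM /= s1 mul1e.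
  rewrite E.
  have mphid : measurable_fun setT (fun p : Borel M => (phi p * (sg * divergence x N H p))%:E).
    by apply/measurable_EFinP; apply: measurable_funM => //; exact: measurable_funM.
  have -> : ((v / 2)%:E * mu A = \int[mu]_p ((v / 2) * \1_A p)%:E)%E.
    have mi : measurable_fun setT (fun p : Borel M => (\1_A p : R)%:E).
      by apply/measurable_EFinP; exact: measurable_indic.
    transitivity (\int[mu]_p ((v / 2)%:E * (\1_A p : R)%:E))%E; last by [].
    rewrite (ge0_integralZl mu measurableT mi) ?lee_fin ?divr_ge0 ?(ltW v0)//.
    by rewrite (integral_indic mu measurableT mA) setIT.
  apply: ge0_le_integral => //.
  - by move=> p _; rewrite lee_fin mulr_ge0// divr_ge0// ltW.
  - by apply/measurable_EFinP; apply: measurable_funM => //; exact: measurable_indic.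
  - move=> p _; rewrite lee_fin indicE; have [Ap|Ap] := pselect (A p); last first.
      rewrite memNset// mulr0; exact: (mulr_ge0 (phi0 p) (d0 p)).
    have [vd /phi1 h] := AP p Ap.
    have h2 : 2^-1 <= 1 - eps by exact: half.
    have h0 : 0 <= (2^-1 : R) by rewrite invr_ge0.
    rewrite (mem_set Ap) mulr1 mulrC.
    exact: (ler_pM h0 (ltW v0) (le_trans h2 h) (ltW vd)).
pose i := fine (\int[mu]_p (enorm (field x N H p))%:E)%E.
have i0 : 0 <= i by apply/fine_ge0/integral_ge0 => p _; rewrite lee_fin enorm_ge0.
have iE : (\int[mu]_p (enorm (field x N H p))%:E = i%:E)%E.
  rewrite fineK// ge0_fin_numE; last by apply: integral_ge0 => p _; rewrite lee_fin enorm_ge0.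
  have /integrableP[_] := If; congr (_ < _)%E; apply: eq_integral => p _ /=.
  by rewrite ger0_norm// enorm_ge0.
rewrite iE in key.
have K0 := @stokes_const_ge0 R n; move: (stokes_const R n) K0 key => k K0 key.
have P : (0 < (v / 2)%:E * mu A)%E by rewrite mule_gt0// lte_fin divr_gt0.
move: ((v / 2)%:E * mu A)%E P key => m m0 key.
have h2 : 0 < (2^-1 : R) by rewrite invr_gt0.
(* The inequality for the slope one half already bounds [m]. *)
have mfin : m \is a fin_num.
  rewrite ge0_fin_numE ?(ltW m0)//; apply: (le_lt_trans (key _ h2 (lexx _))).
  by rewrite -EFinM ltry.
have mE : (m = (fine m)%:E)%E by rewrite fineK.
have fm0 : 0 < fine m by rewrite -lte_fin -mE.
(* This slope makes the upper bound [k * eps * i] smaller than [m]; the 1 avoids a division by 0. *)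
pose eps := Num.min 2^-1 (fine m / (2 * (k * i + 1))).
have den0 : 0 < k * i + 1 by rewrite ltr_wpDl// mulr_ge0.
have e0 : 0 < eps by rewrite lt_min h2 divr_gt0// mulr_gt0.
have e2 : eps <= 2^-1 by rewrite ge_min lexx.
have := key _ e0 e2; rewrite mE -EFinM lee_fin leNgt => /negP; apply.
have e3 : eps <= fine m / (2 * (k * i + 1)) by rewrite ge_min lexx orbT.
rewrite mulrAC; apply: (@le_lt_trans _ _ (k * i * (fine m / (2 * (k * i + 1))))).
  by rewrite ler_wpM2l// mulr_ge0.
rewrite mulrA ltr_pdivrMr ?mulr_gt0//; move: (k * i) den0 (mulr_ge0 K0 i0) => ki d1 d2.
by rewrite mulrC ltr_pM2l//; exact: dbl.
Qed.

End integral_identity.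

(** * Transversality and umbilicity *)

Lemma differentiable_rV (R : realType) (V : normedModType R) (m : nat) (f : V -> 'rV[R]_m) y :
  (forall j, differentiable (fun z => f z 0 j) y) -> differentiable f y.
Proof.
move=> df.
have -> : f = \sum_j (fun z => f z 0 j *: (delta_mx 0 j : 'rV[R]_m)).
  by apply/funext => z; rewrite fct_sumE {1}(row_sum_delta (f z)).
by apply: differentiable_sum => j; apply: differentiableZl; exact: df.
Qed.

Lemma differentiable_enorm (R : realType) (m : nat) (z : 'rV[R]_m) : 0 < enorm z ->
  differentiable (@enorm R m) z.
Proof.
move=> z0; have [dq _] := C1on_dotv_sub (0 : 'rV[R]_m).
have E : (fun y : 'rV[R]_m => dotv (y - 0) (y - 0)) = (fun y => dotv y y).
  by apply/funext => y; rewrite subr0.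
rewrite E in dq.
have p0 : 0 < dotv z z by rewrite -sqr_enorm exprn_gt0.
have [ds _] := is_derive1_sqrt p0.
by have [] := derive_compR 0 (dq z I) ds.
Qed.

Section transversality.
Variables (R : realType) (n k : nat) (M : oriented_manifold R n) (x N : M -> 'rV[R]_n.+1).
Hypotheses (ex : embedding x) (uN : unit_normal x N) (rg : radial_graph k (range x)).

Lemma unit_sphereE (m : nat) (q : 'rV[R]_m) : unit_sphere R m q -> enorm q = 1.
Proof. by rewrite /unit_sphere /esphere /= subr0. Qed.

(* If the position vector were tangent at [x p], differentiating the equation
   [|z| = u (z / |z|)] of the graph in its direction would give [|x p| = 0]. *)
Lemma support_fun_neq0 p : support_fun x N p <> 0.
Proof.
move=> E; have [a [u [_ _ su u0 S]]] := rg.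
have := imageT x p; rewrite S => -[q Oq xE].
have q1 : enorm q = 1 by exact: unit_sphereE Oq.1.
set z0 := x p in xE.
have z0E : enorm z0 = u q by rewrite -xE enormZ q1 mulr1 gtr0_norm// u0.
have z00 : 0 < enorm z0 by rewrite z0E u0.
pose dir (z : 'rV[R]_n.+1) := (enorm z)^-1 *: z.
have dirE q' : (unit_sphere R n.+1 `\` [set` a]) q' -> enorm (u q' *: q') = u q' /\ dir (u q' *: q') = q'.
  move=> Oq'; have e : enorm (u q' *: q') = u q'.
    by rewrite enormZ (unit_sphereE Oq'.1) mulr1 gtr0_norm// u0.
  by split=> //; rewrite /dir e scalerA mulVf ?scale1r// gt_eqF// u0.
have dirz0 : dir z0 = q by rewrite -xE (dirE q Oq).2.
have [U [F [oU Uq sF FE]]] := su q Oq.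
have den := differentiable_enorm z00.
have ddir : differentiable dir z0.
  apply: differentiable_rV => j.
  have -> : (fun z => dir z 0 j) = (fun z => (enorm z)^-1 * z 0 j).
    by apply/funext => z; rewrite mxE.
  apply: (@differentiableM _ _ (fun z : 'rV[R]_n.+1 => (enorm z)^-1) (fun z => z 0 j)).
    have nz : enorm z0 != 0 by rewrite gt_eqF.
    by apply: differentiableV nz; exact: den.
  exact: differentiable_coord.
have dF : differentiable (F : 'rV[R]_n.+1 -> R) (dir z0).
  by rewrite dirz0; have [+ _] := sF 1%N; apply.
(* A local defining function of the graph. It vanishes on the graph near [z0] and grows at rate 1 in
   the radial direction, as [dir] is constant along rays. *)
pose Phi z : R := enorm z - F (dir z).
have dFd : differentiable (fun z => F (dir z) : R) z0 by exact: (differentiable_comp ddir dF).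
have dPhi : differentiable Phi z0 by exact: differentiableB.
have nU : \forall z \near z0, U (dir z).
  have cd : {for z0, continuous dir} by exact: differentiable_continuous.
  by apply: cd; rewrite dirz0; exact: open_near oU Uq.
have Phi0 : \forall z \near z0, range x z -> Phi z = 0.
  apply: filterS nU => z Uz; rewrite S => -[q' Oq' zE].
  have [e1 e2] := dirE q' Oq'; rewrite zE in e1 e2.
  by rewrite /Phi e1 e2 FE ?subrr//; rewrite -e2.
pose c := chart_at p; have ac : atlas c by exact: atlas_chart_at.
have cp : cdom c p by exact: cdom_chart_at.
pose X := x \o cinv c; pose y0 := cmap c p.
have Xy0 : X y0 = z0 by rewrite /X /= cmapK.
have sx : smooth_map x by case: ex.
have [dX _ _] := smooth_map_C2 sx ac.
have dXy := dX y0 (cmap_ccod cp).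
(* The chart coordinates of [z0], which is tangent because the support function is assumed to
   vanish. *)
pose V := z0 *m pinv (cjacobian x c p).
have VJ : V *m 'J X y0 = z0.
  rewrite -mulmxA -/(cjacobian x c p) (tan_projE ex uN ac cp) /tan_proj mulmxBr mulmx1 mulmxA.
  have -> : z0 *m (N p)^T = 0 by apply/rowP => i; rewrite (ord1 i) [RHS]mxE; exact: E.
  by rewrite mul0mx subr0.
have near0 : \forall y \near y0, Phi (X y) = 0.
  have cX : {for y0, continuous X} by exact: differentiable_continuous.
  have P' : nbhs (X y0) [set z | range x z -> Phi z = 0] by rewrite Xy0; exact: Phi0.
  have : \forall y \near y0, range x (X y) -> Phi (X y) = 0 := cX _ P'.
  by apply: filterS => y; apply; exists (cinv c y).
have dPhiX : differentiable Phi (X y0) by rewrite Xy0.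
have D1 : 'D_z0 Phi z0 = 0.
  have dC : differentiable (Phi \o X) y0 by exact: differentiable_comp.
  rewrite -(derive_near0 V near0); apply: esym; apply: (etrans (deriveE _ dC)).
  rewrite diff_comp//= -(deriveE _ dXy) (deriveEjacobian _ dXy) VJ.
  by apply: (etrans (esym (deriveE _ dPhiX))); rewrite Xy0.
have D2 : 'D_z0 Phi z0 = enorm z0.
  have dl : derivable Phi ((0 : R) *: z0 + z0) z0.
    by rewrite scale0r add0r; exact: diff_derivable.
  have [_ e1] := is_derive_line dl; rewrite scale0r add0r in e1; rewrite -e1.
  (* Along the ray [Phi] is affine, with slope the norm of [z0]; this contradicts [D1]. *)
  have n1 : \forall s \near (0 : R), Phi (s *: z0 + z0) = (enorm z0 - F q) + enorm z0 * s.
    have : \forall s \near (0 : R), -1 < s.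
      by apply: (cvgr_gt _ (@cvg_id _ (nbhs (0 : R)))); rewrite ltrN10.
    apply: filterS => s s1.
    have s10 : 0 < s + 1 by rewrite -ltrBlDr sub0r.
    have -> : s *: z0 + z0 = (s + 1) *: z0 by rewrite scalerDl scale1r.
    have e : enorm ((s + 1) *: z0) = (s + 1) * enorm z0 by rewrite enormZ gtr0_norm.
    rewrite /Phi; have -> : dir ((s + 1) *: z0) = q.
      rewrite /dir e scalerA invfM mulrAC mulVf ?mul1r ?gt_eqF//.
    by rewrite e; ring.
  rewrite (near_eq_derive _ n1).
  by have [_ ->] := is_derive_affine (enorm z0 - F q) (enorm z0) 0.
by have := z00; rewrite -D2 D1 ltxx.
Qed.

End transversality.

(** As [f] has no zero, the open set where it is positive is also the closed set where it is
    nonnegative. *)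
Lemma connected_sign (R : realType) (T : topologicalType) (f : T -> R) :
  connected [set: T] -> continuous f -> (forall p, f p <> 0) ->
  exists sg : R, `|sg| = 1 /\ forall p, 0 < sg * f p.
Proof.
move=> cT cf f0.
have [[p fp]|np] := pselect (exists p, 0 < f p); last first.
  exists (-1); rewrite normrN1; split => // p; rewrite mulN1r oppr_gt0 lt_neqAle.
  apply/andP; split; first by apply/eqP.
  by rewrite leNgt; apply/negP => fp; apply: np; exists p.
exists 1; rewrite normr1; split => // q; rewrite mul1r.
have oB : open [set p | 0 < f p] by exact: ((continuousP f).1 cf _ (@open_gt _ _)).
have cB : closed [set p | 0 <= f p] by exact: ((continuous_closedP f).1 cf _ (@closed_ge _ _)).
have := cT [set p | 0 < f p]; move=> /(_ (ex_intro _ p fp)) h.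
have e1 : exists2 C, open C & [set p | 0 < f p] = [set: T] `&` C.
  by exists [set p | 0 < f p]; rewrite ?setTI.
have e2 : exists2 C, closed C & [set p | 0 < f p] = [set: T] `&` C.
  exists [set p | 0 <= f p]; rewrite ?setTI//; apply/seteqP; split => z /=; first exact: ltW.
  by rewrite le_eqVlt => /orP[/eqP e|//]; case: (f0 z).
have E := h e1 e2.
by have : [set p | 0 < f p] q by rewrite E.
Qed.

Lemma connected_cst (T : topologicalType) (W : topologicalType) (f : T -> W) p0 :
  hausdorff_space W -> connected [set: T] -> continuous f ->
  (forall p, \forall q \near p, f q = f p) -> forall p, f p = f p0.
Proof.
move=> hW cT cf lf p.
have e1 : exists2 C, open C & [set p | f p = f p0] = [set: T] `&` C.
  exists [set p | f p = f p0]; rewrite ?setTI//.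
  by rewrite openE => q /= fq; have := lf q; apply: filterS => z fz; exact: (etrans fz fq).
have e2 : exists2 C, closed C & [set p | f p = f p0] = [set: T] `&` C.
  exists [set p | f p = f p0]; rewrite ?setTI//.
  have -> : [set p | f p = f p0] = f @^-1` [set f p0] by [].
  by apply: (continuous_closedP f).1 cf _ _; exact: accessible_closed_set1 (hausdorff_accessible hW) _.
have E := cT [set p | f p = f p0] (ex_intro _ p0 erefl) e1 e2.
by have : [set p | f p = f p0] p by rewrite E.
Qed.

Lemma jacobian0_locally_cst (R : realType) (n m : nat) (U : set 'rV[R]_n)
    (f : 'rV[R]_n -> 'rV[R]_m) y : open U -> (forall z, U z -> differentiable f z) ->
  (forall z, U z -> 'J f z = 0) -> U y -> \forall z \near y, f z = f y.
Proof.
move=> oU df J0 Uy.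
have [d /= d0 dU] := (nbhs_ballP _ _).1 (open_near oU Uy).
apply/nbhs_ballP; exists d => //= z; rewrite -ball_normE /= => dz.
apply/rowP => j; apply/eqP; rewrite -subr_eq0; apply/eqP.
have inU (s : R) : 0 <= s <= 1 -> U (s *: (z - y) + y).
  move=> /andP[s0 s1]; apply: dU; rewrite -ball_normE /= opprD addrCA subrr addr0 normrN.
  rewrite normrZ ger0_norm//; apply: le_lt_trans dz; rewrite [leRHS]distrC.
  by rewrite ler_piMl.
have dj (s : R) : 0 <= s <= 1 -> derivable (fun z => f z 0 j) (s *: (z - y) + y) (z - y).
  move=> /inU Us; apply: diff_derivable.
  apply: (@differentiable_comp _ _ _ _ f (fun A : 'rV[R]_m => A 0 j)); first exact: df.
  exact: differentiable_coord.
have [c /inU Uc] := MVT_line ltr01 dj.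
rewrite scale1r subrK => ->; rewrite mul1r.
have dd := diff_derivable (v := z - y) (df _ Uc).
have e := derive_mx dd.
have := congr1 (fun A : 'rV[R]_m => A 0 j) e.
rewrite [X in _ = X -> _]mxE => <-.
by rewrite (deriveEjacobian _ (df _ Uc)) (J0 _ Uc) mulmx0 mxE.
Qed.

(** * Totally umbilic hypersurfaces *)

Section umbilic.
Variables (R : realType) (n : nat) (M : oriented_manifold R n) (x N : M -> 'rV[R]_n.+1).
Hypotheses (ex : embedding x) (uN : unit_normal x N) (H : R).
Hypothesis cM : connected [set: M].

(** Multiplying the vanishing of [traceless] by the Jacobian of the position gives that the
    derivative of [N] is [- H] times that of [x], so [N + H *: x] is locally constant. *)
Lemma umbilic_cst p0 : (forall p, traceless x N H p = 0) ->
  forall p, N p + H *: x p = N p0 + H *: x p0.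
Proof.
move=> T0.
have sx : smooth_map x by case: ex. have sN : smooth_map N by case: uN.
apply: (@connected_cst M 'rV[R]_n.+1 (fun p => N p + H *: x p) p0 (@norm_hausdorff _ _) cM).
  move=> p; apply: (@continuousD _ _ _ N (fun p => H *: x p)).
    exact: (continuous_smooth_map sN).
  apply: (@continuousZ _ _ _ (fun=> H) x); first exact: cst_continuous.
  exact: (continuous_smooth_map sx).
move=> p; pose c := chart_at p; have ac : atlas c by exact: atlas_chart_at.
have cp : cdom c p by exact: cdom_chart_at.
have [dX CX CX2] := smooth_map_C2 sx ac; have [dN CN CN2] := smooth_map_C2 sN ac.
pose f y := (N \o cinv c) y + H *: (x \o cinv c) y.
have df y : ccod c y -> differentiable f y.
  move=> cy; apply: (@differentiableD _ _ _ (N \o cinv c) (fun y => H *: (x \o cinv c) y)).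
    exact: dN.
  by apply: (@differentiableZ _ _ _ (x \o cinv c) H); exact: dX.
have Jf y : ccod c y -> 'J f y = 0.
  move=> cy; have [dy yE] := cmap_cinv cy.
  have JP : 'J (x \o cinv c) y *m pinv ('J (x \o cinv c) y) = 1%:M.
    by apply: mul_pinv; have [_ _ Jf] := chart_data ex uN ac; exact: Jf.
  have JE : 'J (N \o cinv c) y = - (H *: 'J (x \o cinv c) y).
    have := T0 (cinv c y); rewrite /traceless (amb_shapeE ex uN ac dy) -(tan_projE ex uN ac dy).
    rewrite /chart_shape /cjacobian yE; move: JP; move: (pinv _) => P.
    move: ('J _ _) ('J _ _) => L J JP /(congr1 (mulmx J)).
    rewrite mulmx0 mulmxBr mulmxN mulmxA JP mul1mx -scalemxAr mulmxA JP mul1mx => /eqP.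
    by rewrite subr_eq add0r eqr_oppLR => /eqP.
  apply/row_matrixP => i; rewrite row0 rowE -(deriveEjacobian _ (df _ cy)).
  have -> : 'D_(delta_mx 0 i) f y = 'D_(delta_mx 0 i) (N \o cinv c) y + H *: 'D_(delta_mx 0 i) (x \o cinv c) y.
    have d1 := diff_derivable (v := delta_mx 0 i) (dN y cy).
    have d2 := diff_derivable (v := delta_mx 0 i) (dX y cy).
    have dZ : derivable (H *: (x \o cinv c)) y (delta_mx 0 i) by exact: derivableZ.
    by apply: (etrans (deriveD d1 dZ)); congr (_ + _); exact: deriveZ.
  rewrite (deriveEjacobian _ (dN y cy)) (deriveEjacobian _ (dX y cy)) JE.
  by move: ('J _ _) => J; rewrite mulmxN scalemxAr addNr.
have nf := jacobian0_locally_cst (@ccod_open _ _ _ c) df Jf (cmap_ccod cp).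
have n1 : \forall q \near p, f (cmap c q) = f (cmap c p).
  have h := cmap_continuous cp; exact: (h _ nf).
have n2 : \forall q \near p, cdom c q by apply: open_nbhs_nbhs; split => //; exact: cdom_open.
near=> q.
have cq : cdom c q by near: q.
have : f (cmap c q) = f (cmap c p) by near: q.
by rewrite /f /= !cmapK.
Unshelve. all: by end_near. Qed.

End umbilic.

(** * Spheres and radial graphs *)

Section euclidean_geometry.
Variables (R : realType) (n : nat).
Implicit Types (u v q c z : 'rV[R]_n.+1).

Lemma dotvC m (u v : 'rV[R]_m) : dotv u v = dotv v u.
Proof. by rewrite /dotv -[in LHS](trmxK (u *m v^T)) trmx_mul trmxK [LHS]mxE. Qed.

Lemma dotvDl m (u v w : 'rV[R]_m) : dotv (u + v) w = dotv u w + dotv v w.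
Proof. by rewrite /dotv mulmxDl mxE. Qed.

Lemma dotvZl m (t : R) (u w : 'rV[R]_m) : dotv (t *: u) w = t * dotv u w.
Proof. by rewrite /dotv -scalemxAl mxE. Qed.

Lemma dotvNl m (u w : 'rV[R]_m) : dotv (- u) w = - dotv u w.
Proof. by rewrite /dotv mulNmx mxE. Qed.

Lemma dotvDr m (u v w : 'rV[R]_m) : dotv w (u + v) = dotv w u + dotv w v.
Proof. by rewrite dotvC dotvDl !(dotvC w). Qed.

Lemma dotvZr m (t : R) (u w : 'rV[R]_m) : dotv w (t *: u) = t * dotv w u.
Proof. by rewrite dotvC dotvZl (dotvC w). Qed.

Lemma dotvNr m (u w : 'rV[R]_m) : dotv w (- u) = - dotv w u.
Proof. by rewrite dotvC dotvNl (dotvC w). Qed.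

Lemma enorm1_dotv m (u : 'rV[R]_m) : enorm u = 1 -> dotv u u = 1.
Proof. by move=> e; rewrite -sqr_enorm e expr1n. Qed.

Lemma enorm_eqP m (u : 'rV[R]_m) (r : R) : 0 <= r -> enorm u = r <-> dotv u u = r ^+ 2.
Proof.
move=> r0; split=> [<-|E]; first by rewrite sqr_enorm.
by rewrite /enorm E sqrtr_sqr ger0_norm.
Qed.

(** A quadratic equation in [t], with product of roots [dotv c c - r ^+ 2]; the next three lemmas
    read off the signs of its roots. *)
Lemma esphere_rayP q c (t r : R) : enorm q = 1 -> 0 <= r ->
  esphere c r (t *: q) <-> t ^+ 2 - 2 * t * dotv q c + dotv c c = r ^+ 2.
Proof.
move=> q1 r0; rewrite /esphere /=.
have E : dotv (t *: q - c) (t *: q - c) = t ^+ 2 - 2 * t * dotv q c + dotv c c.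
  rewrite !(dotvDl, dotvDr, dotvNl, dotvNr, dotvZl, dotvZr) (dotvC c q) (enorm1_dotv q1); ring.
by split=> [/(enorm_eqP _ r0)|h]; [rewrite E|apply/(enorm_eqP _ r0); rewrite E].
Qed.

(** Two distinct positive roots would have a positive product, whereas the product is negative. *)
Lemma esphere_ray_uniq q c (t t' r : R) : enorm q = 1 -> 0 <= r -> dotv c c < r ^+ 2 ->
  0 < t -> 0 < t' -> esphere c r (t *: q) -> esphere c r (t' *: q) -> t = t'.
Proof.
move=> q1 r0 cr t0 t'0 /(esphere_rayP _ _ q1 r0) E /(esphere_rayP _ _ q1 r0) E'.
move: (dotv q c) (dotv c c) cr E E' => b d cr E E'.
have : (t - t') * (t + t' - 2 * b) = 0.
  have -> : (t - t') * (t + t' - 2 * b) =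
    (t ^+ 2 - 2 * t * b + d) - (t' ^+ 2 - 2 * t' * b + d) by ring.
  by rewrite E E' subrr.
move=> /eqP; rewrite mulf_eq0 => /orP[|/eqP F]; first by rewrite subr_eq0 => /eqP.
have tt' : 0 < t * t' by rewrite mulr_gt0.
have : d - r ^+ 2 = t * t'.
  have -> : d - r ^+ 2 = t * t' - t * (t + t' - 2 * b) + ((t ^+ 2 - 2 * t * b + d) - r ^+ 2) by ring.
  by rewrite F E subrr mulr0 subr0 addr0.
by nra.
Qed.

(** [t] and [- t'] are the two roots of the same equation, of product [- (t * t')]. *)
Lemma esphere_antipodal q c (t t' r : R) : enorm q = 1 -> 0 <= r -> 0 < t -> 0 < t' ->
  esphere c r (t *: q) -> esphere c r (t' *: - q) -> dotv c c < r ^+ 2.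
Proof.
move=> q1 r0 t0 t'0 /(esphere_rayP _ _ q1 r0) E; rewrite scalerN -scaleNr.
move=> /(esphere_rayP _ _ q1 r0); move: (dotv q c) (dotv c c) E => b d E E'.
have : (t + t') * (t - t' - 2 * b) = 0.
  have -> : (t + t') * (t - t' - 2 * b) =
    (t ^+ 2 - 2 * t * b + d) - ((- t') ^+ 2 - 2 * - t' * b + d) by ring.
  by rewrite E E' subrr.
move=> /eqP; rewrite mulf_eq0 gt_eqF ?addr_gt0//= => /eqP F.
have tt' : 0 < t * t' by rewrite mulr_gt0.
have : r ^+ 2 - d = t * t'.
  have -> : r ^+ 2 - d = t * t' + t * (t - t' - 2 * b) + (r ^+ 2 - (t ^+ 2 - 2 * t * b + d)) by ring.
  by rewrite F E subrr mulr0 !addr0.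
by nra.
Qed.

Lemma esphere_ray_exists q c (r : R) : enorm q = 1 -> 0 <= r -> dotv c c < r ^+ 2 ->
  exists2 t : R, 0 < t & esphere c r (t *: q).
Proof.
move=> q1 r0 cr; set b := dotv q c; set d := dotv c c in cr.
have D0 : 0 <= b ^+ 2 + (r ^+ 2 - d) by rewrite addr_ge0 ?sqr_ge0// subr_ge0 ltW.
pose s := Num.sqrt (b ^+ 2 + (r ^+ 2 - d)).
have sE : s ^+ 2 = b ^+ 2 + (r ^+ 2 - d) by rewrite sqr_sqrtr.
have bs : `|b| < s.
  rewrite -(@ltr_pXn2r _ 2) ?nnegrE ?sqrtr_ge0// sE real_normK ?num_real//.
  by rewrite ltrDl subr_gt0.
exists (b + s).
  by move: bs; rewrite ltr_norml => /andP[]; rewrite -subr_gt0 opprK addrC.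
apply/(esphere_rayP _ _ q1 r0); rewrite -/b -/d.
have -> : (b + s) ^+ 2 - 2 * (b + s) * b + d = s ^+ 2 - b ^+ 2 + d by ring.
by rewrite sE; ring.
Qed.

Lemma esphere_neq0 c z (r : R) : 0 <= r -> dotv c c < r ^+ 2 -> esphere c r z -> 0 < enorm z.
Proof.
move=> r0 cr zS; rewrite lt0r enorm_ge0 andbT; apply/eqP => z0.
have : z = 0 by apply: dotv_eq0; rewrite -sqr_enorm z0 expr0n.
move=> zE; move: zS; rewrite zE /esphere /= sub0r => /(enorm_eqP _ r0).
by rewrite dotvNl dotvNr opprK => E; rewrite E ltxx in cr.
Qed.

Lemma enorm_normalize z : 0 < enorm z -> enorm ((enorm z)^-1 *: z) = 1.
Proof. by move=> z0; rewrite enormZ ger0_norm ?mulVf ?gt_eqF// invr_ge0 ltW. Qed.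

(** A pigeonhole argument: the normalized vectors with first coordinate proportional to 1 and last
    one to [j] are pairwise distinct, and more of them are taken than there are elements in [s] and
    its opposite. *)
Lemma sphere_avoid (s : seq 'rV[R]_n.+1) : (0 < n)%N ->
  exists q, [/\ enorm q = 1, q \notin s & - q \notin s].
Proof.
move=> n0; apply: contrapT => nq.
have o : (ord_max == ord0 :> 'I_n.+1) = false by apply/negbTE; rewrite -val_eqE /= -lt0n.
pose v (j : nat) : 'rV[R]_n.+1 := delta_mx 0 ord0 + j%:R *: delta_mx 0 ord_max.
have v0 j : v j 0 ord0 = 1 by rewrite !mxE !eqxx /= [_ == ord_max]eq_sym o mulr0 addr0.
have vm j : v j 0 ord_max = j%:R by rewrite !mxE !eqxx /= o mulr1 add0r.
have e0 j : 0 < enorm (v j).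
  by apply: (@lt_le_trans _ _ 1) => //; have := entry_le_enorm (v j) ord0; rewrite v0 normr1.
pose w j := (enorm (v j))^-1 *: v j.
have w1 j : enorm (w j) = 1 by exact: enorm_normalize.
have winj : injective w.
  move=> i j /rowP E; have := E ord0; have := E ord_max.
  rewrite ![w _ _ _]mxE !v0 !vm !mulr1 => + E0; rewrite E0 => /mulfI.
  by rewrite invr_eq0 gt_eqF// => /(_ isT)/eqP; rewrite eqr_nat => /eqP.
pose s' := s ++ map -%R s.
have sub : {subset map w (iota 0 (size s').+1) <= s'}.
  move=> _ /mapP[j _ ->]; rewrite mem_cat; apply: contrapT => /negP; rewrite negb_or => /andP[a b].
  apply: nq; exists (w j); split=> //.
  by apply: contra b => h; apply/mapP; exists (- w j); rewrite ?opprK.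
have := uniq_leq_size _ sub; rewrite map_inj_uniq// iota_uniq size_map size_iota => /(_ isT).
by rewrite ltnn.
Qed.

(** A basis vector, or a rotated vector in the plane of the first and last coordinates, is
    normalized. *)
Lemma orthogonal_unit (e : 'rV[R]_n.+1) : (0 < n)%N ->
  exists e', enorm e' = 1 /\ dotv e e' = 0.
Proof.
move=> n0.
have o : (ord_max == ord0 :> 'I_n.+1) = false by apply/negbTE; rewrite -val_eqE /= -lt0n.
have de j : dotv e (delta_mx 0 j) = e 0 j.
  rewrite /dotv mxE (bigD1 j)//= !mxE !eqxx mulr1 big1 ?addr0// => i ij.
  by rewrite !mxE (negPf ij) mulr0.
have [v [v0 ev]] : exists v, v <> 0 /\ dotv e v = 0.
  have [z|z] := eqVneq (e 0 ord0) 0.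
    exists (delta_mx 0 ord0); split; last by rewrite de.
    by move=> /rowP/(_ ord0); rewrite !mxE !eqxx => /eqP; rewrite oner_eq0.
  exists (e 0 ord_max *: delta_mx 0 ord0 - e 0 ord0 *: delta_mx 0 ord_max); split.
    move=> /rowP/(_ ord_max); rewrite !mxE !eqxx o /= mulr0 add0r mulr1 => /eqP.
    by rewrite oppr_eq0 (negPf z).
  by rewrite dotvDr dotvNr !dotvZr !de mulrC subrr.
have v00 : 0 < enorm v.
  rewrite lt0r enorm_ge0 andbT; apply/eqP => z; apply: v0; apply: dotv_eq0.
  by rewrite -sqr_enorm z expr0n.
exists ((enorm v)^-1 *: v); split; first exact: enorm_normalize.
by rewrite dotvZr ev mulr0.
Qed.

Lemma is_deriveZl (f : R -> R) (df t : R) v : is_derive t (1 : R) f df ->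
  is_derive t (1 : R) (fun s => f s *: v) (df *: v).
Proof.
move=> D1; have d1 : differentiable f t by apply/derivable1_diffP; have [] := D1.
have d2 : differentiable (fun t => f t *: v) t by exact: differentiableZl.
split; first exact: diff_derivable.
have -> : 'D_1 (fun t => f t *: v) t = 'd (fun t => f t *: v) t 1 by exact: deriveE.
have E2 : 'D_1 f t = 'd f t 1 by exact: deriveE.
by rewrite diffZl// -E2; have [_ ->] := D1.
Qed.

Definition circle_arc c (r : R) (e1 e2 : 'rV[R]_n.+1) (t : R) :=
  c + (r *: (cos t *: e1) + r *: (sin t *: e2)).

Lemma esphere_circle_arc c (r t : R) e1 e2 : 0 <= r -> enorm e1 = 1 -> enorm e2 = 1 ->
  dotv e1 e2 = 0 -> esphere c r (circle_arc c r e1 e2 t).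
Proof.
move=> r0 u1 u2 o; rewrite /esphere /circle_arc /= addrC addKr; apply/(enorm_eqP _ r0).
rewrite !(dotvDl, dotvDr, dotvZl, dotvZr) (dotvC e2) o (enorm1_dotv u1) (enorm1_dotv u2).
by have := cos2Dsin2 t; move: (cos t) (sin t) => a b E; rewrite !mulr1 -[RHS]mulr1 -E; ring.
Qed.

Lemma circle_arc_C1path c (r : R) e1 e2 : 0 <= r -> enorm e1 = 1 -> enorm e2 = 1 ->
  dotv e1 e2 = 0 -> C1path (circle_arc c r e1 e2) /\
  forall t, enorm (derive1 (circle_arc c r e1 e2) t) = r.
Proof.
move=> r0 u1 u2 o.
pose d t := r *: ((- sin t) *: e1) + r *: (cos t *: e2).
have D t : is_derive t (1 : R) (circle_arc c r e1 e2) (d t).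
  have D1 := is_deriveZ r (is_deriveZl e1 (is_derive_cos t)).
  have D2 := is_deriveZ r (is_deriveZl e2 (is_derive_sin t)).
  have := is_deriveD (is_derive_cst c t (1 : R)) (is_deriveD D1 D2).
  by rewrite add0r.
split.
  apply: (C1path_intro D) => t.
  have cZ (f : R -> R) v : {for t, continuous f} -> {for t, continuous (fun t => r *: (f t *: v))}.
    move=> cf; apply: (@continuousZ _ _ _ (fun=> r) (fun t => f t *: v)); first exact: cst_continuous.
    apply: (@continuousZ _ _ _ f (fun=> v)); [exact: cf|exact: cst_continuous].
  apply: (@continuousD _ _ _ (fun t => r *: ((- sin t) *: e1)) (fun t => r *: (cos t *: e2))).
    apply: (cZ (fun t => - sin t)); apply: continuousN; exact: continuous_sin.
  by apply: cZ; exact: continuous_cos.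
move=> t; rewrite (is_derive1_val (D t)); apply/(enorm_eqP _ r0).
rewrite /d !(dotvDl, dotvDr, dotvZl, dotvZr) (dotvC e2) o (enorm1_dotv u1) (enorm1_dotv u2).
by have := cos2Dsin2 t; move: (cos t) (sin t) => a b E; rewrite !mulr1 -[RHS]mulr1 -E; ring.
Qed.

End euclidean_geometry.

(** * Completeness fills the missing directions *)

Section complete_sphere_graph.
Variables (R : realType) (n k : nat) (M : oriented_manifold R n) (x : M -> 'rV[R]_n.+1).
Hypotheses (ex : embedding x) (n0 : (0 < n)%N) (complete : complete_induced_metric x).

(** The path [gam] is only known to lie in the image for parameters in []0, m]]; the
    reparametrization is a convex combination of [s1] and [s2], so it stays there for all times. *)
Lemma arc_dlt (gam : R -> 'rV[R]_n.+1) (r s1 s2 e m : R) (p1 p2 : M) : 0 <= r ->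
  C1path gam -> (forall t, enorm (derive1 gam t) = r) ->
  (forall s, 0 < s <= m -> range x (gam s)) -> 0 < s1 <= m -> 0 < s2 <= m ->
  x p1 = gam s1 -> x p2 = gam s2 -> r * `|s2 - s1| < e -> dlt x p1 p2 e.
Proof.
move=> r0 Cg dg rg /andP[s10 s1m] /andP[s20 s2m] x1 x2 lt_e.
pose s t := s1 + (s2 - s1) * smoothstep t.
pose ds t := (s2 - s1) * dsmoothstep t.
have Ds (t : R) : is_derive t (1 : R) s (ds t).
  have D1 := is_deriveZ (s2 - s1) (is_derive_smoothstep t).
  have := is_deriveD (is_derive_cst (s1 : R) t (1 : R)) D1.
  by rewrite add0r.
have cds : continuous ds.
  move=> t; apply: (@continuousM _ _ (fun=> s2 - s1) (@dsmoothstep R)).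
    exact: cst_continuous.
  exact: continuous_dsmoothstep.
have sin t : 0 < s t <= m.
  have a0 := smoothstep_ge0 t; have a1 := smoothstep_le1 t.
  have -> : s t = (1 - smoothstep t) * s1 + smoothstep t * s2 by rewrite /s; ring.
  move: (smoothstep t) a0 a1 => a a0 a1; apply/andP; split.
    have [alt|age] := ltP a 1; first by rewrite ltr_pwDl ?mulr_gt0 ?subr_gt0// mulr_ge0// ltW.
    have -> : a = 1 by apply/eqP; rewrite eq_le a1 age.
    by rewrite subrr mul0r add0r mul1r.
  have -> : m = (1 - a) * m + a * m by ring.
  by apply: lerD; rewrite ler_wpM2l// subr_ge0.
have [C1 D1] := C1path_reparam Cg Ds cds.
exists (fun t => gam (s t)); split => //.
- by move=> t; exact: rg (sin t).
- by rewrite /s smoothstep_le0// mulr0 addr0 x1.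
- by rewrite /s smoothstep_ge1// mulr1 addrC subrK x2.
have dF (t : R) : -1 < t < 2 -> is_derive t (1 : R)
    (fun t => (r * `|s2 - s1|) * smoothstep t) (enorm (derive1 (fun t => gam (s t)) t)).
  move=> _; rewrite D1 enormZ dg normrM (ger0_norm (dsmoothstep_ge0 t)).
  have -> : `|s2 - s1| * dsmoothstep t * r = (r * `|s2 - s1|) * dsmoothstep t by ring.
  exact: is_deriveZ (is_derive_smoothstep t).
rewrite (path_length_primitive C1 dF).
by rewrite smoothstep_ge1// smoothstep_le0// mulr1 mulr0 subr0 lte_fin.
Qed.

Lemma complete_sphere_graph c (r : R) : radial_graph k (range x) ->
  range x `<=` esphere c r -> 0 < r -> dotv c c < r ^+ 2 ->
  k = 0%N /\ range x = esphere c r.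
Proof.
move=> [a [u [_ aS _ u0 S]]] sub r0 cr; have r0' := ltW r0.
have ray q t : (unit_sphere R n.+1 `\` [set` a]) q -> 0 < t -> esphere c r (t *: q) -> range x (t *: q).
  move=> Oq t0 h; have q1 := unit_sphereE Oq.1.
  have h2 : range x (u q *: q) by rewrite S; exists q.
  by rewrite (esphere_ray_uniq q1 r0' cr t0 (u0 _ Oq) h (sub _ h2)).
have inR z : esphere c r z -> (enorm z)^-1 *: z \notin a -> range x z.
  move=> zS za; have z0 := esphere_neq0 r0' cr zS.
  have zE : z = enorm z *: ((enorm z)^-1 *: z) by rewrite scalerA divff ?scale1r// gt_eqF.
  rewrite zE; apply: ray => //; last by rewrite -zE.
  split; last exact/negP.
  by rewrite /unit_sphere /esphere /= subr0 enorm_normalize.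
have [k0|kp] := posnP k.
  split=> //; apply/seteqP; split => z; [exact: sub|move=> zS; apply: inR => //].
  have /size0nil a0 : size a = 0%N by rewrite size_tuple.
  by rewrite memtE a0.
exfalso; pose a0 := tnth a (Ordinal kp).
have a01 : enorm a0 = 1 by apply: unit_sphereE; apply: aS; exact: mem_tnth.
have [t t0 tS] := esphere_ray_exists a01 r0' cr.
pose z := t *: a0.
have ez : enorm z = t by rewrite enormZ a01 mulr1 gtr0_norm.
(* [z] is the point of the sphere in the deleted direction [a0], so it cannot belong to the
   graph. *)
have znr : ~ range x z.
  rewrite S => -[q Oq zE].
  have ut : u q = t by rewrite -ez -zE enormZ (unit_sphereE Oq.1) mulr1 gtr0_norm// u0.
  have qa : q = a0.
    by move: zE; rewrite ut /z => /(congr1 (fun v => t^-1 *: v)); rewrite !scalerA mulVf ?scale1r// gt_eqF.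
  by apply: Oq.2; rewrite qa; exact: mem_tnth.
pose e1 := r^-1 *: (z - c).
have u1 : enorm e1 = 1 by rewrite enormZ gtr0_norm ?invr_gt0// tS mulVf// gt_eqF.
have re1 : r *: e1 = z - c by rewrite scalerA divff ?scale1r// gt_eqF.
clearbody e1.
have [e2 [u2 o]] := orthogonal_unit e1 n0.
pose gam := circle_arc c r e1 e2.
have gam0 : gam 0 = z.
  by rewrite /gam /circle_arc cos0 sin0 scale1r scale0r scaler0 addr0 re1 addrC subrK.
have gS s : esphere c r (gam s) by exact: esphere_circle_arc.
have [Cg dg] := circle_arc_C1path c r0' u1 u2 o; rewrite -/gam in Cg dg.
have cg : {for 0, continuous gam}.
  by apply/differentiable_continuous/derivable1_diffP; exact: Cg.1.
have eg0 s : 0 < enorm (gam s) by exact: esphere_neq0 (gS s).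
pose dir s := (enorm (gam s))^-1 *: gam s.
have dir0 : dir 0 = a0 by rewrite /dir gam0 ez scalerA mulVf ?scale1r// gt_eqF.
have cdir : {for 0, continuous dir}.
  apply: (@continuousZ _ _ _ (fun s => (enorm (gam s))^-1) gam); last exact: cg.
  apply: (@continuousV _ _ (fun s => enorm (gam s))); first by rewrite gt_eqF.
  exact: continuous_enorm cg.
(* The arc starts at [z]. Other deleted directions are avoided by continuity. The direction [a0]
   itself is avoided because the sphere meets that ray only at [z], whereas the component
   [r * sin s] of the arc along [e2] is positive. *)
have near_i (i : 'I_k) : \forall s \near (0 : R), 0 < s -> s < 1 -> dir s <> tnth a i.
  have [ai|ai] := eqVneq (tnth a i) a0; last first.
    have o1 : open (~` [set tnth a i] : set 'rV[R]_n.+1).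
      apply: closed_openC; apply: accessible_closed_set1; apply: hausdorff_accessible.
      exact: norm_hausdorff.
    have n1 : nbhs (dir 0) (~` [set tnth a i]).
      by apply: open_nbhs_nbhs; split => //; rewrite dir0 /= => E; rewrite E eqxx in ai.
    have n2 : \forall s \near (0 : R), (~` [set tnth a i]) (dir s) by exact: (cdir _ n1).
    by apply: filterS n2 => s ds _ _.
  suff h : forall s, 0 < s -> s < 1 -> dir s <> tnth a i by exact: (@filterE _ (nbhs (0 : R))).
  move=> s s0 s1; rewrite ai => E.
  have gE : gam s = enorm (gam s) *: a0.
    by rewrite -E /dir scalerA divff ?scale1r// gt_eqF.
  have h : esphere c r (enorm (gam s) *: a0) by rewrite -gE; exact: gS.
  have tE := esphere_ray_uniq a01 r0' cr (eg0 s) t0 h tS.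
  have gz : gam s = z by rewrite gE tE.
  have := congr1 (fun v => dotv (v - c) e2) gz.
  rewrite -re1 /gam /circle_arc [c + _]addrC addrK dotvDl !dotvZl o (enorm1_dotv u2) !mulr0 add0r mulr1.
  apply/eqP; rewrite gt_eqF// mulr_gt0// sin_gt0_pi// s0 /=.
  by apply: (lt_le_trans s1); apply: le_trans (pi_ge2 _); rewrite ler1n.
have near_all : \forall s \near (0 : R), forall i : 'I_k, 0 < s -> s < 1 -> dir s <> tnth a i.
  exact: (@filter_forall R _ (fun (i : 'I_k) s => 0 < s -> s < 1 -> dir s <> tnth a i)
    (nbhs (0 : R)) (nbhs_filter (0 : R)) near_i).
have [d /= d0 dB] := (nbhs_ballP _ _).1 near_all.
pose m : R := Num.min (d / 2) 2^-1.
have m0 : 0 < m by rewrite lt_min divr_gt0//= invr_gt0.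
have md : m <= d / 2 by rewrite ge_min lexx.
have m1 : m <= 2^-1 by rewrite ge_min lexx orbT.
have rng s : 0 < s <= m -> range x (gam s).
  move=> /andP[s0 sm]; apply: inR; first exact: gS.
  apply/negP => /tnthP[i iE].
  have sB : ball 0 d s.
    by rewrite -ball_normE /= sub0r normrN gtr0_norm//; move: d0 sm md; lra.
  have s1 : s < 1 by move: sm m1; lra.
  exact: (dB s sB i s0 s1 iE).
(* Parameters in the good range tending to 0; the arc has constant speed [r], so the points over
   them form a Cauchy sequence. *)
pose th (j : nat) : R := m / j.+1%:R.
have th0 j : 0 < th j by rewrite divr_gt0.
have thm j : 0 < th j <= m.
  by rewrite th0 ler_pdivrMr// ler_peMr ?(ltW m0)// ler1n.
have thS e : 0 < e -> exists K, forall i, (K <= i)%N -> th i < e.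
  move=> e0; exists (Num.bound (m / e)) => i Ki.
  have me : 0 <= m / e by rewrite divr_ge0 ?(ltW m0)// ltW.
  rewrite ltr_pdivrMr// mulrC -ltr_pdivrMr//.
  apply: (lt_le_trans (archi_boundP me)); rewrite ler_nat; exact: leq_trans Ki (leqnSn i).
have [p pE] : exists p : nat -> M, forall j, x (p j) = gam (th j).
  suff /choice[p Hp] : forall j, exists q, x q = gam (th j) by exists p.
  by move=> j; have [q _ <-] := rng _ (thm j); exists q.
have [|q qlim] := @complete p.
  move=> e e0; have er : 0 < e / r by rewrite divr_gt0.
  have [K HK] := thS _ er; exists K => i j Ki Kj.
  apply/(riemannian_dist_ltP ex).
  apply: (arc_dlt r0' Cg dg rng (thm i) (thm j) (pE i) (pE j)).
  rewrite mulrC -ltr_pdivlMr// ltr_norml.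
  by have := HK i Ki; have := HK j Kj; have := th0 i; have := th0 j; lra.
(* Chords are bounded by distances, so the limit on the manifold is mapped to the limit [z] of the
   arc; otherwise a third of their distance could be reached from both. *)
apply: znr; exists q => //; apply/eqP; rewrite -subr_eq0 -normr_le0 leNgt; apply/negP => dl.
pose del := `|x q - z| / 3.
have del0 : 0 < del by rewrite divr_gt0.
have /cvgrPdist_le/(_ _ del0) n1 := cg.
have [d' /= d'0 d'B] := (nbhs_ballP _ _).1 n1.
have [K1 HK1] := thS _ d'0; have [K2 HK2] := qlim _ del0.
pose i := maxn K1 K2.
have h1 : `|gam 0 - gam (th i)| <= del.
  apply: d'B; rewrite -ball_normE /= sub0r normrN gtr0_norm//; apply: HK1; exact: leq_maxl.
have /(riemannian_dist_ltP ex) h2 := HK2 i (leq_maxr _ _).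
have h3 : `|x q - x (p i)| <= del by exact: (path_dist_chord h2).
have h4 : `|x q - z| <= `|x q - x (p i)| + `|x (p i) - z| by exact: ler_distD.
rewrite pE in h3 h4; rewrite gam0 distrC in h1.
have := le_trans h4 (lerD h3 h1); rewrite /del.
by move: (`|x q - z|) dl => b b0; lra.
Qed.

End complete_sphere_graph.

Theorem corollary5p6 (R : realType) (n k : nat) (M : oriented_manifold R n)
    (x N : M -> 'rV[R]_n.+1)
    (mu : {measure set (g_sigma_algebraType (@open M)) -> \bar R}) :
  (2 <= n)%N ->
  connected [set: M] ->
  embedding x ->
  radial_graph k (range x) ->
  complete_induced_metric x ->
  unit_normal x N ->
  riemannian_volume x mu ->
  (exists C : R, forall p : M, norm_sff x N p <= C) ->
  (exists h : R, forall p : M, mean_curvature x N p = h) ->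
  mu.-integrable [set: M] (fun p => (enorm (tangent_proj x p (x p)))%:E) ->
  k = 0%N /\
  exists (c : 'rV[R]_n.+1) (r : R), 0 < r /\ range x = esphere c r.
Proof.
move=> n2 cM ex rg complete uN rv [C boundA] [H cmc] intx.
have n0 : (0 < n)%N by exact: leq_trans n2.
have sf0 := support_fun_neq0 ex uN rg.
have [sg [sg1 sgp]] := connected_sign cM (@continuous_support_fun _ _ _ _ _ ex uN) sf0.
have T0 p : traceless x N H p = 0.
  have := divergence_eq0 ex uN rv boundA cmc n0 complete intx p (fun p => ltW (sgp p)) sg1.
  rewrite /divergence => /eqP; rewrite mulf_eq0 => /orP[/eqP h|/eqP]; first by case: (sf0 p h).
  rewrite (defectE ex uN cmc n0) => h.
  exact: (mxtrace_sqr_sym_eq0 (traceless_sym ex uN H p) h).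
have W := umbilic_cst ex uN cM point T0.
have [a [u [_ _ _ u0 S]]] := rg.
(* A pair of antipodal directions over which the graph is defined. It excludes [H = 0], where the
   support function would have opposite signs at the two points, and otherwise puts the origin
   inside the sphere. *)
have [q [q1 qa qa']] := @sphere_avoid R n (tval a) n0.
have Oq : (unit_sphere R n.+1 `\` [set` a]) q.
  by split; [rewrite /unit_sphere /esphere /= subr0|exact/negP].
have Oq' : (unit_sphere R n.+1 `\` [set` a]) (- q).
  by split; [rewrite /unit_sphere /esphere /= subr0 -scaleN1r enormZ normrN1 mul1r|exact/negP].
have r1 : range x (u q *: q) by rewrite S; exists q.
have r2 : range x (u (- q) *: - q) by rewrite S; exists (- q).
have [H0|H0] := eqVneq H 0.
  exfalso; case: r1 => p1 _ x1; case: r2 => p2 _ x2.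
  have Np p : N p = N point by have := W p; rewrite H0 !scale0r !addr0.
  have := sgp p1; have := sgp p2; rewrite /support_fun !Np x1 x2 !dotvZl dotvNl.
  rewrite mulrCA (pmulr_rgt0 _ (u0 _ Oq')) mulrN oppr_gt0 => h1.
  by rewrite mulrCA (pmulr_rgt0 _ (u0 _ Oq)) ltNge (ltW h1).
(* The constant vector [N + H *: x] divided by [H]; then [x p - c] is [- H^-1 *: N p], of length
   [|H|^-1]. *)
pose c := H^-1 *: (N point + H *: x point).
have cE p : x p - c = - (H^-1 *: N p).
  by rewrite /c -(W p) scalerDr scalerA mulVf// scale1r opprD addrCA subrr addr0.
have sub : range x `<=` esphere c `|H|^-1.
  move=> _ [p _ <-]; rewrite /esphere /= cE -scaleNr enormZ normrN normfV.
  by case: uN => _ -> _; rewrite mulr1.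
have r0 : 0 < `|H|^-1 by rewrite invr_gt0 normr_gt0.
have cr := esphere_antipodal q1 (ltW r0) (u0 _ Oq) (u0 _ Oq') (sub _ r1) (sub _ r2).
have [k0 E] := complete_sphere_graph ex n0 complete rg sub r0 cr.
by split=> //; exists c, `|H|^-1.
Qed.
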